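(* Let $f\in C^1(\mathbb{R})$ and let $\Omega\subset\mathbb{R}^n$ be a smooth convex domain satisfying $$\limsup_{R\to+\infty}\frac{|\Omega\cap\{|x|\le R\}|}{R^2}<+\infty.$$ Let $u$ be a stable solution of $$-\Delta u=f(u)\ \text{ in }\Omega,\qquad \partial_\nu u=0\ \text{ on }\partial\Omega,\qquad u\in C^3(\overline\Omega),\ \nabla u\in L^\infty(\Omega).$$ 1. If $\Omega$ is not a straight cylinder, then $u$ is constant. 2. If $\Omega$ is a straight cylinder, then $u$ is either constant or a monotonic flat solution. If, in addition, $u$ is bounded, then it connects two stable roots $(z^-,z^+)$ of $f$ such that $\int_{z^-}^{z^+}f=0$.
   Context: $|\cdot|$ applied to a set is Lebesgue measure, and $\partial_\nu$ denotes the outward normal derivative on $\partial\Omega$. For a solution $u$, set $$\lambda_1:=\inf\Big\{\int_\Omega |\nabla\psi|^2-f'(u)\psi^2\ :\ \psi\in C^1_0(\overline\Omega),\ \|\psi\|_{L^2(\Omega)}=1\Big\},$$ where $C^1_0(\overline\Omega)$ is the space of continuously differentiable functions with compact support in $\overline\Omega$ (not necessarily vanishing on $\partial\Omega$). The solution $u$ is stable if $\lambda_1\ge0$. A straight cylinder is a domain which, up to a rigid motion, is of the form $\mathbb{R}\times\omega$ with $\omega\subset\mathbb{R}^{n-1}$. A solution is flat if it depends on a single scalar variable, i.e. $u(x)=g(x\cdot e)$ for some unit vector $e$ and some function $g$ of one variable; it is monotonic flat if moreover $g$ is monotone. A stable root of $f$ is $z\in\mathbb{R}$ with $f(z)=0$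 and $f'(z)\le 0$. A flat solution $u(x)=g(x\cdot e)$ connects $(z^-,z^+)$ if $x\cdot e$ takes all real values on $\Omega$ and $g(t)\to z^{\pm}$ as $t\to\pm\infty$ (for a constant solution, $z^-=z^+$ is its value). *)

(* Defs.v *)
From HB Require Import structures.
From mathcomp Require Import all_boot all_order all_algebra.
From mathcomp Require Import all_classical all_reals all_analysis.
From mathcomp Require Import measurable_realfun.

Set Implicit Arguments.
Unset Strict Implicit.
Unset Printing Implicit Defensive.

Import Order.TTheory GRing.Theory Num.Theory.
Import numFieldNormedType.Exports.

Local Open Scope classical_set_scope.
Local Open Scope ring_scope.

(* Row vectors carry the sigma-algebra generated by the coordinate maps, as
   n.-tuple does in the library; over the reals this is the Borel one. *)
Section measurable_rV.
Context (R : realType) (n : nat).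

Let coord : 'I_n -> 'rV[R]_n -> measurableTypeR R := fun i x => x ord0 i.

Let rV_set0 : g_sigma_preimage coord set0.
Proof. exact: sigma_algebra0. Qed.

Let rV_setC A : g_sigma_preimage coord A -> g_sigma_preimage coord (~` A).
Proof. exact: sigma_algebraC. Qed.

Let rV_bigcup (F : (set 'rV[R]_n)^nat) :
  (forall i, g_sigma_preimage coord (F i)) ->
  g_sigma_preimage coord (\bigcup_i (F i)).
Proof. exact: sigma_algebra_bigcup. Qed.

HB.instance Definition _ := @isMeasurable.Build default_measure_display
  'rV[R]_n (g_sigma_preimage coord) rV_set0 rV_setC rV_bigcup.

Lemma measurable_rV_coord (i : 'I_n) :
  measurable_fun setT (fun x : 'rV[R]_n => x ord0 i : measurableTypeR R).
Proof.
move=> _ Y mY; rewrite setTI; apply: sub_sigma_algebra => /=.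
rewrite -bigcup_seq/=; exists i => /=; first by rewrite mem_index_enum.
by exists Y => //; rewrite setTI.
Qed.

Lemma measurable_fun_rVP d (T : measurableType d) (f : T -> 'rV[R]_n) :
  (forall i, measurable_fun setT (fun t => f t ord0 i : measurableTypeR R)) ->
  measurable_fun setT f.
Proof.
move=> mf; apply: (@measurability _ _ _ _ _ _
  (\big[setU/set0]_(i < n) preimage_set_system setT (coord i) measurable)) => //.
move=> _ [A + <-]; rewrite -bigcup_seq => -[i _ [B mB <-]].
by rewrite setTI; have := mf i measurableT B mB; rewrite !setTI.
Qed.

End measurable_rV.

Lemma sigma_finite_product_measure1 d1 d2 (T1 : measurableType d1)
  (T2 : measurableType d2) (R : realType)
  (m1 : {sigma_finite_measure set T1 -> \bar R})
  (m2 : {sigma_finite_measure set T2 -> \bar R}) :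
  sigma_finite setT (m1 \x m2)%E.
Proof.
have /sigma_finiteP[F [TF ndF Foo]] := sigma_finiteT m1.
have /sigma_finiteP[G [TG ndG Goo]] := sigma_finiteT m2.
exists (fun n => F n `*` G n).
  rewrite -setXTT TF TG predeqE => -[x y]; split.
    move=> [/= [n _ Fnx] [k _ Gky]]; exists (maxn n k) => //; split.
    - by move: x Fnx; exact/subsetPset/ndF/leq_maxl.
    - by move: y Gky; exact/subsetPset/ndG/leq_maxr.
  by move=> [n _ []/= ? ?]; split; exists n.
move=> k; have [? ?] := Foo k; have [? ?] := Goo k.
split; first exact: measurableX.
by rewrite product_measure1E// lte_mul_pinfty// ge0_fin_numE.
Qed.

Section lebesgue_rV.
Context (R : realType).

Definition consrV n (p : measurableTypeR R * 'rV[R]_n) : 'rV[R]_n.+1 :=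
  row_mx (const_mx p.1 : 'rV[R]_1) p.2.

(* n-dimensional Lebesgue measure as the iterated product of the library's
   one-dimensional one, computed by slicing along the first coordinate *)
Fixpoint lebesgue_rV n : set 'rV[R]_n -> \bar R :=
  match n return set 'rV[R]_n -> \bar R with
  | 0 => fun A => \d_(0 : 'rV[R]_0) A
  | n'.+1 => fun A => (\int[@lebesgue_measure R]_t
      @lebesgue_rV n' [set y | A (consrV (t, y))])%E
  end.

Let unconsrV n (x : 'rV[R]_n.+1) : measurableTypeR R * 'rV[R]_n :=
  (x ord0 ord0, @rsubmx _ 1 1 n x).

Let unconsrVK n : cancel (@unconsrV n) (@consrV n).
Proof.
move=> x; rewrite -[RHS](@hsubmxK _ 1 1 n).
congr (@row_mx _ 1 1 n _ _); first by
  apply/rowP => i; rewrite !mxE ord1; congr (x _ _); apply/val_inj.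
Qed.

Let consrVK n : cancel (@consrV n) (@unconsrV n).
Proof.
move=> [t y]; rewrite /consrV /unconsrV /= row_mxKr; congr pair.
rewrite (_ : ord0 = @lshift 1 n ord0); last exact/val_inj.
by rewrite (@row_mxEl _ 1 1 n) mxE.
Qed.

Lemma measurable_consrV n : measurable_fun setT (@consrV n).
Proof.
apply: measurable_fun_rVP => i; rewrite /consrV.
have [j ->|j ->] := @split_ordP 1 n i.
  under eq_fun do rewrite (@row_mxEl _ 1 1 n) mxE.
  exact: measurable_fst.
under eq_fun do rewrite (@row_mxEr _ 1 1 n).
apply: (@measurableT_comp _ _ _ _ _ _ (fun y : 'rV[R]_n => y ord0 j)).
  exact: measurable_rV_coord.
exact: measurable_snd.
Qed.

Lemma measurable_unconsrV n : measurable_fun setT (@unconsrV n).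
Proof.
apply/measurable_fun_pairP; split => /=; first exact: measurable_rV_coord.
apply: measurable_fun_rVP => i /=.
under eq_fun do rewrite mxE.
exact: measurable_rV_coord.
Qed.

Lemma lebesgue_rVS n : @lebesgue_rV n.+1 =
  pushforward (@lebesgue_measure R \x @lebesgue_rV n)%E (@consrV n).
Proof.
apply/funext => A; rewrite /pushforward /product_measure1 /=.
apply: eq_integral => t _ /=; congr lebesgue_rV.
by apply/seteqP; split => y; rewrite /xsection /= inE.
Qed.

Let lebesgue_rV_spec n : [/\ @lebesgue_rV n set0 = 0%E,
  forall A, (0 <= @lebesgue_rV n A)%E,
  semi_sigma_additive (@lebesgue_rV n) & sigma_finite setT (@lebesgue_rV n)].
Proof.
elim: n => [|n [m0 m_ge0 m_sigma mfin]].
  split; [exact: measure0|by move=> A; exact: measure_ge0|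
    exact: measure_semi_sigma_additive|exact: sigma_finiteT].
pose mM := isMeasure.Build _ _ _ (@lebesgue_rV n) m0 m_ge0 m_sigma.
pose m' : {measure set 'rV[R]_n -> \bar R} := HB.pack (@lebesgue_rV n) mM.
pose mS := Measure_isSigmaFinite.Build _ _ _ m' mfin.
pose m : {sigma_finite_measure set 'rV[R]_n -> \bar R} :=
  HB.pack (@lebesgue_rV n) mM mS.
rewrite lebesgue_rVS -/(m : set _ -> \bar R).
have -> : @lebesgue_rV n = m by [].
pose mc := @measurable_consrV n.
split.
- by rewrite /pushforward preimage_set0 measure0.
- by move=> A; exact: measure_ge0.
- move=> F mF tF mUF; rewrite /pushforward preimage_bigcup.
  apply: measure_semi_sigma_additive.
  + by move=> k; rewrite -[X in measurable X]setTI; exact: mc.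
  + apply/trivIsetP => /= i j _ _ ij; rewrite -preimage_setI.
    by move/trivIsetP : tF => /(_ _ _ _ _ ij) ->//; rewrite preimage_set0.
  + by rewrite -preimage_bigcup -[X in measurable X]setTI; exact: mc.
- have [G GT Gfin] :=
    sigma_finite_product_measure1 (@lebesgue_measure R) m.
  exists (fun k => @unconsrV n @^-1` G k).
    by rewrite -preimage_bigcup -GT preimage_setT.
  move=> k; have [mG Gk] := Gfin k; split.
    by rewrite -[X in measurable X]setTI; exact: measurable_unconsrV.
  rewrite /pushforward -comp_preimage.
  rewrite (_ : _ \o _ = id) ?preimage_id//.
  by apply/funext => p /=; rewrite consrVK.
Qed.

HB.instance Definition _ n := isMeasure.Build _ _ _ (@lebesgue_rV n)
  (let: And4 h _ _ _ := lebesgue_rV_spec n in h)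
  (let: And4 _ h _ _ := lebesgue_rV_spec n in h)
  (let: And4 _ _ h _ := lebesgue_rV_spec n in h).

HB.instance Definition _ n := Measure_isSigmaFinite.Build _ _ _ (@lebesgue_rV n)
  (let: And4 _ _ _ h := lebesgue_rV_spec n in h).

Lemma lebesgue_rV_box n (A : 'I_n -> set (measurableTypeR R)) :
  (forall i, measurable (A i)) ->
  @lebesgue_rV n [set x | forall i, A i (x ord0 i)] =
  (\prod_(i < n) @lebesgue_measure R (A i))%E.
Proof.
elim: n A => [|n IH] A mA.
  rewrite big_ord0 /= diracE mem_set//= => -[].
  by [].
pose B : set 'rV[R]_n := [set y | forall i, A (lift ord0 i) (y ord0 i)].
have sliceE t : [set y : 'rV[R]_n | forall i, A i (consrV (t, y) ord0 i)] =
    if t \in A ord0 then B else set0.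
  have E0 (y : 'rV[R]_n) : consrV (t, y) ord0 ord0 = t.
    transitivity (consrV (t, y) ord0 (@lshift 1 n ord0)).
      by congr (consrV _ _ _); exact/val_inj.
    by rewrite /consrV (@row_mxEl _ 1 1 n) mxE.
  have E1 (y : 'rV[R]_n) i : consrV (t, y) ord0 (lift ord0 i) = y ord0 i.
    transitivity (consrV (t, y) ord0 (@rshift 1 n i)).
      by congr (consrV _ _ _); exact/val_inj.
    by rewrite /consrV (@row_mxEr _ 1 1 n).
  apply/seteqP; split => y /=.
    move=> h; have := h ord0; rewrite E0 => tA; rewrite mem_set// => i.
    by have := h (lift ord0 i); rewrite E1.
  case: ifPn => //; rewrite inE => tA h i.
  by have [j ->|->] := unliftP ord0 i; rewrite ?E1 ?E0//; exact: h.
rewrite big_ord_recl /=.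
rewrite (eq_integral (fun t => (\1_(A ord0) t)%:E * lebesgue_rV B)%E); last first.
  move=> t _; rewrite [X in lebesgue_rV X]sliceE indicE.
  by case: ifPn => _; rewrite ?mul1e ?mul0e ?measure0.
rewrite ge0_integralZr//; last exact/measurable_EFinP/measurable_indic.
rewrite integral_indic// setIT; congr (_ * _)%E.
by apply: (IH (fun i => A (lift ord0 i))) => i; exact: mA.
Qed.

End lebesgue_rV.

Section euclidean.
Context (R : realType) (n : nat).
Implicit Types x y : 'rV[R]_n.

Definition dotv x y : R := \sum_(i < n) x ord0 i * y ord0 i.

(* the norm [`|x|] of the library on matrices is the sup norm *)
Definition enorm x : R := Num.sqrt (dotv x x).

End euclidean.

Section differential_operators.
Context (R : realType) (n : nat).
Implicit Types (g : 'rV[R]_n.+1 -> R) (x : 'rV[R]_n.+1).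

Definition partial (i : 'I_n.+1) g : 'rV[R]_n.+1 -> R :=
  fun x => 'D_(delta_mx ord0 i) g x.

Definition partials (s : seq 'I_n.+1) g : 'rV[R]_n.+1 -> R :=
  foldr partial g s.

Definition grad g x : 'rV[R]_n.+1 := \row_i partial i g x.

Definition laplacian g x : R := \sum_i partials [:: i; i] g x.

End differential_operators.

Section regularity.
Context (R : realType) (n : nat).
Implicit Types (U Omega : set 'rV[R]_n.+1) (g : 'rV[R]_n.+1 -> R).

Definition Ck_on (k : nat) U g :=
  forall s : seq 'I_n.+1, (size s <= k)%N ->
    (forall x, U x -> {for x, continuous (partials s g)}) /\
    ((size s < k)%N -> forall i x, U x ->
       derivable (partials s g) x (delta_mx ord0 i)).

Definition smooth_on U g := forall k, Ck_on k U g.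

(* C^k up to the boundary: the partial derivatives of order at most k, which
   make sense in the open set Omega only, extend continuously to its closure *)
Definition Ck_closure (k : nat) Omega g :=
  [/\ Ck_on k Omega g,
      {within closure Omega, continuous g} &
      forall s : seq 'I_n.+1, (size s <= k)%N ->
        exists2 h : 'rV[R]_n.+1 -> R, {within closure Omega, continuous h} &
          forall x, Omega x -> h x = partials s g x].

(* gradient extended by continuity from Omega to its closure *)
Definition grad_closure Omega g (x : 'rV[R]_n.+1) : 'rV[R]_n.+1 :=
  \row_i lim (partial i g @ within Omega (nbhs x)).

Definition C1_0_closure Omega g :=
  Ck_closure 1 Omega g /\ compact (closure [set x | closure Omega x /\ g x != 0]).

End regularity.

Section domains.
Context (R : realType) (n : nat).
Implicit Types (Omega : set 'rV[R]_n.+1) (x nu : 'rV[R]_n.+1).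

Definition is_domain Omega := [/\ open Omega, Omega !=set0 & connected Omega].

Definition frontier Omega : set 'rV[R]_n.+1 := closure Omega `\` interior Omega.

(* Near x the set Omega is {phi < 0} for a regular smooth phi, so that grad phi
   points outwards. *)
Definition local_defining_function Omega x (U : set 'rV[R]_n.+1)
    (phi : 'rV[R]_n.+1 -> R) :=
  [/\ open U, U x, smooth_on U phi, grad phi x != 0 &
      forall y, U y -> (Omega y <-> phi y < 0)].

Definition smooth_boundary Omega :=
  forall x, frontier Omega x ->
    exists U phi, local_defining_function Omega x U phi.

Definition outward_normal Omega x nu :=
  exists U phi, local_defining_function Omega x U phi /\
    nu = (enorm (grad phi x))^-1 *: grad phi x.

Definition rigid_motion (Q : 'M[R]_n.+1) (b : 'rV[R]_n.+1) x : 'rV[R]_n.+1 :=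
  x *m Q + b.

Definition straight_cylinder Omega :=
  exists (Q : 'M[R]_n.+1) (b : 'rV[R]_n.+1) (omega : set 'rV[R]_n),
    Q *m Q^T = 1%:M /\
    Omega = rigid_motion Q b @` [set x | omega (@rsubmx _ 1 1 n x)].

Definition quadratic_growth Omega :=
  (limf_esup (fun r : R =>
     @lebesgue_rV R n.+1 (Omega `&` [set x | (enorm x <= r)%R])
       * (r ^- 2)%:E) (pinfty_nbhs R) < +oo)%E.

End domains.

Section semilinear_neumann.
Context (R : realType) (n : nat).
Variables (f : R -> R) (Omega : set 'rV[R]_n.+1) (u : 'rV[R]_n.+1 -> R).

Definition C1_R := (forall t, derivable f t 1) /\ continuous (derive1 f).

Definition neumann_solution :=
  [/\ forall x, Omega x -> - laplacian u x = f (u x),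
      forall x nu, frontier Omega x -> outward_normal Omega x nu ->
        dotv (grad_closure Omega u x) nu = 0,
      Ck_closure 3 Omega u &
      exists M : R, \forall x \ae (@lebesgue_rV R n.+1),
        Omega x -> enorm (grad u x) <= M].

Definition L2norm (psi : 'rV[R]_n.+1 -> R) : \bar R :=
  ('N[@lebesgue_rV R n.+1]_2%:E[(fun x => (psi x * \1_Omega x)%:E)])%E.

Definition energy (psi : 'rV[R]_n.+1 -> R) : \bar R :=
  (\int[@lebesgue_rV R n.+1]_(x in Omega)
     (enorm (grad psi x) ^+ 2 - derive1 f (u x) * psi x ^+ 2)%:E)%E.

Definition lambda1 : \bar R :=
  ereal_inf (energy @` [set psi | C1_0_closure Omega psi /\ L2norm psi = 1%E]).

Definition stable := (0 <= lambda1)%E.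

Definition constant_sol := exists c : R, forall x, closure Omega x -> u x = c.

Definition flat_profile (e : 'rV[R]_n.+1) (g : R -> R) :=
  enorm e = 1 /\ forall x, closure Omega x -> u x = g (dotv x e).

Definition monotone (g : R -> R) :=
  {homo g : s t / s <= t} \/ {homo g : s t /~ s <= t}.

Definition monotonic_flat := exists e g, flat_profile e g /\ monotone g.

Definition bounded_sol := exists M : R, forall x, Omega x -> `|u x| <= M.

Definition connects (zm zp : R) :=
  (zm = zp /\ forall x, closure Omega x -> u x = zm) \/
  exists e g, [/\ flat_profile e g,
    forall t : R, exists2 x, Omega x & dotv x e = t,
    g t @[t --> -oo] --> zm & g t @[t --> +oo] --> zp].

Definition stable_root (z : R) := f z = 0 /\ derive1 f z <= 0.

Definition oriented_integral (a b : R) : R :=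
  if a <= b then \int[@lebesgue_measure R]_(t in `[a, b]) f t
  else - \int[@lebesgue_measure R]_(t in `[b, a]) f t.

End semilinear_neumann.

(* Main.v *)
(* Write W = grad (|grad u|^2 / 2). The Neumann condition and the convexity of the domain
   give W . nu <= 0 on the boundary, so that the quadratic form Q of the second variation
   satisfies sum_i Q (eta d_i u) <= int |grad u|^2 |grad eta|^2 for every cutoff eta.
   Since the volume growth is quadratic, there are cutoffs exhausting the domain whose
   Dirichlet energy tends to 0; as Q >= 0, every directional derivative v of u is a limit
   of null vectors of Q, and so is |v|, hence |v| solves the linearized equation weakly.
   A barrier argument then shows that v vanishes identically or nowhere, so grad u has a
   constant direction e and v = d_e u > 0 unless u is constant. If e were transversal to
   the boundary somewhere, v would vanish there and, the flux of v grad psi being 0, the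
   barrier argument would apply at a boundary point as well, a contradiction. So e is
   tangent to the boundary everywhere, the domain is invariant under translations along
   e, and u is an increasing solution of g'' = - f (g) along e; the conservation of
   g'^2 / 2 + F (g) gives the statement on the limits of g. *)
Require Import Defs.
From HB Require Import structures.
From mathcomp Require Import all_boot all_order all_algebra.
From mathcomp Require Import all_classical all_reals all_analysis.
From mathcomp Require Import measurable_realfun.
From mathcomp Require Import ring lra.
Import Order.TTheory GRing.Theory Num.Theory.
Import numFieldNormedType.Exports.
Set Implicit Arguments.
Unset Strict Implicit.
Unset Printing Implicit Defensive.
Local Open Scope classical_set_scope.
Local Open Scope ring_scope.

(** * Lebesgue measure on row vectors *)

(** Only classical functions are used, without traces on the frontier or weak derivatives. Boundary
    integrals are replaced by a cutoff [sstep (- m phi)] in a local defining function [phi]; the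
    term it creates is controlled as soon as the field [X] satisfies [X . grad phi <= C |phi|]
    inside the domain, and this follows from bounds on [X] and its first derivatives and from the
    sign of its boundary values. For [W] these bounds use the limits of three derivatives of [u] at
    the frontier. As [|v|] is not differentiable, it is approached by [sqrt (v ^ 2 + k ^ 2)] and all
    derivatives are moved to the test function. The cutoffs of small energy are averages of dyadic
    ones, a discrete form of the logarithmic cutoff of the plane: quadratic growth bounds the energy
    of each independently of its scale. The strong maximum principle and Hopf's lemma are both
    replaced by one integral argument with a radial function slightly more singular than the
    fundamental solution; of a nonnegative weak solution it only asks to be [O(|x - y|)] at the
    point [y], interior or not. *)

Lemma normv_leP (R : realType) n (x : 'rV[R]_n) (r : R) : 0 <= r ->
  (`|x| <= r) <-> (forall i, `|x ord0 i| <= r).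
Proof.
move=> r0; rewrite -[`|x|]/(mx_norm x) mx_normrE; split=> [h i|h].
  apply: le_trans _ h.
  exact: (le_bigmax _ (fun ij : 'I_1 * 'I_n => `|x ij.1 ij.2|) (ord0, i)).
apply/bigmax_leP; split=> // -[a b] _ /=; by rewrite ord1.
Qed.

Lemma coord_le_norm (R : realType) n (x : 'rV[R]_n) i : `|x ord0 i| <= `|x|.
Proof. by move: i; apply/(normv_leP x (normr_ge0 x)). Qed.

Lemma is_derive_line (R : realType) (V : normedModType R) (f : V -> R)
  (x v : V) (t0 d : R) :
  is_derive (t0 *: v + x) v f d <-> is_derive t0 1 (fun t : R => f (t *: v + x)) d.
Proof.
have E : (fun h : R => h^-1 *: ((f \o shift (t0 *: v + x)) (h *: v) - f (t0 *: v + x)))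
   = (fun h : R => h^-1 *: (((fun t : R => f (t *: v + x)) \o shift t0) (h *: 1) - f (t0 *: v + x))).
  apply/funext => h /=; congr (_ *: (f _ - _)).
  by rewrite addrA -scalerDl; congr (_ *: _ + _); rewrite [_ *: _]mulr1.
split=> -[h1 h2]; split.
- by rewrite /derivable -E.
- by rewrite /derive -E.
- by rewrite /derivable E.
- by rewrite /derive E.
Qed.

Lemma is_derive_locally0 (R : realType) (V : normedModType R) (f : V -> R)
  (x v : V) (d : R) : (\near x, f x = 0) -> is_derive x v f d -> d = 0.
Proof.
move=> f0 fd; have h : is_derive x v (cst 0) d.
  by apply: near_eq_is_derive fd; near=> y; near: y; apply: f0.
have [_ <-] := h; have h0 := @is_derive_cst _ V R 0 x v.
by have [_ ->] := h0.
Unshelve. all: by end_near. Qed.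

Lemma nonexpansive_continuous (R : realType) (V W : normedModType R) (f : V -> W) :
  (forall x y, `|f x - f y| <= `|x - y|) -> continuous f.
Proof.
move=> h x; apply/cvgrPdist_lt => e e0; near=> z.
by apply: le_lt_trans (h _ _) _; near: z; apply: cvgr_dist_lt.
Unshelve. all: by end_near. Qed.

Lemma near_norm_gt (R : realType) (V : normedModType R) (x : V) (r : R) :
  r < `|x| -> \forall y \near x, r < `|y|.
Proof. by move=> rx; exact: (@cvgr_gt _ _ (nbhs x) _ (fun y => `|y|) `|x| (@norm_continuous _ _ x) r rx). Qed.

Lemma measurable_box_rV (R : realType) n (A : 'I_n -> set (measurableTypeR R)) :
  (forall i, measurable (A i)) ->
  measurable [set x : 'rV[R]_n | forall i, A i (x ord0 i)].
Proof.
move=> mA; rewrite (_ : [set x | _] =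
  \big[setI/setT]_(i < n) ((fun x : 'rV[R]_n => x ord0 i) @^-1` A i)).
  apply: bigsetI_measurable => i _.
  by rewrite -[X in measurable X]setTI; exact: measurable_rV_coord.
apply/seteqP; split=> x /=; rewrite -bigcap_seq /=.
  by move=> h i _; exact: h.
by move=> h i; apply: h => /=; rewrite mem_index_enum.
Qed.

(** Measurable sets are generated by coordinate preimages only, so the open set is written as the
    countable union of the boxes with rational centre and radius [1 / (k + 1)] that it contains. *)
Lemma open_measurable_rV (R : realType) n (U : set 'rV[R]_n) :
  open U -> measurable U.
Proof.
move=> oU.
pose box (p : 'rV[rat]_n * nat) := [set x : 'rV[R]_n | forall i,
   (@ball R R (ratr (p.1 ord0 i)) (p.2.+1%:R^-1)) (x ord0 i)].
pose F p := if `[< box p `<=` U >] then box p else set0.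
rewrite (_ : U = \bigcup_p F p).
  apply: countable_bigcupT_measurable; first exact: countableP.
  move=> p; rewrite /F; case: ifP => // _.
  apply: (@measurable_box_rV R n (fun i => @ball R R (ratr (p.1 ord0 i)) (p.2.+1%:R^-1))) => i.
  exact: measurable_ball.
apply/seteqP; split=> x; last first.
  by move=> [p _]; rewrite /F; case: asboolP => // h /h.
move=> Ux; have /nbhs_ballP[e /= e0 xeU] : nbhs x U by exact: open_nbhs_nbhs.
have [k _ ke] : \forall k \near \oo, (k.+1%:R^-1 : R) < e / 2.
  by exact: (near_infty_natSinv_lt (PosNum (divr_gt0 e0 (ltr0Sn _ 1)))).
have {}ke := ke k (leqnn k).
have d0 : 0 < (k.+1%:R^-1 : R) by rewrite invr_gt0.
have H i : exists q : rat, x ord0 i < ratr q < x ord0 i + k.+1%:R^-1.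
  have [q ] := @rat_in_itvoo R (x ord0 i) (x ord0 i + k.+1%:R^-1) (ltac:(by rewrite ltrDl)).
  by rewrite in_itv /= => h; exists q.
pose q : 'rV[rat]_n := \row_i projT1 (cid (H i)).
have qP i : x ord0 i < ratr (q ord0 i) < x ord0 i + k.+1%:R^-1.
  by rewrite mxE; case: (cid (H i)).
exists (q, k) => //; rewrite /F.
case: asboolP => [_ i|h].
  rewrite /= /ball/= /ball_ ltr_norml.
  by have /andP[] := qP i; move: (k.+1%:R^-1) => d ? ?; apply/andP; split; lra.
exfalso; apply: h => y yb; apply: xeU; split=> // i j.
rewrite ord1 /ball/= /ball_; have := yb j; rewrite /ball/= /ball_ !ltr_norml.
by have /andP[] := qP j; move: (k.+1%:R^-1) ke => d ? ? ? /andP[? ?]; apply/andP; split; lra.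
Qed.

Lemma continuous_measurable_rV (R : realType) n (D : set 'rV[R]_n) (f : 'rV[R]_n -> R) :
  open D -> (forall x, D x -> {for x, continuous f}) -> measurable_fun D f.
Proof.
move=> oD cf; apply: (measurability _ (RGenOInfty.measurableE R)).
move=> _ [_ [a ->] <-]; apply: open_measurable_rV.
rewrite openE => x [Dx /= fx]; rewrite /interior.
apply: filterI; first exact: open_nbhs_nbhs.
by apply: (cf x Dx); apply: open_nbhs_nbhs; split=> //; exact: rray_open.
Qed.

Lemma lebesgue_ball_le (R : realType) n (D : set 'rV[R]_n) (y : 'rV[R]_n) (r : R) : 0 <= r ->
  measurable D -> (forall x, D x -> `|x - y| <= r) ->
  (@lebesgue_rV R n D <= ((2 * r) ^+ n)%:E)%E.
Proof.
move=> r0 mD Dr.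
have /= := @lebesgue_rV_box R n (fun i => `[y ord0 i - r, y ord0 i + r]%classic) (fun _ => measurable_itv _).
rewrite (eq_bigr (fun _ => (2 * r)%:E)); last first.
  by move=> i _; rewrite lebesgue_measure_itv /= lte_fin; case: ifPn => h;
    [congr EFin; lra| congr EFin; move: h; rewrite -leNgt; lra].
rewrite -(big_morph EFin EFinM erefl) prodr_const card_ord => <-.
apply: le_measure; rewrite ?inE//.
  by apply: (measurable_box_rV (A := fun i => `[y ord0 i - r, y ord0 i + r]%classic)) => i; exact: measurable_itv.
move=> x /Dr h i; rewrite /= in_itv /=.
have : `|x ord0 i - y ord0 i| <= r by move: h => /(normv_leP _ r0)/(_ i); rewrite !mxE.
by rewrite ler_norml => /andP[? ?]; apply/andP; split; lra.
Qed.

Lemma integrable_bounded_rV (R : realType) n (D : set 'rV[R]_n) (F : 'rV[R]_n -> R) (M r : R) :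
  open D -> (forall x, D x -> {for x, continuous F}) ->
  (forall x, D x -> `|F x| <= M) -> (forall x, D x -> r < `|x| -> F x = 0) ->
  (@lebesgue_rV R n).-integrable D (EFin \o F).
Proof.
move=> oD cF FM Fr; have mF := continuous_measurable_rV oD cF.
have mD := open_measurable_rV oD.
apply/integrableP; split; first exact/measurable_EFinP.
pose B := [set x : 'rV[R]_n | forall i, `[- `|r|, `|r|]%classic (x ord0 i)].
have mB : measurable B by apply: (measurable_box_rV (A := fun _ => `[-`|r|, `|r|]%classic)).
have BP x : B x <-> `|x| <= `|r|.
  rewrite normv_leP //; split=> h i; have := h i; rewrite /= ?in_itv /= ?ler_norml //.
apply: (@le_lt_trans _ _ (\int[@lebesgue_rV R n]_(x in D `&` B) (cst `|M|%:E x))%E).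
  rewrite integral_mkcondr; apply: ge0_le_integral => //.
  - by apply/measurable_EFinP; apply: measurableT_comp.
  - by apply/measurable_restrict => //; apply: measurable_cst.
  - move=> x Dx; rewrite ?patchE; case: ifPn; rewrite ?lee_fin.
      by move=> _; exact: le_trans (FM _ Dx) (ler_norm _).
    move/negP; rewrite inE BP => /negP; rewrite -ltNge => h.
    by rewrite Fr ?normr0 //; apply: le_lt_trans h; exact: ler_norm.
rewrite integral_cst; last exact: measurableI.
apply: lte_mul_pinfty => //.
apply: le_lt_trans (@lebesgue_ball_le R n _ 0 `|r| (normr_ge0 r) (measurableI _ _ mD mB) _) _.
  by move=> x [_ /BP]; rewrite subr0.
exact: ltry.
Qed.

Lemma continuous_bounded_supp (R : realType) n (F : 'rV[R]_n -> R) (r : R) :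
  continuous F -> (forall x, r < `|x| -> F x = 0) ->
  exists M, forall x, `|F x| <= M.
Proof.
move=> cF Fr; pose K := [set x : 'rV[R]_n | `|x| <= r].
have cK : compact K.
  apply: bounded_closed_compact.
    exists r; split; first exact: num_real.
    by move=> M rM x /= xr; apply: le_trans xr (ltW rM).
  rewrite (_ : K = (fun x : 'rV[R]_n => `|x|) @^-1` [set t | t <= r])//.
  by apply: closed_comp => [x _|]; [exact: norm_continuous|exact: closed_le].
have /compact_bounded[M [_ MK]] : compact (F @` K).
  by apply: continuous_compact => //; exact: continuous_subspaceT.
exists (Num.max (M + 1) 0) => x; rewrite le_max; have [xr|xr] := leP `|x| r.
  by rewrite MK ?ltrDl//; exists x.
by rewrite Fr // normr0 lexx orbT.
Qed.

Lemma consrV_continuous2 (R : realType) n (t : R) : continuous (fun y : 'rV[R]_n => consrV (t, y)).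
Proof.
apply: nonexpansive_continuous => y z.
rewrite (normv_leP _ (normr_ge0 _)) => i; rewrite !mxE.
case: splitP => j _; rewrite ?mxE ?subrr ?normr0//.
by have := coord_le_norm (y - z) j; rewrite !mxE.
Qed.

Lemma consrV_norm_ge (R : realType) n (t : R) (y : 'rV[R]_n) :
  `|t| <= `|consrV (t, y)| /\ `|y| <= `|consrV (t, y)|.
Proof.
split; last first.
  rewrite (normv_leP _ (normr_ge0 _)) => i.
  by have := coord_le_norm (consrV (t, y)) (rshift 1 i); rewrite (@row_mxEr _ 1 1 n).
have := coord_le_norm (consrV (t, y)) (@lshift 1 n ord0).
by rewrite (@row_mxEl _ 1 1 n) mxE.
Qed.

Lemma consrV_line0 (R : realType) n (j : 'I_1) (s : R) (y : 'rV[R]_n) :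
  consrV (s, y) = s *: delta_mx ord0 (lshift n j) + consrV (0, y) :> 'rV[R]_(1 + n).
Proof.
apply/rowP => k; rewrite !mxE ord1; case: splitP => k' kE; rewrite ?mxE ?ord1.
  rewrite (_ : k == _); last by apply/eqP/val_inj => /=; rewrite kE !ord1.
  by rewrite eqxx /= mulr1 addr0.
rewrite (_ : k == _ = false) ?andbF ?mulr0 ?add0r//.
by apply/eqP => /(congr1 val) /=; rewrite kE.
Qed.

Lemma consrV_lineS (R : realType) n (j : 'I_n) (t s : R) (y : 'rV[R]_n) :
  consrV (t, s *: delta_mx ord0 j + y) =
  s *: delta_mx ord0 (rshift 1 j) + consrV (t, y) :> 'rV[R]_(1 + n).
Proof.
apply/rowP => k; rewrite !mxE ord1; case: splitP => k' kE; rewrite ?mxE ?ord1.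
  rewrite (_ : k == _ = false) ?andbF ?mulr0 ?add0r//.
  by apply/eqP => /(congr1 val) /=; rewrite kE ord1.
congr (_ * _ + _); rewrite !eqxx /=; congr (nat_of_bool _)%:R.
apply/eqP/eqP => [kj|/(congr1 val) /=]; first by apply/val_inj => /=; rewrite kE kj.
by rewrite kE => -[]; exact: val_inj.
Qed.

Lemma is_derive_consrV0 (R : realType) n (j : 'I_1) (F dF : 'rV[R]_(1 + n) -> R) (t : R) (y : 'rV[R]_n) :
  (forall x, is_derive x (delta_mx ord0 (lshift n j)) F (dF x)) ->
  is_derive t 1 (fun t : R => F (consrV (t, y))) (dF (consrV (t, y))).
Proof.
move=> FdF; under eq_fun do rewrite (consrV_line0 j).
by rewrite -is_derive_line -consrV_line0; exact: FdF.
Qed.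

Lemma is_derive_consrVS (R : realType) n (j : 'I_n) (F dF : 'rV[R]_(1 + n) -> R) (t : R) (y : 'rV[R]_n) :
  (forall x, is_derive x (delta_mx ord0 (rshift 1 j)) F (dF x)) ->
  is_derive y (delta_mx ord0 j) (fun y : 'rV[R]_n => F (consrV (t, y))) (dF (consrV (t, y))).
Proof.
move=> FdF; have := FdF (consrV (t, y)).
rewrite -{1}[consrV _]add0r -(scale0r (delta_mx ord0 (rshift 1 j))).
move/is_derive_line => h; rewrite -{1}[y]add0r -{1}(scale0r (delta_mx ord0 j)).
by apply/is_derive_line; under eq_fun do rewrite consrV_lineS.
Qed.

Lemma consrV_continuous1 (R : realType) n (y : 'rV[R]_n) : continuous (fun t : R => consrV (t, y)).
Proof.
apply: nonexpansive_continuous => t z.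
rewrite (normv_leP _ (normr_ge0 _)) => k; rewrite !mxE.
by case: splitP => k' _; rewrite ?mxE ?subrr ?normr0.
Qed.

Lemma integral_slice0 (R : realType) (F dF : R -> R) (r : R) :
  (forall x : R, is_derive x 1 F (dF x)) -> continuous dF ->
  (forall x, r < `|x| -> F x = 0) ->
  (\int[@lebesgue_measure R]_t (dF t)%:E = 0)%E.
Proof.
move=> der cty Fr.
have dFr x : r < `|x| -> dF x = 0.
  move=> rx; apply: (is_derive_locally0 _ (der x)); near=> y; apply: Fr.
  by near: y; exact: (@near_norm_gt R R x r rx).
pose b : R := `|r| + 1.
have b0 : 0 < b by rewrite /b ltr_wpDl.
have rb : r < b by rewrite /b; apply: le_lt_trans (ler_norm r) _; rewrite ltrDl.
rewrite (_ : (\int[_]_t _)%E = (\int[@lebesgue_measure R]_(t in `[(- b)%R, b]) (dF t)%:E)%E); last first.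
  rewrite [RHS]integral_mkcond; apply: eq_integral => t _; rewrite patchE.
  case: ifPn => // /negP; rewrite inE /= in_itv /= -ler_norml => /negP; rewrite -ltNge => bt.
  by rewrite dFr //; exact: lt_trans bt.
rewrite (@continuous_FTC2 _ _ F).
+ by rewrite !Fr ?sube0 ?subee ?normrN ?gtr0_norm.
+ by rewrite gtrN.
+ by apply: continuous_subspaceT.
+ have cF t : {for t, continuous F}.
    by apply: differentiable_continuous; apply/derivable1_diffP; have [] := der t.
  split.
  * by move=> t _; have [] := der t.
  * by apply: cvg_at_right_filter; exact: cF.
  * by apply: cvg_at_left_filter; exact: cF.
+ by move=> t _; rewrite derive1E; have [_ ->] := der t.
Unshelve. all: by end_near. Qed.

(** Induction on the dimension with Fubini: a derivative in the first coordinate is killed by the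
    inner one-dimensional integral, a derivative in a later coordinate by the induction hypothesis
    on each slice. *)
Lemma integral_partial0 (R : realType) n (i : 'I_n) (F dF : 'rV[R]_n -> R) (r : R) :
  (forall x, is_derive x (delta_mx ord0 i) F (dF x)) -> continuous dF ->
  (forall x, r < `|x| -> F x = 0) ->
  (\int[@lebesgue_rV R n]_x (dF x)%:E = 0)%E.
Proof.
elim: n i F dF => [|n IH] i F dF FdF cdF Fr; first by case: i {FdF}.
have dFr x : r < `|x| -> dF x = 0.
  move=> rx; apply: (is_derive_locally0 _ (FdF x)); near=> y; apply: Fr.
  by near: y; exact: (@near_norm_gt R 'rV[R]_n.+1 x r rx).
have [M dFM] := continuous_bounded_supp cdF dFr.
have iF : (@lebesgue_rV R n.+1).-integrable setT (EFin \o dF).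
  by apply: (@integrable_bounded_rV _ _ _ _ M r) => //; [exact: openT|move=> x _; exact: cdF|
     move=> x _; exact: dFr].
have mF : measurable_fun setT dF.
  by apply: continuous_measurable_rV; [exact: openT|move=> x _; exact: cdF].
have mEF : measurable_fun setT (EFin \o dF) by apply/measurable_EFinP.
have iP : (@lebesgue_measure R \x @lebesgue_rV R n)%E.-integrable setT ((EFin \o dF) \o @consrV R n).
  have mP : measurable_fun setT ((EFin \o dF) \o @consrV R n).
    exact: (measurableT_comp mEF (@measurable_consrV R n)).
  apply/integrableP; split => //.
  have /integrableP[_] := iF; rewrite lebesgue_rVS ge0_integral_pushforward //.
    by apply: measurable_consrV.
  by apply: measurableT_comp.
have -> : (\int[@lebesgue_rV R n.+1]_x (dF x)%:E = 
    \int[(@lebesgue_measure R \x @lebesgue_rV R n)]_p (dF (consrV p))%:E)%E.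
  by rewrite [in LHS]lebesgue_rVS (integral_pushforward (@measurable_consrV R n) mEF) ?preimage_setT.
move: FdF; have [j ->|j ->] := @split_ordP 1 n i => FdF.
- rewrite -(integral21_prod_meas1 iP) /fubini_G /=.
  rewrite (eq_integral (cst 0%E)) ?integral_cst ?mul0e // => y _ /=.
  apply: (@integral_slice0 R (fun t : R => F (consrV (t, y))) _ r).
  + by move=> t; exact: (is_derive_consrV0 _ _ FdF).
  + move=> t; apply: (@continuous_comp R 'rV[R]_n.+1 R) (cdF _).
    exact: consrV_continuous1.
  + move=> t rt; apply: Fr; apply: lt_le_trans rt _.
    by have [] := consrV_norm_ge t y.
- rewrite -(integral12_prod_meas1 iP) /fubini_F /=.
  rewrite (eq_integral (cst 0%E)) ?integral_cst ?mul0e // => t _ /=.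
  apply: (IH j (fun y => F (consrV (t, y)))).
  + by move=> y; exact: (is_derive_consrVS _ _ FdF).
  + move=> y; apply: (@continuous_comp 'rV[R]_n 'rV[R]_n.+1 R); first exact: consrV_continuous2.
    exact: cdF.
  + by move=> y ry; apply: Fr; apply: lt_le_trans ry (proj2 (consrV_norm_ge t y)).
Unshelve. all: by end_near. Qed.

(** * Integrals of locally bounded functions *)

Section locally_bounded.
Context {R : realType} {n : nat}.
Implicit Types (D : set 'rV[R]_n) (F G : 'rV[R]_n -> R).

(** The bound is required on bounded parts of [D], hence up to the frontier; together with [bsupp]
    it gives integrability on [D] of functions that need not vanish near the frontier. *)
Definition lcb D F := (forall x, D x -> {for x, continuous F}) /\
  forall r, exists M, forall x, D x -> `|x| <= r -> `|F x| <= M.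

Definition bsupp D F := exists r, forall x, D x -> r < `|x| -> F x = 0.

Lemma lcbD D F G : lcb D F -> lcb D G -> lcb D (fun x => F x + G x).
Proof.
move=> [cF bF] [cG bG]; split; first by move=> x Dx; apply: continuousD; [exact: cF|exact: cG].
move=> r; have [M FM] := bF r; have [K GK] := bG r; exists (M + K) => x Dx xr.
by apply: le_trans (ler_normD _ _) _; apply: lerD; [exact: FM|exact: GK].
Qed.

Lemma lcbM D F G : lcb D F -> lcb D G -> lcb D (fun x => F x * G x).
Proof.
move=> [cF bF] [cG bG]; split; first by move=> x Dx; apply: continuousM; [exact: cF|exact: cG].
move=> r; have [M FM] := bF r; have [K GK] := bG r; exists (M * K) => x Dx xr.
by rewrite normrM; apply: ler_pM => //; [exact: FM|exact: GK].
Qed.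

Lemma lcb_cst D (a : R) : lcb D (fun=> a).
Proof. by split; [move=> x _; exact: cst_continuous|move=> r; exists `|a|]. Qed.

Lemma lcbN D F : lcb D F -> lcb D (fun x => - F x).
Proof.
move=> [cF bF]; split; first by move=> x Dx; apply: continuousN; exact: cF.
by move=> r; have [M FM] := bF r; exists M => x Dx xr; rewrite normrN; exact: FM.
Qed.

Lemma lcbX D F k : lcb D F -> lcb D (fun x => F x ^+ k).
Proof.
move=> hF; elim: k => [|k IH].
  by under eq_fun do rewrite expr0; exact: lcb_cst.
by under eq_fun do rewrite exprS; exact: lcbM.
Qed.

Lemma lcb_sum D (I : Type) (s : seq I) (P : pred I) (F : I -> 'rV[R]_n -> R) :
  (forall i, P i -> lcb D (F i)) -> lcb D (fun x => \sum_(i <- s | P i) F i x).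
Proof.
move=> hF; elim: s => [|i s IH].
  by under eq_fun do rewrite big_nil; exact: lcb_cst.
have [Pi|Pi] := boolP (P i); last by under eq_fun do rewrite big_cons (negbTE Pi).
under eq_fun do rewrite big_cons Pi.
by apply: lcbD => //; exact: hF.
Qed.

Lemma lcb_abs D F : lcb D F -> lcb D (fun x => `|F x|).
Proof.
move=> [cF bF]; split.
  move=> x Dx; apply: continuous_comp; first exact: cF.
  exact: norm_continuous.
by move=> r; have [M FM] := bF r; exists M => x Dx xr; rewrite normr_id; exact: FM.
Qed.

Lemma lcb_comp D F (h : R -> R) : continuous h -> lcb D F -> lcb D (fun x => h (F x)).
Proof.
move=> ch [cF bF]; split.
  by move=> x Dx; apply: continuous_comp; [exact: cF|exact: ch].
move=> r; have [M FM] := bF r.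
have : compact (h @` `[-M, M]).
  by apply: continuous_compact; [exact: continuous_subspaceT|exact: segment_compact].
move=> /compact_bounded[K [_ hK]]; exists (K + 1) => x Dx xr.
apply: hK; first by rewrite ltrDl.
by exists (F x) => //=; rewrite in_itv /= -ler_norml; exact: FM.
Qed.

Lemma lcb_continuous D F : continuous F -> lcb D F.
Proof.
move=> cF; split; first by move=> x _; exact: cF.
move=> r; pose K := [set x : 'rV[R]_n | `|x| <= r].
have cK : compact K.
  apply: bounded_closed_compact.
    exists r; split; first exact: num_real.
    by move=> M rM x /= xr; apply: le_trans xr (ltW rM).
  rewrite (_ : K = (fun x : 'rV[R]_n => `|x|) @^-1` [set t | t <= r])//.
  by apply: closed_comp => [x _|]; [exact: norm_continuous|exact: closed_le].
have /compact_bounded[M [_ MK]] : compact (F @` K).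
  by apply: continuous_compact => //; exact: continuous_subspaceT.
by exists (M + 1) => x _ xr; apply: MK; [rewrite ltrDl|exists x].
Qed.

Lemma lcbS D D' F : D' `<=` D -> lcb D F -> lcb D' F.
Proof.
move=> DD [cF bF]; split; first by move=> x /DD; exact: cF.
by move=> r; have [M FM] := bF r; exists M => x /DD; exact: FM.
Qed.

Lemma bsuppD D F G : bsupp D F -> bsupp D G -> bsupp D (fun x => F x + G x).
Proof.
move=> [r Fr] [s Gs]; exists (Num.max r s) => x Dx; rewrite gt_max => /andP[? ?].
by rewrite Fr // Gs // addr0.
Qed.

Lemma bsuppMl D F G : bsupp D F -> bsupp D (fun x => F x * G x).
Proof. by move=> [r Fr]; exists r => x Dx h; rewrite Fr // mul0r. Qed.

Lemma bsuppMr D F G : bsupp D G -> bsupp D (fun x => F x * G x).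
Proof. by move=> [r Fr]; exists r => x Dx h; rewrite Fr // mulr0. Qed.

Lemma bsuppN D F : bsupp D F -> bsupp D (fun x => - F x).
Proof. by move=> [r Fr]; exists r => x Dx h; rewrite Fr // oppr0. Qed.

Lemma bsuppX D F k : bsupp D F -> bsupp D (fun x => F x ^+ k.+1).
Proof. by move=> [r Fr]; exists r => x Dx h; rewrite Fr // exprS mul0r. Qed.

Lemma bsupp_sum D (I : Type) (s : seq I) (P : pred I) (F : I -> 'rV[R]_n -> R) :
  (forall i, P i -> bsupp D (F i)) -> bsupp D (fun x => \sum_(i <- s | P i) F i x).
Proof.
move=> hF; elim: s => [|i s IH].
  by exists 0 => x _ _; rewrite big_nil.
have [Pi|Pi] := boolP (P i); last by under eq_fun do rewrite big_cons (negbTE Pi).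
under eq_fun do rewrite big_cons Pi.
by apply: bsuppD => //; exact: hF.
Qed.

Definition ibl D F := lcb D F /\ bsupp D F.

Lemma iblD D F G : ibl D F -> ibl D G -> ibl D (fun x => F x + G x).
Proof. by move=> [? ?] [? ?]; split; [exact: lcbD|exact: bsuppD]. Qed.

Lemma iblMl D F G : ibl D F -> lcb D G -> ibl D (fun x => F x * G x).
Proof. by move=> [? ?] ?; split; [exact: lcbM|exact: bsuppMl]. Qed.

Lemma iblMr D F G : lcb D F -> ibl D G -> ibl D (fun x => F x * G x).
Proof. by move=> ? [? ?]; split; [exact: lcbM|exact: bsuppMr]. Qed.

Lemma iblZ D F (a : R) : ibl D F -> ibl D (fun x => a * F x).
Proof. by move=> ?; apply: iblMr => //; exact: lcb_cst. Qed.

Lemma iblN D F : ibl D F -> ibl D (fun x => - F x).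
Proof. by move=> [? ?]; split; [exact: lcbN|exact: bsuppN]. Qed.

Lemma iblB D F G : ibl D F -> ibl D G -> ibl D (fun x => F x - G x).
Proof. by move=> ? ?; apply: iblD => //; exact: iblN. Qed.

Lemma ibl_sum D (I : Type) (s : seq I) (P : pred I) (F : I -> 'rV[R]_n -> R) :
  (forall i, P i -> ibl D (F i)) -> ibl D (fun x => \sum_(i <- s | P i) F i x).
Proof.
by move=> h; split; [apply: lcb_sum => i /h[]|apply: bsupp_sum => i /h[]].
Qed.

Lemma ibl_abs D F : ibl D F -> ibl D (fun x => `|F x|).
Proof.
by move=> [? [r h]]; split; [exact: lcb_abs|exists r => x Dx xr; rewrite h // normr0].
Qed.

Lemma ibl_integrable D F : open D -> ibl D F ->
  (@lebesgue_rV R n).-integrable D (EFin \o F).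
Proof.
move=> oD [[cF bF] [r Fr]]; have [M FM] := bF r.
apply: (@integrable_bounded_rV _ _ _ _ (Num.max M 0) r) => // x Dx.
by rewrite le_max; have [xr|xr] := leP `|x| r; [rewrite FM|rewrite Fr // normr0 lexx orbT].
Qed.

End locally_bounded.

Section integral_rV.
Context {R : realType} {n : nat}.
Implicit Types (D : set 'rV[R]_n) (F G : 'rV[R]_n -> R).
Local Notation mu := (@lebesgue_rV R n).

Lemma int_rVD D F G : open D -> ibl D F -> ibl D G ->
  \int[mu]_(x in D) (F x + G x) = \int[mu]_(x in D) F x + \int[mu]_(x in D) G x.
Proof.
by move=> oD iF iG; apply: RintegralD; [exact: open_measurable_rV|exact: ibl_integrable..].
Qed.

Lemma int_rVB D F G : open D -> ibl D F -> ibl D G ->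
  \int[mu]_(x in D) (F x - G x) = \int[mu]_(x in D) F x - \int[mu]_(x in D) G x.
Proof.
by move=> oD iF iG; apply: RintegralB; [exact: open_measurable_rV|exact: ibl_integrable..].
Qed.

Lemma int_rVZ D F (a : R) : open D -> ibl D F ->
  \int[mu]_(x in D) (a * F x) = a * \int[mu]_(x in D) F x.
Proof.
by move=> oD iF; apply: RintegralZl; [exact: open_measurable_rV|exact: ibl_integrable].
Qed.

Lemma eq_int_rV D F G : (forall x, D x -> F x = G x) ->
  \int[mu]_(x in D) F x = \int[mu]_(x in D) G x.
Proof. by move=> h; apply: eq_Rintegral => x; rewrite inE; exact: h. Qed.

Lemma int_rV0 D F : (forall x, D x -> F x = 0) -> \int[mu]_(x in D) F x = 0.
Proof.
move=> h; rewrite (eq_int_rV h) /Rintegral.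
by rewrite integral0_eq.
Qed.

Lemma int_rV_sum D (I : Type) (s : seq I) (P : pred I) (F : I -> 'rV[R]_n -> R) :
  open D -> (forall i, P i -> ibl D (F i)) ->
  \int[mu]_(x in D) (\sum_(i <- s | P i) F i x) =
  \sum_(i <- s | P i) \int[mu]_(x in D) F i x.
Proof.
move=> oD hF; elim: s => [|i s IH].
  by rewrite big_nil; apply: int_rV0 => x _; rewrite big_nil.
rewrite big_cons; under eq_Rintegral do rewrite big_cons.
case: ifP => // Pi; rewrite int_rVD ?IH//; first exact: hF.
exact: ibl_sum.
Qed.

Lemma le_int_rV D F G : open D -> ibl D F -> ibl D G -> (forall x, D x -> F x <= G x) ->
  \int[mu]_(x in D) F x <= \int[mu]_(x in D) G x.
Proof.
by move=> oD iF iG; apply: le_Rintegral; [exact: open_measurable_rV|exact: ibl_integrable..].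
Qed.

Lemma int_rV_ge0 D F : (forall x, D x -> 0 <= F x) -> 0 <= \int[mu]_(x in D) F x.
Proof. exact: Rintegral_ge0. Qed.

Lemma dominated_cvg_rV D (F_ : nat -> 'rV[R]_n -> R) F G : open D ->
  (forall k, ibl D (F_ k)) -> ibl D F -> ibl D G ->
  (forall k x, D x -> `|F_ k x| <= G x) ->
  (forall x, D x -> F_ ^~ x @ \oo --> F x) ->
  (fun k => \int[mu]_(x in D) F_ k x) @ \oo --> \int[mu]_(x in D) F x.
Proof.
move=> oD iF_ iF iG FG FF; have mD := open_measurable_rV oD.
have mea H : ibl D H -> measurable_fun D (EFin \o H).
  by move=> iH; apply: measurable_int (ibl_integrable oD iH).
have FFE x : D x -> (fun k => (F_ k x)%:E) @ \oo --> (F x)%:E.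
  by move=> Dx; apply: cvg_EFin; [exact: nearW|exact: FF].
have [_ _ h] := @dominated_convergence _ _ _ mu D mD (fun k => EFin \o F_ k)
  (EFin \o F) (EFin \o G) (fun k => mea _ (iF_ k)) (mea _ iF)
  (aeW _ FFE) (ibl_integrable oD iG)
  (aeW _ (fun x k Dx => FG k x Dx)).
rewrite /Rintegral; apply: fine_cvg.
by have -> := fineK (integrable_fin_num mD (ibl_integrable oD iF)); exact: h.
Qed.

(** If [F x > 0], continuity gives [F > F x / 2] on a box around [x], whose measure is positive. *)
Lemma ge0_int_rV_eq0 D F : open D -> ibl D F -> (forall x, D x -> 0 <= F x) ->
  \int[mu]_(x in D) F x <= 0 -> forall x, D x -> F x = 0.
Proof.
move=> oD iF F0 JF x Dx; apply/eqP; rewrite eq_le F0 // andbT leNgt; apply/negP => Fx.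
have [[cF _] _] := iF.
have /nbhs_ballP[e /= e0 xe] : \forall y \near x, D y /\ F x / 2 < F y.
  near=> y; split; first by near: y; exact: open_nbhs_nbhs.
  by near: y; apply: (@cvgr_gt _ _ (nbhs x) _ F (F x) (cF x Dx) (F x / 2)); lra.
pose A i : set (measurableTypeR R) := @ball R R (x ord0 i) e.
pose B := [set y : 'rV[R]_n | forall i, A i (y ord0 i)].
have mA i : measurable (A i) by exact: measurable_ball.
have mB : measurable B by exact: measurable_box_rV.
have BD : B `<=` ball x e by move=> y yB; split=> // i j; rewrite ord1; exact: yB.
have mD := open_measurable_rV oD.
have mF : measurable_fun D (EFin \o F) by apply: measurable_int (ibl_integrable oD iF).
have : (\int[mu]_(y in D) (F y)%:E <= 0)%E.
  rewrite -(fineK (integrable_fin_num mD (ibl_integrable oD iF))) lee_fin.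
  exact: JF.
apply/negP; rewrite -ltNge.
have BD' : B `<=` D by move=> y /BD/xe[].
apply: (@lt_le_trans _ _ (\int[mu]_(y in B) (F y)%:E)%E); last first.
  by apply: ge0_subset_integral => // y Dy; rewrite lee_fin F0.
apply: (@lt_le_trans _ _ (\int[mu]_(y in B) (cst (F x / 2)%:E y))%E); last first.
  apply: ge0_le_integral => //.
  - by move=> y _; rewrite lee_fin; lra.
  - exact: measurable_funS mF.
  - by move=> y /BD/xe[_ /ltW]; rewrite lee_fin.
rewrite integral_cst // mule_gt0 ?lte_fin ?divr_gt0 //.
have /= -> := lebesgue_rV_box mA; rewrite (eq_bigr (fun=> (e *+ 2)%:E)); last first.
  by move=> i _; rewrite /A lebesgue_measure_ball // ltW.
rewrite -(big_morph EFin EFinM erefl) lte_fin prodr_gt0 // => i _.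
by rewrite pmulrn_lgt0.
Unshelve. all: by end_near. Qed.

(** [F] vanishes off the closed set [K] inside [D], hence so does [dF], and the integral over [D] is
    the integral over the whole space. *)
Lemma int_partial0 D (K : set 'rV[R]_n) (i : 'I_n) F dF : open D -> closed K -> K `<=` D ->
  (forall x, is_derive x (delta_mx ord0 i) F (dF x)) -> continuous dF ->
  (forall x, ~ K x -> F x = 0) -> bsupp setT F ->
  \int[mu]_(x in D) dF x = 0.
Proof.
move=> oD cK KD FdF cdF F0 [r Fr].
have dF0 x : ~ K x -> dF x = 0.
  move=> Kx; apply: (is_derive_locally0 _ (FdF x)).
  have : nbhs x (~` K) by apply: open_nbhs_nbhs; split=> //; exact: closed_openC.
  by apply: filterS => y; exact: F0.
rewrite /Rintegral integral_mkcond (_ : _ \_ _ = EFin \o dF).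
  by rewrite (@integral_partial0 R n i F dF r) // => x rx; apply: Fr.
apply/funext => x; rewrite patchE; case: ifPn => //; rewrite notin_setE => Dx.
by rewrite /= dF0 // => /KD.
Qed.

End integral_rV.

(** * Functions of class C^1 *)

Section epsilon_delta.
Context {R : realType} {V : normedModType R}.

Lemma nbhs_eps (x : V) (P : set V) : nbhs x P ->
  exists2 d : R, 0 < d & forall y, `|y - x| < d -> P y.
Proof.
move=> /nbhs_ballP[d /= d0 h]; exists d => // y yx; apply: h.
by rewrite -ball_normE /ball_ /= distrC.
Qed.

Lemma eps_nbhs (x : V) (P : set V) (d : R) : 0 < d ->
  (forall y, `|y - x| < d -> P y) -> nbhs x P.
Proof.
move=> d0 h; apply/nbhs_ballP; exists d => //= y.
by rewrite -ball_normE /ball_ /= distrC; exact: h.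
Qed.

Lemma open_eps (D : set V) (x : V) : open D -> D x ->
  exists2 d : R, 0 < d & forall y, `|y - x| < d -> D y.
Proof. by move=> oD Dx; apply: nbhs_eps; exact: open_nbhs_nbhs. Qed.

Lemma continuous_eps (f : V -> R) (x : V) (e : R) : {for x, continuous f} -> 0 < e ->
  exists2 d : R, 0 < d & forall y, `|y - x| < d -> `|f y - f x| < e.
Proof.
move=> cf e0; apply: (@nbhs_eps x (fun y => `|f y - f x| < e)).
near=> y; rewrite distrC.
by near: y; exact: (@cvgr_dist_lt _ _ _ (nbhs x) _ f (f x) cf e e0).
Unshelve. all: by end_near. Qed.

End epsilon_delta.

Section directional.
Context {R : realType} {V : normedModType R}.
Implicit Types (f g : V -> R) (x y v w : V).

Lemma is_derive_ext f g x v (d : R) : (forall y, f y = g y) -> is_derive x v f d -> is_derive x v g d.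
Proof. by move=> /funext ->. Qed.

Lemma to_line f x v (t0 d : R) : is_derive (t0 *: v + x) v f d ->
  is_derive t0 1 (fun t : R => f (t *: v + x)) d.
Proof. exact: (proj1 (is_derive_line f x v t0 d)). Qed.

Lemma to_line0 f x v (d : R) : is_derive x v f d ->
  is_derive (0 : R) 1 (fun t : R => f (t *: v + x)) d.
Proof. by move=> h; apply: (@to_line f x v 0 d); rewrite scale0r add0r. Qed.

Lemma of_line0 f x v (d : R) :
  is_derive (0 : R) 1 (fun t : R => f (t *: v + x)) d -> is_derive x v f d.
Proof. by move=> h; have := proj2 (is_derive_line f x v 0 d) h; rewrite scale0r add0r. Qed.

Lemma near_eq_continuous (D : set V) f g x : open D -> D x ->
  (forall y, D y -> f y = g y) -> {for x, continuous f} -> {for x, continuous g}.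
Proof.
move=> oD Dx E cf; rewrite /prop_for /continuous_at -E //; apply: cvg_trans cf.
apply: near_eq_cvg; near=> y; apply: E; near: y; exact: open_nbhs_nbhs.
Unshelve. all: by end_near. Qed.

Lemma near_eq_is_derive_on (D : set V) f g x v (d : R) : open D -> D x ->
  (forall y, D y -> f y = g y) -> is_derive x v f d -> is_derive x v g d.
Proof.
move=> oD Dx E; apply: near_eq_is_derive.
near=> y; apply: E; near: y; exact: open_nbhs_nbhs.
Unshelve. all: by end_near. Qed.

Lemma is_derive_mulid (t a : R) : is_derive t 1 (fun t : R => t * a) a.
Proof.
have h : is_derive t 1 ((id : R -> R) * (cst a)) (id t *: (0 : R) + cst a t *: (1:R)).
  by apply: is_deriveM.
by apply: (is_derive_eq h); rewrite scaler0 add0r /cst [_ *: _]mulr1.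
Qed.

Lemma is_derive_scaledir f x v (d a : R) : is_derive x v f d -> is_derive x (a *: v) f (a * d).
Proof.
move=> fd; have h : is_derive (0 * a : R) 1 (fun t : R => f (t *: v + x)) d.
  by rewrite mul0r; exact: to_line0.
have := @is_derive1_comp R (fun t : R => f (t *: v + x)) (fun t : R => t * a) 0 d a h (is_derive_mulid 0 a).
rewrite mulrC => h3.
apply: of_line0.
rewrite (_ : (fun t : R => _) = (fun t : R => f (t *: v + x)) \o (fun t : R => t * a)) //.
by apply/funext => t /=; rewrite scalerA.
Qed.

Lemma is_derive_shift_arg f a x v (d : R) : is_derive (a + x) v f d ->
  is_derive x v (fun y => f (a + y)) d.
Proof.
move=> /to_line0 h; apply: of_line0.
rewrite (_ : (fun t : R => _) = (fun t : R => f (t *: v + (a + x)))) //.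
by apply/funext => t; rewrite addrCA.
Qed.

Lemma is_derive_continuous1 (f : R -> R) (t d : R) : is_derive t 1 f d -> {for t, continuous f}.
Proof. by move=> [h _]; apply: differentiable_continuous; exact/derivable1_diffP. Qed.

Lemma MVT_line f (Df : V -> R) x v :
  (forall t : R, 0 <= t <= 1 -> is_derive (t *: v + x) v f (Df (t *: v + x))) ->
  exists2 c : R, 0 <= c <= 1 & f (v + x) - f x = Df (c *: v + x).
Proof.
move=> h.
have [c c01 E] : exists2 c : R, c \in `[0, 1]%R & (fun t : R => f (t *: v + x)) 1 - (fun t : R => f (t *: v + x)) 0 =
    (fun t : R => Df (t *: v + x)) c * (1 - 0).
  apply: (@MVT_segment R (fun t : R => f (t *: v + x)) (fun t : R => Df (t *: v + x)) 0 1) => //.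
    move=> t; rewrite in_itv /= => /andP[t0 t1]; apply: to_line; apply: h.
    by rewrite !ltW.
  apply: derivable_within_continuous => t; rewrite in_itv /= => h'.
  by have [] := to_line (h t h').
exists c; first by move: c01; rewrite in_itv.
by move: E; rewrite scale1r scale0r add0r subr0 mulr1.
Qed.

(** Only the derivative along [w] has to be continuous: the increment along [v] uses the derivative
    at [x] alone, and the following one along [w] the mean value theorem. *)
Lemma is_derive_adddir (D : set V) f (Df Dg : V -> R) v w x : open D -> D x ->
  is_derive x v f (Df x) ->
  (forall y, D y -> is_derive y w f (Dg y)) -> {for x, continuous Dg} ->
  is_derive x (v + w) f (Df x + Dg x).
Proof.
move=> oD Dx fv fw cDg.
have : (fun h : R => h^-1 *: ((f \o shift x) (h *: (v + w)) - f x)) @ 0^' --> Df x + Dg x; last first.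
  by move=> h; split; [exact: cvgP h|exact: cvg_lim h].
have -> : (fun h : R => h^-1 *: ((f \o shift x) (h *: (v + w)) - f x)) =
   (fun h : R => h^-1 *: ((f \o shift x) (h *: v) - f x) + 
       h^-1 *: (f (h *: w + (h *: v + x)) - f (h *: v + x))).
  apply/funext => h /=; rewrite -scalerDr; congr (_ *: _).
  have -> : h *: (v + w) + x = h *: w + (h *: v + x).
    by rewrite scalerDr addrA [h *: w + _]addrC.
  ring.
apply: cvgD; first by case: fv => fv <-; exact: fv.
apply/cvgrPdist_lt => e e0.
have [d1 d10 h1] := open_eps oD Dx.
have [d2 d20 h2] := continuous_eps cDg e0.
pose C : R := `|v| + `|w| + 1.
have C0 : 0 < C by rewrite /C; apply: ltr_wpDl => //; apply: addr_ge0.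
pose d := Num.min d1 d2 / C.
have d0 : 0 < d by rewrite divr_gt0 // lt_min d10.
near=> h.
have h0 : h != 0 by near: h; exact: nbhs_dnbhs_neq.
have hd : `|h| < d.
  near: h; apply: nbhs_dnbhs; apply: (@eps_nbhs _ _ _ _ d) => // y.
  by rewrite subr0.
have close t : 0 <= t <= 1 -> `|(t *: (h *: w) + (h *: v + x)) - x| < Num.min d1 d2.
  move=> /andP[t0 t1].
  have -> : t *: (h *: w) + (h *: v + x) - x = h *: (t *: w + v).
    by rewrite addrA addrK scalerDr !scalerA mulrC.
  rewrite normrZ; apply: (@le_lt_trans _ _ (`|h| * C)).
    apply: ler_wpM2l => //; apply: le_trans (ler_normD _ _) _.
    rewrite normrZ ger0_norm // /C.
    have : t * `|w| <= `|w| by rewrite ler_piMl.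
    lra.
  by rewrite -ltr_pdivlMr.
have [c c01 ->] : exists2 c : R, 0 <= c <= 1 &
    f (h *: w + (h *: v + x)) - f (h *: v + x) = h * Dg (c *: (h *: w) + (h *: v + x)).
  apply: (@MVT_line f (fun y => h * Dg y)) => t t01; apply: is_derive_scaledir.
  by apply: fw; apply: h1; apply: lt_le_trans (close t t01) _; rewrite ge_min lexx.
rewrite [_ *: _]mulrA mulVf // mul1r distrC; apply: h2.
by apply: lt_le_trans (close c c01) _; rewrite ge_min lexx orbT.
Unshelve. all: by end_near. Qed.

End directional.

Section C1.
Context {R : realType} {n : nat}.
Implicit Types (D : set 'rV[R]_n) (g h : 'rV[R]_n -> R) (dg dh : 'I_n -> 'rV[R]_n -> R).

(** The partial derivatives are carried as data instead of being computed, so that the calculus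
    rules yield explicit formulas valid on [D]. *)
Definition C1g D g dg := forall x, D x -> {for x, continuous g} /\
  forall i, is_derive x (delta_mx ord0 i) g (dg i x) /\ {for x, continuous (dg i)}.

Lemma C1gS D D' g dg : D' `<=` D -> C1g D g dg -> C1g D' g dg.
Proof. by move=> DD h x /DD; exact: h. Qed.

Lemma C1gD D g dg h dh : C1g D g dg -> C1g D h dh ->
  C1g D (fun x => g x + h x) (fun i x => dg i x + dh i x).
Proof.
move=> Hg Hh x Dx; have [cg Hgx] := Hg x Dx; have [ch Hhx] := Hh x Dx.
split; first exact: continuousD.
move=> i; have [g1 g2] := Hgx i; have [h1 h2] := Hhx i.
by split; [exact: is_deriveD|exact: continuousD].
Qed.

Lemma C1gM D g dg h dh : C1g D g dg -> C1g D h dh ->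
  C1g D (fun x => g x * h x) (fun i x => dg i x * h x + g x * dh i x).
Proof.
move=> Hg Hh x Dx; have [cg Hgx] := Hg x Dx; have [ch Hhx] := Hh x Dx.
split; first exact: continuousM.
move=> i; have [g1 g2] := Hgx i; have [h1 h2] := Hhx i; split.
  apply: (@is_derive_eq _ _ _ (fun x => g x * h x) _ _ _ _ (is_deriveM g1 h1)).
  by rewrite addrC [h x *: _]mulrC.
by apply: continuousD; apply: continuousM.
Qed.

Lemma C1g_cst D (a : R) : C1g D (fun=> a) (fun _ _ => 0).
Proof.
by move=> x _; split=> [|i]; [exact: cst_continuous|split; [exact: is_derive_cst|exact: cst_continuous]].
Qed.

Lemma C1g_eq D g dg h : C1g D g dg -> open D -> (forall x, D x -> g x = h x) -> C1g D h dg.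
Proof.
move=> Hg oD E x Dx; have [cg Hgx] := Hg x Dx.
split; first exact: (@near_eq_continuous R 'rV[R]_n D g h x oD Dx E cg).
move=> i; have [g1 g2] := Hgx i; split=> //.
exact: (@near_eq_is_derive_on R 'rV[R]_n D g h x _ _ oD Dx E g1).
Qed.

Lemma C1g_ext D g dg h dh : (forall x, g x = h x) -> (forall i x, dg i x = dh i x) ->
  C1g D g dg -> C1g D h dh.
Proof.
move=> /funext -> E; suff -> : dg = dh by [].
by apply/funext => i; apply/funext => x.
Qed.

Lemma C1gZ D g dg (a : R) : C1g D g dg -> C1g D (fun x => a * g x) (fun i x => a * dg i x).
Proof.
move=> Hg; apply: (C1g_ext _ _ (C1gM (@C1g_cst D a) Hg)) => // i x.
by rewrite mul0r add0r.
Qed.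

Lemma C1gN D g dg : C1g D g dg -> C1g D (fun x => - g x) (fun i x => - dg i x).
Proof.
by move=> Hg; apply: (C1g_ext _ _ (C1gZ (-1) Hg)) => *; rewrite mulN1r.
Qed.

Lemma C1gB D g dg h dh : C1g D g dg -> C1g D h dh ->
  C1g D (fun x => g x - h x) (fun i x => dg i x - dh i x).
Proof. by move=> Hg Hh; exact: C1gD Hg (C1gN Hh). Qed.

Lemma C1g_sum D (I : Type) (s : seq I) (P : pred I) (g : I -> 'rV[R]_n -> R)
    (dg : I -> 'I_n -> 'rV[R]_n -> R) :
  (forall k, P k -> C1g D (g k) (dg k)) ->
  C1g D (fun x => \sum_(k <- s | P k) g k x) (fun i x => \sum_(k <- s | P k) dg k i x).
Proof.
move=> hg; elim: s => [|k s IH].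
  by apply: (C1g_ext _ _ (@C1g_cst D 0)) => *; rewrite big_nil.
have [Pk|Pk] := boolP (P k).
  by apply: (C1g_ext _ _ (C1gD (hg k Pk) IH)) => *; rewrite big_cons Pk.
by apply: (C1g_ext _ _ IH) => *; rewrite big_cons (negbTE Pk).
Qed.

Lemma C1g_comp D g dg (h dh : R -> R) : C1g D g dg ->
  (forall x, D x -> is_derive (g x) 1 h (dh (g x)) /\ {for g x, continuous dh}) ->
  C1g D (fun x => h (g x)) (fun i x => dh (g x) * dg i x).
Proof.
move=> Hg Hh x Dx; have [cg Hgx] := Hg x Dx; have [h1 h2] := Hh x Dx; split.
  by apply: continuous_comp => //; exact: is_derive_continuous1 h1.
move=> i; have [g1 g2] := Hgx i; split; last first.
  by apply: continuousM => //; exact: continuous_comp.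
apply: of_line0; apply: (@is_derive1_comp _ h (fun t : R => g (t *: delta_mx ord0 i + x))).
  by rewrite scale0r add0r.
exact: to_line0.
Qed.

Lemma C1g_coord D (j : 'I_n) : C1g D (fun x => x ord0 j) (fun i _ => (i == j)%:R).
Proof.
move=> x _; split; first exact: coord_continuous.
move=> i; split; last exact: cst_continuous.
apply: of_line0.
rewrite (_ : (fun t : R => _) = (fun t : R => t * (i == j)%:R) + cst (x ord0 j)).
  have h := is_deriveD (is_derive_mulid 0 ((i == j)%:R : R)) (is_derive_cst (x ord0 j) (0:R) (1:R)).
  by apply: (is_derive_eq h); rewrite addr0.
by apply/funext => t; rewrite !mxE eqxx /= eq_sym.
Qed.

Lemma C1g_uniq D g dg dg' i x : C1g D g dg -> C1g D g dg' -> D x -> dg i x = dg' i x.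
Proof.
by move=> h h' Dx; have [_ /(_ i) [[_ <-] _]] := h x Dx; have [_ /(_ i) [[_ <-] _]] := h' x Dx.
Qed.

Lemma C1g_partial D g dg i x : C1g D g dg -> D x -> 'D_(delta_mx ord0 i) g x = dg i x.
Proof. by move=> h Dx; have [_ /(_ i) [[_ ->] _]] := h x Dx. Qed.

Lemma C1g_dir D g dg x (d : 'rV[R]_n) : open D -> C1g D g dg -> D x ->
  is_derive x d g (\sum_i d ord0 i * dg i x).
Proof.
move=> oD Hg Dx.
have : forall s : seq 'I_n, forall x, D x ->
   is_derive x (\sum_(i <- s) d ord0 i *: delta_mx ord0 i) g (\sum_(i <- s) d ord0 i * dg i x).
  elim=> [|k s IH] y Dy; first by rewrite !big_nil; exact: is_derive0.
  rewrite !big_cons addrC [X in is_derive _ _ _ X]addrC.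
  apply: (@is_derive_adddir _ _ D g (fun y => \sum_(i <- s) d ord0 i * dg i y) (fun y => d ord0 k * dg k y)) => //.
  - exact: IH.
  - by move=> z Dz; apply: is_derive_scaledir; have [_ /(_ k) []] := Hg z Dz.
  - by have [_ /(_ k) []] := C1gZ (d ord0 k) Hg Dy.
move=> /(_ (index_enum _) x Dx).
suff -> : \sum_i d ord0 i *: delta_mx ord0 i = d by [].
by rewrite [RHS]row_sum_delta.
Qed.

Lemma C1g_line D g dg x (d : 'rV[R]_n) (t : R) : open D -> C1g D g dg -> D (t *: d + x) ->
  is_derive t 1 (fun t : R => g (t *: d + x)) (\sum_i d ord0 i * dg i (t *: d + x)).
Proof. by move=> oD Hg Dx; apply: to_line; exact: C1g_dir Hg Dx. Qed.

Lemma C1g_MVT D g dg x (d : 'rV[R]_n) : open D -> C1g D g dg ->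
  (forall t : R, 0 <= t <= 1 -> D (t *: d + x)) ->
  exists2 c : R, 0 <= c <= 1 & g (d + x) - g x = \sum_i d ord0 i * dg i (c *: d + x).
Proof.
move=> oD Hg HD; apply: (@MVT_line _ _ g (fun y => \sum_i d ord0 i * dg i y)) => t t01.
by apply: (C1g_dir _ oD Hg); exact: HD.
Qed.

Lemma norm_delta_mx_le (i : 'I_n) : `|delta_mx ord0 i : 'rV[R]_n| <= 1.
Proof.
apply/(normv_leP _ ler01) => j; rewrite !mxE eqxx /=.
by case: (j == i); rewrite ?normr0 ?normr1.
Qed.

(** The double increment of [g] along two axes is symmetric in them, and the mean value theorem used
    twice equates it with [h ^ 2] times either mixed derivative at a point near [x]. *)
Lemma schwarz D g dg (ddg : 'I_n -> 'I_n -> 'rV[R]_n -> R) i j x : open D ->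
  C1g D g dg -> (forall i, C1g D (dg i) (ddg i)) -> D x -> ddg i j x = ddg j i x.
Proof.
move=> oD Hg Hdg Dx; apply/eqP/negPn/negP => ne.
pose e : R := `|ddg i j x - ddg j i x| / 2.
have e0 : 0 < e by rewrite divr_gt0 // normr_gt0 subr_eq0.
have [d1 d10 h1] := open_eps oD Dx.
have [_ /(_ j)[_ cij]] := Hdg i x Dx; have [_ /(_ i)[_ cji]] := Hdg j x Dx.
have [d2 d20 h2] := continuous_eps cij e0.
have [d3 d30 h3] := continuous_eps cji e0.
pose d := Num.min d1 (Num.min d2 d3).
have d0 : 0 < d by rewrite !lt_min d10 d20.
have [h h0 dh] : exists2 h : R, 0 < h & h + h < d by exists (d / 4); [rewrite divr_gt0|lra].
have key (a b : 'I_n) : exists2 p, `|p - x| < d &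
   g (h *: delta_mx ord0 b + (h *: delta_mx ord0 a + x)) - g (h *: delta_mx ord0 a + x) -
   (g (h *: delta_mx ord0 b + x) - g x) = h * (h * ddg a b p).
  have close (s t : R) : 0 <= s <= 1 -> 0 <= t <= 1 ->
     `|s *: (h *: delta_mx ord0 b) + (t *: (h *: delta_mx ord0 a) + x) - x| < d.
    move=> /andP[s0 s1] /andP[t0 t1]; rewrite addrA addrK.
    apply: le_lt_trans (ler_normD _ _) _; rewrite !normrZ (ger0_norm s0) (ger0_norm t0) (gtr0_norm h0).
    have := norm_delta_mx_le a; have := norm_delta_mx_le b.
    set A := `|delta_mx _ a|; set B := `|delta_mx _ b| => B1 A1.
    have A0 : 0 <= A by exact: normr_ge0.
    have B0 : 0 <= B by exact: normr_ge0.
    have hA : h * A <= h by rewrite ger_pMr.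
    have hB : h * B <= h by rewrite ger_pMr.
    have s2 : s * (h * B) <= h * B by rewrite ler_piMl // mulr_ge0 // ltW.
    have t2 : t * (h * A) <= h * A by rewrite ler_piMl // mulr_ge0 // ltW.
    apply: le_lt_trans dh.
    by apply: lerD; [exact: le_trans s2 hB|exact: le_trans t2 hA].
  have dd1 y : `|y - x| < d -> D y.
    by move=> yd; apply: h1; apply: lt_le_trans yd _; rewrite ge_min lexx.
  have [c c01 E] : exists2 c : R, 0 <= c <= 1 &
    (g (h *: delta_mx ord0 b + (h *: delta_mx ord0 a + x)) - g (h *: delta_mx ord0 a + x)) -
      (g (h *: delta_mx ord0 b + x) - g x) =
    h * (dg a (h *: delta_mx ord0 b + (c *: (h *: delta_mx ord0 a) + x)) - dg a (c *: (h *: delta_mx ord0 a) + x)).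
    apply: (@MVT_line _ _ (fun y => g (h *: delta_mx ord0 b + y) - g y)
      (fun y => h * (dg a (h *: delta_mx ord0 b + y) - dg a y))) => t t01.
    apply: is_derive_scaledir; apply: is_deriveB; first apply: is_derive_shift_arg.
      have Dy := dd1 _ (close 1 t (ltac:(by rewrite ler01 lexx)) t01).
      by rewrite scale1r in Dy; have [_ /(_ a) []] := Hg _ Dy.
    have Dy := dd1 _ (close 0 t (ltac:(by rewrite ler01 lexx)) t01).
    by rewrite scale0r add0r in Dy; have [_ /(_ a) []] := Hg _ Dy.
  rewrite E.
  have [c' c01' ->] : exists2 c' : R, 0 <= c' <= 1 &
    dg a (h *: delta_mx ord0 b + (c *: (h *: delta_mx ord0 a) + x)) - dg a (c *: (h *: delta_mx ord0 a) + x) =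
    h * ddg a b (c' *: (h *: delta_mx ord0 b) + (c *: (h *: delta_mx ord0 a) + x)).
    apply: (@MVT_line _ _ (dg a) (fun y => h * ddg a b y)) => t t01.
    apply: is_derive_scaledir; have Dy := dd1 _ (close t c t01 c01).
    by have [_ /(_ b) []] := Hdg a _ Dy.
  by exists (c' *: (h *: delta_mx ord0 b) + (c *: (h *: delta_mx ord0 a) + x)) => //; exact: close.
have [p pd Ep] := key i j; have [q qd Eq] := key j i.
have E : ddg i j p = ddg j i q.
  apply: (@mulfI _ h); first by rewrite gt_eqF.
  apply: (@mulfI _ h); first by rewrite gt_eqF.
  rewrite -Ep -Eq (addrCA (h *: delta_mx ord0 j)); ring.
have := h2 p (lt_le_trans pd _); have := h3 q (lt_le_trans qd _).
rewrite !ge_min !lexx !orbT => /(_ isT) H3 /(_ isT) H2.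
have : `|ddg i j x - ddg j i x| < e + e.
  rewrite (_ : ddg i j x - ddg j i x = (ddg j i q - ddg j i x) - (ddg i j p - ddg i j x)); last by rewrite E; ring.
  by apply: le_lt_trans (ler_normB _ _) _; exact: ltrD.
by rewrite /e -splitr ltxx.
Qed.

End C1.

(** * Boundary limits *)

Lemma continuous_subr (R : realType) (V : normedModType R) (y : V) : continuous (fun x : V => x - y).
Proof. by apply: nonexpansive_continuous => a b; rewrite opprB addrA subrK. Qed.

Section boundary_limits.
Context {R : realType} {V : normedModType R}.
Implicit Types (D : set V) (f g : V -> R) (x : V) (l : R).

(** Meant for frontier points [x], where the value of [g] itself carries no information. *)
Definition limin D g x l := g @ within D (nbhs x) --> l.

Lemma limin_eps D g x l (e : R) : limin D g x l -> 0 < e ->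
  exists2 d : R, 0 < d & forall y, D y -> `|y - x| < d -> `|g y - l| < e.
Proof.
move=> /cvgrPdist_lt h e0; have := h e e0; rewrite near_withinE => /nbhs_eps[d d0 dh].
by exists d => // y Dy yd; rewrite distrC; exact: dh.
Qed.

Lemma eps_limin D g x l :
  (forall e : R, 0 < e -> exists2 d : R, 0 < d & forall y, D y -> `|y - x| < d -> `|g y - l| < e) ->
  limin D g x l.
Proof.
move=> h; apply/cvgrPdist_lt => e e0; rewrite near_withinE.
have [d d0 dh] := h e e0; apply: (@eps_nbhs _ _ x _ d) => // y yd Dy.
by rewrite distrC; exact: dh.
Qed.

Lemma limin_cont D g x : {for x, continuous g} -> limin D g x (g x).
Proof. by move=> h; apply: cvg_within_filter. Qed.

Lemma liminD D f g x l m : limin D f x l -> limin D g x m -> limin D (fun y => f y + g y) x (l + m).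
Proof. by move=> hf hg; apply: cvgD. Qed.

Lemma liminM D f g x l m : limin D f x l -> limin D g x m -> limin D (fun y => f y * g y) x (l * m).
Proof. by move=> hf hg; apply: cvgM. Qed.

Lemma limin_cst D x (a : R) : limin D (fun=> a) x a.
Proof. exact: cvg_cst. Qed.

Lemma limin_sum D (I : Type) (s : seq I) (P : pred I) (F : I -> V -> R) (L : I -> R) x :
  (forall i, P i -> limin D (F i) x (L i)) ->
  limin D (fun y => \sum_(i <- s | P i) F i y) x (\sum_(i <- s | P i) L i).
Proof.
move=> h; elim: s => [|i s IH].
  by under eq_fun do rewrite big_nil; rewrite big_nil; exact: limin_cst.
have [Pi|Pi] := boolP (P i).
  under eq_fun do rewrite big_cons Pi; rewrite big_cons Pi; apply: liminD => //; exact: h.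
by under eq_fun do rewrite big_cons (negbTE Pi); rewrite big_cons (negbTE Pi).
Qed.

Lemma limin_comp D f (h : R -> R) x l : limin D f x l -> {for l, continuous h} ->
  limin D (fun y => h (f y)) x (h l).
Proof. by move=> hf hh; apply: (cvg_comp f h hf hh). Qed.

Lemma limin_uniq D g x l m : closure D x -> limin D g x l -> limin D g x m -> l = m.
Proof. move=> cDx h1 h2; have PF := within_nbhs_proper cDx.
have := @cvg_unique R (@norm_hausdorff R R) (g @ within D (nbhs x)) _.
by apply. Qed.

Lemma closure_eps D x (d : R) : closure D x -> 0 < d -> exists2 y, D y & `|y - x| < d.
Proof.
move=> cDx d0; have [y [Dy yb]] := cDx (ball x d) (nbhsx_ballx _ _ d0).
by exists y => //; move: yb; rewrite -ball_normE /ball_ /= distrC.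
Qed.

Lemma limin_le D f g x l m : closure D x -> limin D f x l -> limin D g x m ->
  (forall y, D y -> f y <= g y) -> l <= m.
Proof.
move=> cDx h1 h2 fg; rewrite leNgt; apply/negP => ml.
pose e : R := (l - m) / 2.
have e0 : 0 < e by rewrite divr_gt0 // subr_gt0.
have [d d0 hd] := limin_eps h1 e0; have [d' d0' hd'] := limin_eps h2 e0.
have dd0 : 0 < Num.min d d' by rewrite lt_min d0.
have [y Dy yx] := closure_eps cDx dd0.
move: yx; rewrite lt_min => /andP[/(hd y Dy) + /(hd' y Dy)].
rewrite !ltr_norml => /andP[h3 _] /andP[_ h4]; have := fg y Dy.
by move: h3 h4; rewrite /e; lra.
Qed.

Lemma limin_eq D f g x l : (forall y, D y -> f y = g y) -> limin D f x l -> limin D g x l.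
Proof.
move=> fg hf; apply: eps_limin => e e0; have [d d0 hd] := limin_eps hf e0.
by exists d => // y Dy yx; rewrite -fg //; exact: hd.
Qed.

Definition ext D g := forall x, closure D x -> exists l, limin D g x l.

Lemma extD D f g : ext D f -> ext D g -> ext D (fun x => f x + g x).
Proof. by move=> hf hg x cx; have [l hl] := hf x cx; have [m hm] := hg x cx; exists (l + m); exact: liminD. Qed.

Lemma extM D f g : ext D f -> ext D g -> ext D (fun x => f x * g x).
Proof. by move=> hf hg x cx; have [l hl] := hf x cx; have [m hm] := hg x cx; exists (l * m); exact: liminM. Qed.

Lemma ext_cst D (a : R) : ext D (fun=> a).
Proof. by move=> x _; exists a; exact: limin_cst. Qed.

Lemma extZ D f (a : R) : ext D f -> ext D (fun x => a * f x).
Proof. by move=> hf; apply: extM => //; exact: ext_cst. Qed.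

Lemma ext_sum D (I : Type) (s : seq I) (P : pred I) (F : I -> V -> R) :
  (forall i, P i -> ext D (F i)) -> ext D (fun y => \sum_(i <- s | P i) F i y).
Proof.
move=> h; elim: s => [|i s IH].
  by under eq_fun do rewrite big_nil; exact: ext_cst.
have [Pi|Pi] := boolP (P i).
  under eq_fun do rewrite big_cons Pi; apply: extD => //; exact: h.
by under eq_fun do rewrite big_cons (negbTE Pi).
Qed.

Lemma ext_continuous D f : continuous f -> ext D f.
Proof. by move=> cf x _; exists (f x); apply: limin_cont; exact: cf. Qed.

Lemma ext_comp D f (h : R -> R) : continuous h -> ext D f -> ext D (fun x => h (f x)).
Proof. by move=> ch hf x cx; have [l hl] := hf x cx; exists (h l); apply: limin_comp => //; exact: ch. Qed.

Lemma ext_eq D f g : (forall y, D y -> f y = g y) -> ext D f -> ext D g.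
Proof. by move=> fg hf x cx; have [l hl] := hf x cx; exists l; exact: limin_eq hl. Qed.

Lemma ext_within D g h : {within closure D, continuous h} ->
  (forall x, D x -> h x = g x) -> forall x, closure D x -> limin D g x (h x).
Proof.
move=> /subspace_continuousP ch hg x cx; apply: limin_eq hg _.
have := ch x cx; apply: cvg_trans; apply: cvg_app; apply: within_subset.
  exact: subset_closure.
Qed.

(** A pointwise choice of limits is automatically continuous: [h y] and [h x] are compared through a
    point [z] of [D] close to [y], with half of [e] for each. *)
Lemma within_extension D g (h : V -> R) : 
  (forall x, closure D x -> limin D g x (h x)) -> {within closure D, continuous h}.
Proof.
move=> gh; apply/subspace_continuousP => x cx; apply: (@eps_limin (closure D) h x (h x)) => e e0.
have e2 : 0 < e / 2 by rewrite divr_gt0.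
have [d d0 hd] := limin_eps (gh x cx) e2.
exists (d / 2); first by rewrite divr_gt0.
move=> y cy yx; have [d' d0' hd'] := limin_eps (gh y cy) e2.
have dd0 : 0 < Num.min d' (d / 2) by rewrite lt_min d0' divr_gt0.
have [z Dz zy] := closure_eps cy dd0.
move: zy; rewrite lt_min => /andP[z1 z2].
have := hd' z Dz z1; have := hd z Dz _.
have -> : `|z - x| < d.
  rewrite (_ : z - x = (z - y) + (y - x)); last by rewrite addrA subrK.
  by apply: le_lt_trans (ler_normD _ _) _; rewrite [d]splitr; exact: ltrD.
move=> /(_ isT) H1 H2.
rewrite (_ : h y - h x = (g z - h x) - (g z - h y)); last by ring.
by apply: le_lt_trans (ler_normB _ _) _; rewrite [e]splitr; exact: ltrD.
Qed.

End boundary_limits.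

Lemma ext_lcb (R : realType) n (D : set 'rV[R]_n) (g : 'rV[R]_n -> R) :
  (forall x, D x -> {for x, continuous g}) -> ext D g -> lcb D g.
Proof.
move=> cg eg; split=> // r.
have /choice[h hP] : forall x, exists l, closure D x -> limin D g x l.
  move=> x; have [cx|cx] := pselect (closure D x); last by exists 0.
  by have [l hl] := eg x cx; exists l.
pose K := closure D `&` [set x : 'rV[R]_n | `|x| <= r].
have cK : compact K.
  apply: bounded_closed_compact.
    exists r; split; first exact: num_real.
    by move=> M rM x [_ /= xr]; apply: le_trans xr (ltW rM).
  apply: closedI; first exact: closed_closure.
  rewrite (_ : [set x : 'rV[R]_n | _] = (fun x : 'rV[R]_n => `|x|) @^-1` [set t | t <= r])//.
  by apply: closed_comp => [x _|]; [exact: norm_continuous|exact: closed_le].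
have /compact_bounded[M [_ MK]] : compact (h @` K).
  apply: continuous_compact => //; apply: (@continuous_subspaceW _ _ _ (closure D)).
    by move=> x [].
  by apply: (@within_extension _ _ D g) => x cx; exact: hP.
exists (M + 1) => x Dx xr; have cx : closure D x by exact: subset_closure.
rewrite (@limin_uniq _ _ D g x (g x) (h x)) //.
- by apply: MK; [rewrite ltrDl|exists x].
- by apply: limin_cont; exact: cg.
- exact: hP.
Qed.

Lemma lcb_closed_ball (R : realType) n (U : set 'rV[R]_n) (g : 'rV[R]_n -> R) (y : 'rV[R]_n) (r : R) :
  (forall x, U x -> {for x, continuous g}) -> (forall x, `|x - y| <= r -> U x) ->
  exists M, forall x, `|x - y| <= r -> `|g x| <= M.
Proof.
move=> cg yU; pose K := [set x : 'rV[R]_n | `|x - y| <= r].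
have cK : compact K.
  apply: bounded_closed_compact.
    exists (r + `|y|); split; first exact: num_real.
    move=> M rM x /= xr; apply: le_trans (ltW rM).
    by rewrite -[x](subrK y); apply: le_trans (ler_normD _ _) _; rewrite lerD2r.
  rewrite (_ : K = (fun x : 'rV[R]_n => `|x - y|) @^-1` [set t | t <= r])//.
  apply: closed_comp => [x _|]; last exact: closed_le.
  apply: (@continuous_comp _ _ _ (fun x : 'rV[R]_n => x - y)); last exact: norm_continuous.
  exact: continuous_subr.
have /compact_bounded[M [_ MK]] : compact (g @` K).
  by apply: continuous_compact => //; apply: continuous_in_subspaceT => x; rewrite inE => /yU; exact: cg.
by exists (M + 1) => x xr; apply: MK; [rewrite ltrDl|exists x].
Qed.

(** * Smooth steps and ramps of one variable *)

Section scalar_functions.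
Context {R : realType}.
Implicit Types t : R.

Definition pos t : R := Num.max t 0.

Lemma pos_ge0 t : 0 <= pos t. Proof. by rewrite /pos le_max lexx orbT. Qed.
Lemma pos_id t : 0 <= t -> pos t = t. Proof. by move=> h; rewrite /pos max_l. Qed.
Lemma pos_nonpos t : t <= 0 -> pos t = 0. Proof. by move=> h; rewrite /pos max_r. Qed.

Lemma pos_continuous : continuous pos.
Proof.
apply: nonexpansive_continuous => x y; rewrite /pos.
case: (leP x 0) => hx; case: (leP y 0) => hy.
- by rewrite subrr normr0.
- by rewrite sub0r normrN (gtr0_norm hy) ler0_norm; lra.
- by rewrite subr0 (gtr0_norm hx) ger0_norm; lra.
- by [].
Qed.

(** The kink of [pos] at [0] is harmless because [h' 0 = 0]; the left difference quotients there are
    identically [0]. *)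
Lemma is_derive_pos (h h' : R -> R) : (forall t, 0 <= t -> is_derive t 1 h (h' t)) -> h' 0 = 0 ->
  forall t, is_derive t 1 (fun t => h (pos t)) (h' (pos t)).
Proof.
move=> hh h'0 t; have [t0|t0|->] := ltgtP t 0.
- rewrite (pos_nonpos (ltW t0)) h'0.
  apply: (@near_eq_is_derive_on R R [set t | t < 0] (cst (h 0)) _ t 1 0) => //=.
  + by move=> y /= y0; rewrite (pos_nonpos (ltW y0)).
- rewrite (pos_id (ltW t0)).
  apply: (@near_eq_is_derive_on R R [set t | 0 < t] h _ t 1 (h' t)) => //=.
  + by move=> y /= y0; rewrite (pos_id (ltW y0)).
  + by apply: hh; exact: ltW.
rewrite (pos_id (lexx 0)) h'0.
have H0 := hh 0 (lexx 0); rewrite h'0 in H0.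
have : (fun s : R => s^-1 *: (((fun t => h (pos t)) \o shift 0) (s *: 1) - h (pos 0))) @ 0^' --> (0 : R); last first.
  by move=> H; split; [exact: cvgP H|exact: cvg_lim H].
have [d0 v0] := H0; move: d0; rewrite /derivable => d0.
have /cvgrPdist_lt d1 : (fun s : R => s^-1 *: ((h \o shift 0) (s *: 1) - h 0)) @ 0^' --> (0 : R).
  by have := d0; rewrite -[lim _]/('D_1 h 0) v0.
apply/cvgrPdist_lt => e e0; have := d1 e e0; rewrite !near_withinE.
apply: filterS => s /= hs s0; have := hs s0; rewrite !sub0r !normrN !addr0 (pos_id (lexx 0)) [_ *: 1]mulr1.
have [s1|s1] := leP 0 s; first by rewrite pos_id.
by rewrite (pos_nonpos (ltW s1)) subrr scaler0 normr0.
Qed.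

Lemma is_derive_pow k t : is_derive t 1 (fun t : R => t ^+ k.+1) (k.+1%:R * t ^+ k).
Proof.
have h : is_derive t 1 ((id : R -> R) ^+ k.+1) ((k.+1%:R * t ^+ k) *: (1 : R)) by apply: is_deriveX.
have -> : (fun t : R => t ^+ k.+1) = (id : R -> R) ^+ k.+1 by apply/funext => s; rewrite fctE.
by apply: (is_derive_eq h); rewrite [_ *: _]mulr1.
Qed.

Lemma is_derive_posX k t : is_derive t 1 (fun t : R => pos t ^+ k.+2) (k.+2%:R * pos t ^+ k.+1).
Proof.
apply: (@is_derive_pos (fun t => t ^+ k.+2) (fun t => k.+2%:R * t ^+ k.+1)).
  by move=> s _; exact: is_derive_pow.
by rewrite exprS mul0r mulr0.
Qed.

(** A C1 step from [0] on [t <= 1] to [1] on [t >= 2]; its derivative is the tent over [[1, 2]] of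
    height [2] at [3 / 2]. *)
Definition sstep t : R := 2 * (pos (t - 1) ^+ 2 - 2 * pos (t - 3 / 2) ^+ 2 + pos (t - 2) ^+ 2).
Definition sstep' t : R := 4 * (pos (t - 1) - 2 * pos (t - 3 / 2) + pos (t - 2)).

Lemma is_derive_shift1 (h : R -> R) (a t d : R) : is_derive (t - a) 1 h d -> is_derive t 1 (fun t => h (t - a)) d.
Proof.
move=> H; have H2 := @is_derive_shift_arg R R h (- a) t 1 d.
rewrite (_ : (fun t => h (t - a)) = (fun y => h (- a + y))).
  by apply: H2; rewrite addrC.
by apply/funext => y; rewrite addrC.
Qed.

Lemma is_derive_sstep t : is_derive t 1 sstep (sstep' t).
Proof.
have h a : is_derive t 1 (fun t => pos (t - a) ^+ 2) (2 * pos (t - a)).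
  apply: (@is_derive_shift1 (fun t => pos t ^+ 2)).
  by have := is_derive_posX 0 (t - a); rewrite expr1.
have H := is_deriveZ 2 (is_deriveD (is_deriveB (h 1) (is_deriveZ 2 (h (3 / 2)))) (h 2)).
apply: (is_derive_eq H).
by rewrite /sstep' /GRing.scale /= !mulrDr !mulrN !mulrA; ring.
Qed.

Lemma sstep'_continuous : continuous sstep'.
Proof.
move=> t; have h a : {for t, continuous (fun t => pos (t - a))}.
  apply: continuous_comp; last exact: pos_continuous.
  exact: continuous_subr.
have H : {for t, continuous (fun t => 4 * (pos (t - 1) - 2 * pos (t - 3 / 2) + pos (t - 2)))}.
  apply: continuousM; first exact: cst_continuous.
  apply: continuousD; last exact: h.
  by apply: continuousB; [exact: h|apply: continuousM; [exact: cst_continuous|exact: h]].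
exact: H.
Qed.

Lemma sstep_continuous : continuous sstep.
Proof. by move=> t; exact: is_derive_continuous1 (is_derive_sstep t). Qed.

Lemma sstep0 t : t <= 1 -> sstep t = 0 /\ sstep' t = 0.
Proof. by move=> h; rewrite /sstep /sstep' !pos_nonpos; [split; ring|lra..]. Qed.

Lemma sstep1 t : 2 <= t -> sstep t = 1 /\ sstep' t = 0.
Proof. by move=> h; rewrite /sstep /sstep' !pos_id; [split; field|lra..]. Qed.

Lemma sstep_cases t : [/\ 0 <= sstep t <= 1, 0 <= sstep' t & sstep' t <= 2].
Proof.
have [h|h] := leP t 1; first by have [-> ->] := sstep0 h; rewrite !lexx ler01; split=> //; lra.
have [h2|h2] := leP 2 t; first by have [-> ->] := sstep1 h2; rewrite !lexx ler01; split=> //; lra.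
rewrite /sstep /sstep' (@pos_id (t - 1)) ?(@pos_nonpos (t - 2)); [|lra..].
have [h3|h3] := leP t (3 / 2).
  by rewrite (@pos_nonpos (t - 3 / 2)); [split; [apply/andP; split|..]; nra|lra].
by rewrite (@pos_id (t - 3 / 2)); [split; [apply/andP; split|..]; nra|lra].
Qed.

(* [t ^ 3 / (1 + t) ^ 2] for [t >= 0], convex of class C^2 *)
Definition ramp t : R := pos t - 2 + 3 * (1 + pos t)^-1 - (1 + pos t)^-1 ^+ 2.
Definition ramp' t : R := 1 - 3 * (1 + pos t)^-1 ^+ 2 + 2 * (1 + pos t)^-1 ^+ 3.
Definition ramp'' t : R := 6 * (1 + pos t)^-1 ^+ 3 - 6 * (1 + pos t)^-1 ^+ 4.

Lemma is_derive_inv1 t : 0 <= t -> is_derive t 1 (fun t : R => (1 + t)^-1) (- ((1 + t)^-1 ^+ 2)).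
Proof.
move=> t0; have h : is_derive t 1 (fun t : R => 1 + t) 1.
  have H := is_deriveD (is_derive_cst (1:R) t (1:R)) (is_derive_id t (1:R)).
  by apply: (is_derive_eq H); rewrite add0r.
have n0 : 1 + t != 0 by lra.
have := @is_deriveV R _ t 1 1 n0 h.
by move=> /is_derive_eq; apply; rewrite [_ *: _]mulr1 exprVn.
Qed.

Lemma is_derive_inv1X k t : 0 <= t ->
  is_derive t 1 (fun t : R => (1 + t)^-1 ^+ k.+1) (- (k.+1%:R * (1 + t)^-1 ^+ k.+2)).
Proof.
move=> t0; have h := @is_derive1_comp R (fun t => t ^+ k.+1) (fun t => (1 + t)^-1) t _ _ (is_derive_pow k _) (is_derive_inv1 t0).
by apply: (is_derive_eq h); rewrite !exprS; ring.
Qed.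

Lemma is_derive_ramp t : is_derive t 1 ramp (ramp' t).
Proof.
apply: (@is_derive_pos (fun t => t - 2 + 3 * (1 + t)^-1 - (1 + t)^-1 ^+ 2)
  (fun t => 1 - 3 * (1 + t)^-1 ^+ 2 + 2 * (1 + t)^-1 ^+ 3)); last first.
  by rewrite addr0 invr1 !expr1n; ring.
move=> s s0.
have H := is_deriveB (is_deriveD (is_deriveB (is_derive_id s (1:R)) (is_derive_cst (2:R) s (1:R))) (is_deriveZ 3 (is_derive_inv1 s0))) (is_derive_inv1X 1 s0).
by apply: (is_derive_eq H); rewrite /GRing.scale /=; ring.
Qed.

Lemma is_derive_ramp' t : is_derive t 1 ramp' (ramp'' t).
Proof.
apply: (@is_derive_pos (fun t => 1 - 3 * (1 + t)^-1 ^+ 2 + 2 * (1 + t)^-1 ^+ 3)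
  (fun t => 6 * (1 + t)^-1 ^+ 3 - 6 * (1 + t)^-1 ^+ 4)); last first.
  by rewrite addr0 invr1 !expr1n; ring.
move=> s s0.
have H := is_deriveD (is_deriveB (is_derive_cst (1:R) s (1:R)) (is_deriveZ 3 (is_derive_inv1X 1 s0))) (is_deriveZ 2 (is_derive_inv1X 2 s0)).
by apply: (is_derive_eq H); rewrite /GRing.scale /=; ring.
Qed.

Lemma ramp''_continuous : continuous ramp''.
Proof.
move=> t; have h : {for t, continuous (fun t => (1 + pos t)^-1)}.
  apply: continuousV; first by have := pos_ge0 t; lra.
  by apply: continuousD; [exact: cst_continuous|exact: pos_continuous].
have hX k : {for t, continuous (fun t => (1 + pos t)^-1 ^+ k)}.
  by apply: (@continuous_comp _ _ _ (fun t => (1 + pos t)^-1) (fun t => t ^+ k)) => //; exact: exprn_continuous.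
have H : {for t, continuous (fun t => 6 * (1 + pos t)^-1 ^+ 3 - 6 * (1 + pos t)^-1 ^+ 4)}.
  by apply: continuousB; (apply: continuousM; [exact: cst_continuous|exact: hX]).
exact: H.
Qed.

Lemma ramp_le0 t : t <= 0 -> ramp t = 0 /\ ramp' t = 0.
Proof. by move=> h; rewrite /ramp /ramp' pos_nonpos // addr0 invr1 !expr1n; split; ring. Qed.

Lemma ramp_bounds t : [/\ 0 <= ramp t, 0 <= ramp' t, ramp' t <= 1, 0 <= ramp'' t & ramp t <= pos t * ramp' t].
Proof.
rewrite /ramp /ramp' /ramp''; have := pos_ge0 t; set s := pos t => s0.
have w0 : 0 < 1 + s by lra.
have [v vE] : exists v, v = (1 + s)^-1 by exists (1 + s)^-1.
rewrite -vE; have v0 : 0 < v by rewrite vE invr_gt0.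
have v1 : v <= 1 by rewrite vE invf_le1 //; lra.
have sv : s * v = 1 - v by rewrite vE; field; lra.
(* From [s v = 1 - v], the function [ramp] equals [s (1 - v) ^ 2]; the bounds then reduce to signs
   of products. *)
have E : s - 2 + 3 * v - v ^+ 2 = s * (1 - v) ^+ 2.
  by rewrite !expr2; transitivity (s - 2 * (s * v) + (s * v) * v); [rewrite sv; ring|ring].
split.
- by rewrite E mulr_ge0 // sqr_ge0.
- have -> : 1 - 3 * v ^+ 2 + 2 * v ^+ 3 = (1 - v) ^+ 2 * (1 + 2 * v) by ring.
  by rewrite mulr_ge0 ?sqr_ge0 //; lra.
- have : 0 <= v ^+ 2 * (3 - 2 * v) by rewrite mulr_ge0 ?sqr_ge0 //; lra.
  by rewrite !exprS !expr0; lra.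
- have -> : 6 * v ^+ 3 - 6 * v ^+ 4 = 6 * v ^+ 3 * (1 - v) by ring.
  by rewrite !mulr_ge0 ?exprn_ge0 ?(ltW v0) //; lra.
- rewrite E; have -> : s * (1 - 3 * v ^+ 2 + 2 * v ^+ 3) = s * (1 - v) ^+ 2 + 2 * v * (s * (1 - v) ^+ 2) by ring.
  by rewrite lerDl; apply: mulr_ge0; [lra|apply: mulr_ge0; rewrite ?sqr_ge0].
Qed.

(** With [v = 1 / (1 + t)] one has [ramp' t = (1 - v) ^ 2 (1 + 2 v)], and [v] decreases in [t]. *)
Lemma ramp'_lower (t0 t : R) : 0 < t0 -> t0 <= t -> (1 - (1 + t0)^-1) ^+ 2 <= ramp' t.
Proof.
move=> t0p t0t; rewrite /ramp' pos_id; last by lra.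
have w0 : 0 < 1 + t0 by lra.
have : (1 + t)^-1 <= (1 + t0)^-1 by rewrite lef_pV2 ?posrE; lra.
have : (1 + t0)^-1 < 1 by rewrite invf_lt1 //; lra.
have : 0 < (1 + t)^-1 by rewrite invr_gt0; lra.
move: (1 + t0)^-1 (1 + t)^-1 => v0 v vp v01 vv0.
have -> : 1 - 3 * v ^+ 2 + 2 * v ^+ 3 = (1 - v) ^+ 2 + 2 * v * (1 - v) ^+ 2 by ring.
have : (1 - v0) ^+ 2 <= (1 - v) ^+ 2 by rewrite ler_sqr ?nnegrE; lra.
have : 0 <= 2 * v * (1 - v) ^+ 2 by rewrite !mulr_ge0 ?sqr_ge0 //; lra.
lra.
Qed.

End scalar_functions.

(** * Flux through the boundary *)

Lemma C1g_MVT_coord (R : realType) n (D : set 'rV[R]_n) g dg (x : 'rV[R]_n) (j : 'I_n) (tau : R) :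
  C1g D g dg ->
  (forall c : R, 0 <= c <= 1 -> D ((c * tau) *: delta_mx ord0 j + x)) ->
  exists2 c : R, 0 <= c <= 1 &
    g (tau *: delta_mx ord0 j + x) - g x = tau * dg j ((c * tau) *: delta_mx ord0 j + x).
Proof.
move=> Hg HD.
have [c c01 E] : exists2 c : R, 0 <= c <= 1 & g (tau *: delta_mx ord0 j + x) - g x =
    tau * dg j (c *: (tau *: delta_mx ord0 j) + x).
  apply: (@MVT_line R 'rV[R]_n g (fun y => tau * dg j y)) => t t01.
  apply: is_derive_scaledir; have Dt := HD t t01; rewrite -scalerA in Dt.
  by have [_ /(_ j)[]] := Hg _ Dt.
by exists c => //; rewrite E scalerA.
Qed.

Lemma continuous_sum_fin (R : realType) (V : normedModType R) (I : Type) (s : seq I) (P : pred I)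
  (F : I -> V -> R) (x : V) :
  (forall i, P i -> {for x, continuous (F i)}) ->
  {for x, continuous (fun x => \sum_(i <- s | P i) F i x)}.
Proof.
move=> h; elim: s => [|i s IH].
  rewrite (_ : (fun x => _) = cst 0); first exact: cst_continuous.
  by apply/funext => y; rewrite big_nil.
have [Pi|Pi] := boolP (P i).
  rewrite (_ : (fun x => _) = (fun x => F i x + \sum_(j <- s | P j) F j x)).
    by apply: continuousD => //; exact: h.
  by apply/funext => y; rewrite big_cons Pi.
rewrite (_ : (fun x => _) = (fun x => \sum_(j <- s | P j) F j x)) //.
by apply/funext => y; rewrite big_cons (negbTE Pi).
Qed.

Lemma C1g_glue (R : realType) n (W K : set 'rV[R]_n) (F : 'rV[R]_n -> R) (dF : 'I_n -> 'rV[R]_n -> R) :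
  closed K -> K `<=` W -> C1g W F dF -> (forall x, ~ K x -> F x = 0) ->
  (forall i x, ~ K x -> dF i x = 0) -> C1g setT F dF.
Proof.
move=> cK KW HF F0 dF0 x _; have [Kx|Kx] := pselect (K x); first exact: HF (KW _ Kx).
have oK : open (~` K) by exact: closed_openC.
split.
  apply: (@near_eq_continuous R 'rV[R]_n (~` K) (cst 0) F x oK Kx).
    by move=> y Ky; rewrite F0.
  exact: cst_continuous.
move=> i; split.
  rewrite dF0 //; apply: (@near_eq_is_derive_on R 'rV[R]_n (~` K) (cst 0) F x _ 0 oK Kx).
    by move=> y Ky; rewrite F0.
apply: (@near_eq_continuous R 'rV[R]_n (~` K) (cst 0) _ x oK Kx).
  by move=> y Ky; rewrite dF0.
exact: cst_continuous.
Qed.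

Lemma open_outside (R : realType) (V : normedModType R) (y0 : V) (r : R) :
  open [set x : V | r < `|x - y0|].
Proof.
rewrite (_ : [set x : V | _] = (fun x : V => `|x - y0|) @^-1` [set t | r < t]) //.
apply: open_comp; last exact: open_gt.
move=> x _; apply: (@continuous_comp _ _ _ (fun x : V => x - y0)); first exact: continuous_subr.
exact: norm_continuous.
Qed.

Lemma ibl_glue (R : realType) n (D U : set 'rV[R]_n) (F : 'rV[R]_n -> R) (y0 : 'rV[R]_n) (r M : R) :
  (forall x, `|x - y0| <= r -> U x) -> (forall x, D x -> U x -> {for x, continuous F}) ->
  (forall x, r < `|x - y0| -> F x = 0) ->
  (forall x, D x -> `|x - y0| <= r -> `|F x| <= M) -> ibl D F.
Proof.
move=> yU cF F0 FM; split; [split|].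
- move=> x Dx; have [h|h] := leP `|x - y0| r; first by apply: cF => //; exact: yU.
  apply: (@near_eq_continuous R 'rV[R]_n [set x | r < `|x - y0|] (cst 0) F x) => //.
  + exact: open_outside.
  + by move=> y /= hy; rewrite F0.
  + exact: cst_continuous.
- move=> rho; exists `|M| => x Dx _; have [h|h] := leP `|x - y0| r.
    by apply: le_trans (FM x Dx h) _; exact: ler_norm.
  by rewrite F0 // normr0.
- exists (r + `|y0|) => x Dx h; apply: F0.
  rewrite -(ltrD2r `|y0|); apply: lt_le_trans h _.
  by rewrite -{1}[x](subrK y0); exact: ler_normD.
Qed.

Lemma dtheta_outside (R : realType) n (theta : 'rV[R]_n -> R) dtheta (y0 : 'rV[R]_n) (r : R) :
  C1g setT theta dtheta -> (forall x, r < `|x - y0| -> theta x = 0) ->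
  forall i x, r < `|x - y0| -> dtheta i x = 0.
Proof.
move=> Ht t0 i x rx; have [_ /(_ i) [h _]] := Ht x I.
apply: (is_derive_locally0 _ h).
have : nbhs x [set x : 'rV[R]_n | r < `|x - y0|] by apply: open_nbhs_nbhs; split=> //; exact: open_outside.
by apply: filterS => y /= hy; exact: t0.
Qed.

Section local_boundary.
Context {R : realType} {n : nat}.
Variables (D U : set 'rV[R]_n) (phi : 'rV[R]_n -> R) (dphi : 'I_n -> 'rV[R]_n -> R).
Hypothesis oD : open D.
Hypothesis oU : open U.
Hypothesis Hphi : C1g U phi dphi.
Hypothesis DU : forall y, U y -> (D y <-> phi y < 0).

(** [s] is the sign of [dphi j y0]: moving along [s] times the [j]-th axis raises [phi] at rate at
    least [a]. The radius [2 r] leaves room for a segment of length [r] issued from any point of the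
    ball of radius [r]. *)
Lemma boundary_radius (y0 : 'rV[R]_n) (j : 'I_n) : U y0 -> dphi j y0 != 0 ->
  exists r a s : R, [/\ 0 < r, 0 < a, `|s| = 1 &
    forall x, `|x - y0| <= 2 * r -> U x /\ a <= s * dphi j x].
Proof.
move=> Uy0 dj0; pose d := dphi j y0; pose s : R := Num.sg d; pose a : R := `|d| / 2.
have d0 : 0 < `|d| by rewrite normr_gt0.
have a0 : 0 < a by rewrite divr_gt0.
have [r1 r10 h1] := open_eps oU Uy0.
have [_ /(_ j) [_ cj]] := Hphi Uy0.
have [r2 r20 h2] := continuous_eps cj a0.
exists (Num.min r1 r2 / 3), a, s; split=> //.
- by rewrite divr_gt0 // lt_min r10.
- by rewrite /s normr_sg dj0.
move=> x xy; have xy' : `|x - y0| < Num.min r1 r2.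
  apply: le_lt_trans xy _; have : 0 < Num.min r1 r2 by rewrite lt_min r10.
  lra.
move: xy'; rewrite lt_min => /andP[x1 x2]; split; first exact: h1.
have := h2 x x2; rewrite -/d => h.
have sd : s * d = `|d| by rewrite normrEsg.
have s1 : `|s * (dphi j x - d)| < a by rewrite normrM /s normr_sg dj0 mul1r.
move: s1; rewrite mulrBr sd ltr_norml => /andP[+ _].
by rewrite /a; lra.
Qed.

(** From [x] the frontier is met along the axis [j] after a length at most [T = |phi x| / a],
    provided [T < r]; as [k] is almost nonpositive there, [k x <= M T]. When [r <= T] the trivial
    bound [k x <= M <= M T / r] is enough. The two terms of the constant serve these two cases. *)
Lemma boundary_bound (y0 : 'rV[R]_n) (j : 'I_n) (r a s M : R) (k : 'rV[R]_n -> R) dk :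
  0 < r -> 0 < a -> `|s| = 1 ->
  (forall x, `|x - y0| <= 2 * r -> U x /\ a <= s * dphi j x) ->
  C1g (D `&` U) k dk ->
  (forall x, D x -> `|x - y0| <= 2 * r -> `|k x| <= M /\ `|dk j x| <= M) ->
  (forall y, U y -> phi y = 0 -> `|y - y0| <= 2 * r -> forall e : R, 0 < e ->
     exists2 d : R, 0 < d & forall x, D x -> `|x - y| < d -> k x < e) ->
  forall x, D x -> `|x - y0| <= r -> k x <= (M / a + M / (a * r)) * `|phi x|.
Proof.
move=> r0 a0 s1 hU Hk kM k0 x Dx xr.
have x2r : `|x - y0| <= 2 * r by lra.
have [Ux _] := hU x x2r.
have M0 : 0 <= M by have [h _] := kM x Dx x2r; exact: le_trans h.
have px : phi x < 0 by apply/(DU Ux).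
rewrite (ltr0_norm px).
have [T T0 Te] : exists2 T : R, 0 < T & - phi x = a * T.
  by exists (- phi x / a); [rewrite divr_gt0 // oppr_gt0|field; rewrite gt_eqF].
have Ma0 : 0 <= M / a by rewrite divr_ge0 // ltW.
have Mar0 : 0 <= M / (a * r) by rewrite divr_ge0 // mulr_ge0 // ltW.
have [rT|Tr] := leP r T.
  have [h _] := kM x Dx x2r; apply: le_trans (ler_norm _) _; apply: le_trans h _.
  rewrite Te mulrDl; apply: (@le_trans _ _ (M / (a * r) * (a * T))).
    rewrite (_ : _ * (a * T) = M * (T / r)); last by field; rewrite !gt_eqF.
    by rewrite ler_peMr // ler_pdivlMr // mul1r.
  by rewrite lerDr; apply: mulr_ge0 => //; apply: mulr_ge0; exact: ltW.
pose e := s *: (delta_mx ord0 j : 'rV[R]_n).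
pose p (t : R) := phi (t *: e + x).
have e1 : `|e| <= 1 by rewrite normrZ s1 mul1r; exact: norm_delta_mx_le.
have near2 t : 0 <= t <= T -> `|t *: e + x - y0| <= 2 * r.
  move=> /andP[t0 tT]; rewrite -addrA; apply: le_trans (ler_normD _ _) _.
  rewrite normrZ (ger0_norm t0); apply: (@le_trans _ _ (t + r)); last by lra.
  by apply: lerD => //; rewrite ler_piMr.
have inc t t' : 0 <= t -> t <= t' -> t' <= T -> a * (t' - t) <= p t' - p t.
  move=> t0 tt' t'T; rewrite /p.
  have -> : t' *: e + x = ((t' - t) * s) *: delta_mx ord0 j + (t *: e + x).
    by rewrite -scalerA addrA -scalerDl subrK.
  have [c c01 ->] := @C1g_MVT_coord R n U phi dphi (t *: e + x) j ((t' - t) * s) Hphi (ltac:(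
    move=> c /andP[c0 c1]; rewrite mulrA -scalerA addrA -scalerDl;
    apply: (proj1 (hU _ (near2 _ _))); apply/andP; split; nra)).
  rewrite mulrA -scalerA addrA -scalerDl -mulrA [a * _]mulrC; apply: ler_wpM2l; first by lra.
  by case/andP: c01 => c0 c1; apply: (proj2 (hU _ (near2 _ _))); apply/andP; split; nra.
have p0 : p 0 = phi x by rewrite /p scale0r add0r.
have pT : 0 <= p T by have := inc 0 T (lexx 0) (ltW T0) (lexx T); rewrite p0 subr0; lra.
have cp t : 0 <= t <= T -> {for t, continuous p}.
  move=> tT; apply: (@is_derive_continuous1 R p t (\sum_i e ord0 i * dphi i (t *: e + x))).
  by apply: (C1g_line oU Hphi); apply: (proj1 (hU _ (near2 _ tT))).
(* Since [phi] increases strictly along the segment, it is negative before its zero [ts], so the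
   segment stays in [D] up to there. *)
have [ts] : exists2 c : R, c \in `[0, T]%R & p c = 0.
  apply: IVT; first exact: ltW.
    apply: continuous_in_subspaceT => t; rewrite inE /= in_itv /=; exact: cp.
  by rewrite p0 min_l ?max_r; [rewrite pT ltW|lra|lra].
rewrite in_itv /= => /andP[ts0 tsT] pts.
have ts1 : 0 < ts.
  rewrite lt_neqAle ts0 andbT; apply/negP => /eqP h.
  by move: pts; rewrite -h p0 => h2; move: px; rewrite h2 ltxx.
have inD t : 0 <= t -> t < ts -> (D `&` U) (t *: e + x).
  move=> t0 tts; have [Ut _] := hU _ (near2 t (ltac:(apply/andP; split; lra))).
  split=> //; apply/(DU Ut); have := inc t ts t0 (ltW tts) tsT; rewrite pts.
  have : 0 < a * (ts - t) by rewrite mulr_gt0 // subr_gt0.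
  by rewrite /p; lra.
apply: (@le_trans _ _ (M * T)); last first.
  rewrite Te mulrDl (_ : M / a * (a * T) = M * T); last by field; rewrite gt_eqF.
  by rewrite lerDl; apply: mulr_ge0 => //; apply: mulr_ge0; exact: ltW.
apply/ler_addgt0Pr => eps eps0.
have [Uy _] := hU _ (near2 ts (ltac:(apply/andP; split; lra))).
have [d d0 hd] := k0 _ Uy pts (near2 ts (ltac:(apply/andP; split; lra))) eps eps0.
have [t t0 [tts td]] : exists2 t : R, 0 <= t & t < ts /\ ts - t < d.
  exists (Num.max 0 (ts - d / 2)); first by rewrite le_max lexx.
  split; first by rewrite gt_max ts1 /=; lra.
  have : ts - d / 2 <= Num.max 0 (ts - d / 2) by rewrite le_max lexx orbT.
  by move: (Num.max _ _) => q; lra.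
have [Dt Ut] := inD t t0 tts.
have kt : k (t *: e + x) < eps.
  apply: (hd _ Dt); rewrite opprD addrACA subrr addr0 -scalerBl normrZ.
  apply: (@le_lt_trans _ _ `|t - ts|); first by rewrite ler_piMr.
  by rewrite distrC ger0_norm; lra.
have [c c01] := @C1g_MVT_coord R n (D `&` U) k dk x j (t * s) Hk (ltac:(
    move=> c /andP[c0 c1]; rewrite mulrA -scalerA; apply: inD; nra)).
rewrite mulrA -!scalerA -/e (scalerA c t) => E.
have /andP[c0 c1] := c01.
have [_ dkM] := kM _ (proj1 (inD (c * t) (ltac:(nra)) (ltac:(nra)))) (near2 (c * t) (ltac:(apply/andP; split; nra))).
have : `|t * s * dk j ((c * t) *: e + x)| <= T * M.
  rewrite !normrM s1 mulr1 (ger0_norm t0); apply: ler_pM => //; lra.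
rewrite ler_norml => /andP[h1 h2].
by move: E; lra.
Qed.

Section flux.
Variables (y0 : 'rV[R]_n) (r C M : R).
Hypothesis ballU : forall x, `|x - y0| <= r -> U x.
Variables (theta : 'rV[R]_n -> R) (dtheta : 'I_n -> 'rV[R]_n -> R).
Hypothesis Htheta : C1g setT theta dtheta.
Hypothesis theta_ge0 : forall x, 0 <= theta x.
Hypothesis theta0 : forall x, r < `|x - y0| -> theta x = 0.
Variables (X : 'I_n -> 'rV[R]_n -> R) (dX : 'I_n -> 'I_n -> 'rV[R]_n -> R).
Hypothesis HX : forall i, C1g (D `&` U) (X i) (dX i).
Hypothesis XM : forall i x, D x -> `|x - y0| <= r -> `|X i x| <= M /\ `|dX i i x| <= M.
Hypothesis Xphi : forall x, D x -> `|x - y0| <= r ->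
  \sum_i X i x * dphi i x <= C * `|phi x|.

Let G x := \sum_i (dtheta i x * X i x + theta x * dX i i x).
Let k x := \sum_i X i x * dphi i x.
Let zeta (m : nat) x := sstep (- m.+1%:R * phi x).
Let zeta' (m : nat) x := sstep' (- m.+1%:R * phi x).

Let dtheta0 i x : r < `|x - y0| -> dtheta i x = 0.
Proof. exact: (dtheta_outside Htheta theta0). Qed.

Let theta_bound : exists B, forall x, `|x - y0| <= r -> `|theta x| <= B.
Proof.
by apply: (@lcb_closed_ball R n setT) => // x _; have [] := Htheta (x := x) I.
Qed.

Let dtheta_bound : exists B, forall i x, `|x - y0| <= r -> `|dtheta i x| <= B.
Proof.
have /choice[B hB] : forall i, exists B, forall x, `|x - y0| <= r -> `|dtheta i x| <= B.
  move=> i; apply: (@lcb_closed_ball R n setT) => // x _.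
  by have [_ /(_ i)[]] := Htheta (x := x) I.
exists (\sum_i `|B i|) => i x h; apply: le_trans (hB i x h) _; apply: le_trans (ler_norm _) _.
by rewrite (bigD1 i) //= lerDl sumr_ge0.
Qed.

Let cont_DU x : D x -> U x -> [/\ {for x, continuous theta}, {for x, continuous phi},
   forall i, {for x, continuous (dtheta i)} /\ {for x, continuous (dphi i)} &
   forall i, {for x, continuous (X i)} /\ {for x, continuous (dX i i)}].
Proof.
move=> Dx Ux; have [t1 t2] := Htheta (x := x) I; have [p1 p2] := Hphi Ux.
split=> // i; first by split; [have [] := t2 i|have [] := p2 i].
have [x1 x2] := HX i (conj Dx Ux); split=> //.
by have [] := x2 i.
Qed.

Let G0 x : r < `|x - y0| -> G x = 0.
Proof.
by move=> h; rewrite /G big1 // => i _; rewrite dtheta0 // theta0 // !mul0r addr0.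
Qed.

Let contG x : D x -> U x -> {for x, continuous G}.
Proof.
move=> Dx Ux; have [c1 c2 c3 c4] := cont_DU Dx Ux; rewrite /G.
apply: (@continuous_sum_fin R 'rV[R]_n) => i _; have [c5 c6] := c3 i; have [c7 c8] := c4 i.
by apply: continuousD; apply: continuousM.
Qed.

Let iG : ibl D G.
Proof.
have [B hB] := theta_bound; have [B' hB'] := dtheta_bound.
apply: (@ibl_glue R n D U G y0 r (\sum_(i < n) (B' * M + B * M))) => //.
move=> x Dx h; rewrite /G; apply: le_trans (ler_norm_sum _ _ _) _; apply: ler_sum => i _.
have [X1 X2] := XM i Dx h; apply: le_trans (ler_normD _ _) _; rewrite !normrM.
by apply: lerD; apply: ler_pM => //; [exact: hB'|exact: hB].
Qed.

Let contZ m x : U x -> {for x, continuous (zeta m)} /\ {for x, continuous (zeta' m)}.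
Proof.
move=> Ux; have [c1 _] := Hphi Ux.
have c2 : {for x, continuous (fun x => - m.+1%:R * phi x)}.
  by apply: continuousM => //; exact: cst_continuous.
by split; apply: (continuous_comp c2); [exact: sstep_continuous|exact: sstep'_continuous].
Qed.

Let izG m : ibl D (fun x => zeta m x * G x).
Proof.
have [[_ bG] sG] := iG; have [rr hrr] := sG; have [B hB] := bG (`|y0| + r).
apply: (@ibl_glue R n D U _ y0 r B) => //.
- by move=> x Dx Ux; apply: continuousM; [have [] := contZ m Ux|exact: contG].
- by move=> x h; rewrite G0 // mulr0.
- move=> x Dx h; rewrite normrM.
  have [/andP[z0 z1] _ _] := sstep_cases (- m.+1%:R * phi x).
  rewrite /zeta (ger0_norm z0); apply: (@le_trans _ _ `|G x|); first by rewrite ler_piMl.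
  apply: hB => //; rewrite -[x](subrK y0) addrC; apply: le_trans (ler_normD _ _) _.
  by rewrite lerD2l.
Qed.

Let sT m (x : 'rV[R]_n) := theta x * (m.+1%:R * `|phi x| * zeta' m x).

(** With [t = (m + 1) |phi x|], the factor [sstep' t] vanishes for [t >= 2] and is at most [2],
    whence [4 = 2 * 2]. *)
Let sT_bound m x : D x -> U x -> `|m.+1%:R * `|phi x| * zeta' m x| <= 4.
Proof.
move=> Dx Ux; have px : phi x < 0 by apply/(DU Ux).
rewrite /zeta' (ltr0_norm px) mulrN -mulNr; set t := - m.+1%:R * phi x.
have t0 : 0 <= t by rewrite /t mulNr -mulrN mulr_ge0 // oppr_ge0 ltW.
have [_ s0 s2] := sstep_cases t.
rewrite ger0_norm; last by rewrite mulr_ge0.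
have [h|h] := leP t 2; last by have [_ ->] := sstep1 (ltW h); rewrite mulr0.
by rewrite (_ : 4 = 2 * 2); [apply: ler_pM|ring].
Qed.

Let isT m : ibl D (sT m).
Proof.
have [B hB] := theta_bound.
apply: (@ibl_glue R n D U _ y0 r (B * 4)) => //.
- move=> x Dx Ux; have [c1 c2 _ _] := cont_DU Dx Ux; have [_ cz] := contZ m Ux.
  apply: continuousM => //; apply: continuousM => //; apply: continuousM; first exact: cst_continuous.
  by apply: (continuous_comp c2); exact: norm_continuous.
- by move=> x h; rewrite /sT theta0 // mul0r.
- move=> x Dx h; rewrite /sT normrM; apply: ler_pM => //; first exact: hB.
  by apply: sT_bound => //; exact: ballU.
Qed.

Let Kset m := [set x | `|x - y0| <= r /\ phi x <= - m.+1%:R^-1].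

Let K_closed m : closed (Kset m).
Proof.
rewrite -openC openE => x Kx; rewrite /interior.
have [h|h] := leP `|x - y0| r; last first.
  have : nbhs x [set x : 'rV[R]_n | r < `|x - y0|] by apply: open_nbhs_nbhs; split=> //; exact: open_outside.
  by apply: filterS => y /= hy [hy' _]; move: hy; rewrite ltNge hy'.
have Ux := ballU h; have [cx _] := Hphi Ux.
have e0 : 0 < phi x + m.+1%:R^-1.
  rewrite ltNge; apply/negP => h2; apply: Kx; split=> //; by rewrite -lerBrDr sub0r in h2.
have [d d0 hd] := continuous_eps cx e0.
apply: (eps_nbhs d0) => y /hd; rewrite ltr_norml => /andP[h1 _] [_ h2].
by move: h1 h2; move: (m.+1%:R^-1) => q; lra.
Qed.

Let K_sub m : Kset m `<=` D `&` U.
Proof.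
move=> x [h1 h2]; have Ux := ballU h1; split=> //; apply/(DU Ux).
by apply: le_lt_trans h2 _; rewrite oppr_lt0 invr_gt0.
Qed.

Let F m i x := zeta m x * (theta x * X i x).
Let dF m i l x := (zeta' m x * (- m.+1%:R * dphi l x)) * (theta x * X i x) +
  zeta m x * (dtheta l x * X i x + theta x * dX i l x).

Let outK m x : ~ Kset m x -> r < `|x - y0| \/ zeta m x = 0 /\ zeta' m x = 0.
Proof.
move=> Kx; have [h|h] := leP `|x - y0| r; [right|by left].
apply: sstep0; rewrite leNgt; apply/negP => h2; apply: Kx; split=> //.
have m0 : 0 < (m.+1%:R : R) by [].
by rewrite -(ler_pM2l m0) mulrN divff ?gt_eqF //; move: h2; rewrite mulNr; lra.
Qed.

Let C1F m i : C1g setT (F m i) (dF m i).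
Proof.
apply: (@C1g_glue R n (D `&` U) (Kset m)) => //.
- have Hz : C1g (D `&` U) (zeta m) (fun l x => zeta' m x * (- m.+1%:R * dphi l x)).
    apply: (@C1g_comp R n (D `&` U) _ _ sstep sstep').
      by apply: C1gZ; apply: C1gS Hphi => x [].
    by move=> x _; split; [exact: is_derive_sstep|exact: sstep'_continuous].
  have Ht : C1g (D `&` U) theta dtheta by apply: C1gS Htheta.
  exact: C1gM Hz (C1gM Ht (HX i)).
- by move=> x /outK[h|[h _]]; rewrite /F; [rewrite theta0 // mul0r mulr0|rewrite h mul0r].
- move=> l x /outK[h|[h h']]; rewrite /dF; last by rewrite h h' !mul0r addr0.
  by rewrite theta0 // dtheta0 // !mul0r addr0 !mulr0 addr0.
Qed.

Let int_dF m i : \int[@lebesgue_rV R n]_(x in D) dF m i i x = 0.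
Proof.
apply: (@int_partial0 R n D (Kset m) i (F m i)) => //.
- by move=> x /K_sub[].
- by move=> x; have [_ /(_ i)[]] := C1F m i (x := x) I.
- by move=> x; have [_ /(_ i)[]] := C1F m i (x := x) I.
- by move=> x /outK[h|[h _]]; rewrite /F; [rewrite theta0 // mul0r mulr0|rewrite h mul0r].
- exists (r + `|y0|) => x _ h; rewrite /F theta0 ?mul0r ?mulr0 //.
  rewrite -(ltrD2r `|y0|); apply: lt_le_trans h _.
  by rewrite -{1}[x](subrK y0); exact: ler_normD.
Qed.

Let idF m i : ibl D (dF m i i).
Proof.
have cF : continuous (dF m i i) by move=> x; have [_ /(_ i)[]] := C1F m i (x := x) I.
split; first exact: lcb_continuous.
exists (r + `|y0|) => x _ h; apply: (is_derive_locally0 _ (proj1 (proj2 (C1F m i (x := x) I) i))).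
have rx : r < `|x - y0|.
  rewrite -(ltrD2r `|y0|); apply: lt_le_trans h _.
  by rewrite -{1}[x](subrK y0); exact: ler_normD.
have : nbhs x [set x : 'rV[R]_n | r < `|x - y0|] by apply: open_nbhs_nbhs; split=> //; exact: open_outside.
by apply: filterS => y /= hy; rewrite /F theta0 // mul0r mulr0.
Qed.

Let ineq m : \int[@lebesgue_rV R n]_(x in D) (zeta m x * G x) <=
  \int[@lebesgue_rV R n]_(x in D) (C * sT m x).
Proof.
have iS : ibl D (fun x => \sum_i dF m i i x) by apply: ibl_sum => i _; exact: idF.
have E : \int[@lebesgue_rV R n]_(x in D) (\sum_i dF m i i x) = 0.
  by rewrite int_rV_sum // big1.
rewrite -[leLHS]subr0 -E -int_rVB //; apply: le_int_rV => //.
- exact: iblB.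
- exact: iblZ.
move=> x Dx; have -> : zeta m x * G x - \sum_i dF m i i x = m.+1%:R * zeta' m x * theta x * k x.
  rewrite /G /k !mulr_sumr -sumrB; apply: eq_bigr => i _; rewrite /dF; ring.
have [h|h] := leP `|x - y0| r; last by rewrite /sT theta0 // !(mul0r, mulr0).
have := Xphi Dx h; rewrite -/(k x) => hk.
rewrite (_ : C * sT m x = m.+1%:R * zeta' m x * theta x * (C * `|phi x|)); last by rewrite /sT; ring.
apply: ler_wpM2l => //; do 2 apply: mulr_ge0 => //.
by have [] := sstep_cases (- m.+1%:R * phi x).
Qed.

Let large x : D x -> U x -> \forall m \near \oo, 2 <= - m.+1%:R * phi x.
Proof.
move=> Dx Ux; have px : 0 < - phi x by rewrite oppr_gt0; apply/(DU Ux).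
near=> m; rewrite mulNr -mulrN -ler_pdivrMr //.
apply: (@le_trans _ _ m%:R); last by rewrite ler_nat.
by near: m; exact: nbhs_infty_ger.
Unshelve. all: by end_near. Qed.

(** The divergence theorem as an inequality. The field [zeta m * theta * X] vanishes near the
    frontier, so its divergence has integral [0]: the integral of [zeta m * G] is that of
    [(m + 1) zeta' theta X . grad phi], hence at most that of [C * sT m]. The functions [sT m] are
    dominated and tend to [0] at each point of [D], because the transition layer of [zeta m] shrinks
    to the frontier. *)
Lemma flux_le0 : \int[@lebesgue_rV R n]_(x in D)
  (\sum_i (dtheta i x * X i x + theta x * dX i i x)) <= 0.
Proof.
have h1 : (fun m => \int[@lebesgue_rV R n]_(x in D) (zeta m x * G x)) @ \oo -->
    \int[@lebesgue_rV R n]_(x in D) G x.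
  apply: (@dominated_cvg_rV R n D _ G (fun x => `|G x|)) => //; first exact: ibl_abs.
    move=> m x Dx; rewrite normrM; have [/andP[z0 z1] _ _] := sstep_cases (- m.+1%:R * phi x).
    by rewrite /zeta (ger0_norm z0) ler_piMl.
  move=> x Dx; have [h|h] := leP `|x - y0| r; last first.
    by rewrite G0 //; under eq_fun do rewrite mulr0; exact: cvg_cst.
  apply: cvg_near_cst; apply: filterS (large Dx (ballU h)) => m hm.
  by rewrite /zeta; have [-> _] := sstep1 hm; rewrite mul1r.
have [B hB] := theta_bound.
have h2 : (fun m => \int[@lebesgue_rV R n]_(x in D) (C * sT m x)) @ \oo -->
    \int[@lebesgue_rV R n]_(x in D) (cst 0 x : R).
  apply: (@dominated_cvg_rV R n D _ _ (fun x => `|C| * (4 * theta x))) => //.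
  - by move=> m; exact: iblZ.
  - by split; [exact: lcb_cst|exists 0].
  - apply: iblZ; apply: iblZ; apply: (@ibl_glue R n D U _ y0 r B) => //.
      by move=> x Dx Ux; have [] := cont_DU Dx Ux.
    by move=> x Dx; exact: hB.
  - move=> m x Dx; rewrite normrM; apply: ler_wpM2l => //.
    have [h|h] := leP `|x - y0| r; last by rewrite /sT theta0 // mul0r normr0 mulr0.
    rewrite /sT normrM (ger0_norm (theta_ge0 x)) mulrC; apply: ler_wpM2r => //.
    by apply: sT_bound => //; exact: ballU.
  - move=> x Dx; have [h|h] := leP `|x - y0| r; last first.
      by rewrite /sT theta0 //; under eq_fun do rewrite mul0r mulr0; exact: cvg_cst.
    apply: cvg_near_cst; apply: filterS (large Dx (ballU h)) => m hm.
    by rewrite /sT /zeta'; have [_ ->] := sstep1 hm; rewrite !mulr0.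
have E0 : \int[@lebesgue_rV R n]_(x in D) (cst 0 x : R) = 0 by apply: int_rV0.
rewrite E0 in h2.
by apply: (ler_cvg_to h1 h2); exact: nearW.
Qed.

End flux.
End local_boundary.

(** * Test functions and volume growth *)

Section hypotheses.
Context {R : realType} {n : nat}.
Local Notation V := 'rV[R]_n.+1.
Local Notation mu := (@lebesgue_rV R n.+1).
Implicit Types (U D : set V) (g u phi : V -> R).

Lemma Ck_on_C1g k U g : Ck_on k.+1 U g -> C1g U g (fun i => partial i g).
Proof.
move=> h x Ux; have [h0 hd] := h [::] (leq0n _); split; first exact: h0.
move=> i; split; first by apply: DeriveDef => //; exact: (hd isT i x Ux).
by have [h1 _] := h [:: i] isT; exact: h1.
Qed.

Lemma Ck_on_partial k U g i : Ck_on k.+1 U g -> Ck_on k U (partial i g).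
Proof.
move=> h s hs; have := h (rcons s i); rewrite size_rcons => /(_ hs) [h1 h2].
have E : partials (rcons s i) g = partials s (partial i g) by rewrite /partials foldr_rcons.
by split=> [|hk j]; [rewrite -E|rewrite -E; exact: h2].
Qed.

Lemma Ck_closure_ext k D g s : open D -> Ck_closure k D g -> (size s <= k)%N -> ext D (partials s g).
Proof.
move=> oD [_ _ h3] hs x cx; have [h ch hE] := h3 s hs; exists (h x).
exact: (ext_within ch hE cx).
Qed.

Lemma open_pos_measure D (x : V) : open D -> D x -> (0 < mu D)%E.
Proof.
move=> oD Dx; have [d d0 dD] := open_eps oD Dx.
pose A i : set (measurableTypeR R) := @ball R R (x ord0 i) d.
have mA i : measurable (A i) by exact: measurable_ball.
apply: (@lt_le_trans _ _ (mu [set y : V | forall i, A i (y ord0 i)])).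
  have /= -> := lebesgue_rV_box mA; rewrite (eq_bigr (fun=> (d *+ 2)%:E)); last first.
    by move=> i _; rewrite /A lebesgue_measure_ball // ltW.
  rewrite -(big_morph EFin EFinM erefl) lte_fin prodr_gt0 // => i _.
  by rewrite pmulrn_lgt0.
apply: le_measure; rewrite ?inE; [exact: measurable_box_rV|exact: open_measurable_rV|].
move=> y hy; apply: dD.
have : ball x d y by split=> // i j; rewrite ord1; exact: hy.
by rewrite -ball_normE /ball_ /= distrC.
Qed.

Lemma sqr_enorm (x : V) : enorm x ^+ 2 = \sum_i x ord0 i ^+ 2.
Proof.
rewrite /enorm sqr_sqrtr; first by apply: eq_bigr => i _; rewrite expr2.
by apply: sumr_ge0 => i _; rewrite -expr2 sqr_ge0.
Qed.

Lemma enorm_ge0 (x : V) : 0 <= enorm x. Proof. exact: sqrtr_ge0. Qed.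

Lemma int_rV_EFin D g : open D -> ibl D g ->
  (\int[mu]_(x in D) g x)%:E = (\int[mu]_(x in D) (g x)%:E)%E.
Proof.
move=> oD ig; rewrite /Rintegral.
exact: (fineK (integrable_fin_num (open_measurable_rV oD) (ibl_integrable oD ig))).
Qed.

Lemma integral_le_measure (D B : set V) (m K : R) (F : V -> R) : open D ->
  measurable B -> (mu (D `&` B) <= m%:E)%E -> 0 <= K ->
  ibl D F -> (forall x, D x -> 0 <= F x <= K) -> (forall x, D x -> ~ B x -> F x = 0) ->
  \int[mu]_(x in D) F x <= K * m.
Proof.
move=> oD mB hm K0 iF FK Fr; have mD := open_measurable_rV oD.
rewrite -lee_fin (int_rV_EFin oD iF).
apply: (@le_trans _ _ (\int[mu]_(x in D `&` B) (cst K%:E x))%E).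
  rewrite integral_mkcondr; apply: ge0_le_integral => //.
  - by move=> x Dx; rewrite lee_fin; have /andP[] := FK x Dx.
  - by apply: measurable_int (ibl_integrable oD iF).
  - by apply/measurable_restrict => //; apply: measurable_cst.
  - move=> x Dx; rewrite patchE; case: ifPn; first by rewrite lee_fin; have /andP[] := FK x Dx.
    by rewrite notin_setE => h; rewrite Fr.
rewrite integral_cst; last exact: measurableI.
by rewrite EFinM; apply: lee_wpmul2l.
Qed.

Lemma enorm_continuous : continuous (fun x : V => enorm x).
Proof.
move=> x; have c : {for x, continuous (fun x : V => dotv x x)}.
  apply: (@continuous_sum_fin R V) => i _.
  by apply: continuousM; exact: coord_continuous.
exact: (continuous_comp c (@sqrt_continuous R _)).
Qed.

Lemma measurable_eball (r : R) : measurable [set x : V | enorm x <= r].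
Proof.
rewrite -[X in measurable X]setCK; apply: measurableC; apply: open_measurable_rV.
rewrite (_ : ~` _ = (fun x : V => enorm x) @^-1` [set t | r < t]).
  by apply: open_comp => [x _|]; [exact: enorm_continuous|exact: open_gt].
by apply/seteqP; split=> x /=; rewrite ltNge => /negP.
Qed.

(** The derivatives are continuous, so a violation at one point spreads to an open set, which has
    positive measure. *)
Lemma gradient_bound D u (u1 : 'I_n.+1 -> V -> R) (M : R) : open D -> C1g D u u1 ->
  (\forall x \ae mu, D x -> enorm (grad u x) <= M) ->
  forall x, D x -> \sum_i u1 i x ^+ 2 <= M ^+ 2.
Proof.
move=> oD Hu [N [mN N0 hN]] x Dx; rewrite leNgt; apply/negP => hx.
pose W := [set y | M ^+ 2 < \sum_i u1 i y ^+ 2] `&` D.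
have oW : open W.
  rewrite openE => y [hy Dy]; rewrite /interior.
  have c : {for y, continuous (fun y => \sum_i u1 i y ^+ 2)}.
    apply: (@continuous_sum_fin R V) => i _; have [_ /(_ i)[_ ci]] := Hu y Dy.
    exact: (continuous_comp ci (@exprn_continuous R 2 _)).
  apply: filterI; last exact: open_nbhs_nbhs.
  have e0 : 0 < \sum_i u1 i y ^+ 2 - M ^+ 2 by rewrite subr_gt0.
  have [d d0 hd] := continuous_eps c e0; apply: (eps_nbhs d0) => z /hd.
  by rewrite ltr_norml => /andP[h _] /=; lra.
have WN : W `<=` N.
  move=> y [hy Dy]; apply: hN => /= /(_ Dy) h; move: hy; rewrite /= ltNge => /negP; apply.
  have M0 : 0 <= M by apply: le_trans h; exact: enorm_ge0.
  rewrite (_ : \sum_i _ = enorm (grad u y) ^+ 2); first by rewrite ler_pXn2r // nnegrE enorm_ge0.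
  by rewrite sqr_enorm; apply: eq_bigr => i _; rewrite mxE /partial (C1g_partial i Hu Dy).
have : (mu W <= mu N)%E by apply: le_measure; rewrite ?inE //; exact: open_measurable_rV.
rewrite N0 leNgt => /negP; apply.
by apply: (open_pos_measure (x := x)) oW _.
Qed.

(** The limit superior controls large radii only; a radius between [1] and [r0] is compared with the
    fixed radius [K], at the cost of the factor [K ^ 2]. *)
Lemma quadratic_growth_bound D : open D -> quadratic_growth D ->
  exists2 C : R, 0 <= C & forall r : R, 1 <= r ->
    (mu (D `&` [set x : V | (enorm x <= r)%R]) <= (C * r ^+ 2)%:E)%E.
Proof.
move=> oD; rewrite /quadratic_growth /limf_esup => /ereal_inf_lt[_ [A [r0 [_ hA]] <-] hlt].
have mE r : measurable (D `&` [set x : V | (enorm x <= r)%R]).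
  apply: measurableI; first exact: open_measurable_rV.
  exact: measurable_eball.
pose m r := mu (D `&` [set x : V | (enorm x <= r)%R]).
have mono r s : r <= s -> (m r <= m s)%E.
  move=> rs; apply: le_measure; rewrite ?inE //.
  by move=> x [Dx /= h]; split=> //=; exact: le_trans rs.
have [B B0 hB] : exists2 B : R, 0 <= B & forall r, r0 < r -> (m r * (r ^- 2)%:E <= B%:E)%E.
  move: hlt; set S := ereal_sup _ => hlt.
  have hS r : r0 < r -> (m r * (r ^- 2)%:E <= S)%E.
    by move=> rr; apply: ereal_sup_ubound; exists r => //; exact: hA.
  case: S hlt hS => [s| |] // _ hS.
    exists (Num.max 0 s); first by rewrite le_max lexx.
    by move=> r rr; apply: le_trans (hS r rr) _; rewrite lee_fin le_max lexx orbT.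
  by exists 0 => // r rr; apply: le_trans (hS r rr) _; rewrite leNye.
pose K : R := Num.max 1 (r0 + 1).
have K1 : 1 <= K by rewrite le_max lexx.
have Kr : r0 < K by rewrite lt_max ltrDl ltr01 orbT.
have hm r : r0 < r -> 1 <= r -> (m r <= (B * r ^+ 2)%:E)%E.
  move=> rr r1; have r2 : 0 < r ^+ 2 by rewrite exprn_gt0 //; lra.
  have := hB r rr; rewrite -[X in (_ -> X <= _)%E]mule1.
  rewrite [1%E](_ : _ = (r ^- 2)%:E * (r ^+ 2)%:E)%E; last by rewrite -EFinM mulVf ?gt_eqF.
  by move=> h; rewrite muleA [leRHS]EFinM; apply: lee_wpmul2r h; rewrite lee_fin ltW.
exists (B * K ^+ 2) => [|r r1]; first by rewrite mulr_ge0 // sqr_ge0.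
have KK : 1 <= K ^+ 2 by rewrite exprn_ege1.
have rr2 : 1 <= r ^+ 2 by rewrite exprn_ege1.
have [h|h] := ltP r0 r.
  apply: le_trans (hm r h r1) _; rewrite lee_fin -mulrA; apply: ler_wpM2l => //.
  by rewrite ler_peMl //; lra.
apply: (@le_trans _ _ (m K)); first by apply: mono; rewrite (le_trans h) // ltW.
apply: le_trans (hm K Kr K1) _; rewrite lee_fin ler_peMr // mulr_ge0 //; lra.
Qed.

Lemma bsupp_partial D g dg i : open D -> C1g D g dg -> bsupp D g -> bsupp D (dg i).
Proof.
move=> oD Hg [r hr]; exists r => x Dx rx; have [_ /(_ i)[h _]] := Hg x Dx.
apply: (is_derive_locally0 _ h).
have : nbhs x (D `&` [set y : V | r < `|y - 0|]).
  by apply: filterI; apply: open_nbhs_nbhs; split => //=; rewrite ?subr0 //; exact: open_outside.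
by apply: filterS => y [Dy /=]; rewrite subr0; exact: hr.
Qed.

(** The counterpart of [C1_0_closure] that only looks inside [D]: frontier values enter through
    limits, and no vanishing on the frontier is asked. *)
Definition adm D g (dg : 'I_n.+1 -> V -> R) :=
  [/\ C1g D g dg, ext D g, (forall i, ext D (dg i)) & bsupp D g].

Lemma adm_ibl D g dg : open D -> adm D g dg -> ibl D g /\ forall i, ibl D (dg i).
Proof.
move=> oD [Hg eg edg sg]; split=> [|i]; split=> //.
- by apply: ext_lcb => // x Dx; have [] := Hg x Dx.
- by apply: ext_lcb => // x Dx; have [_ /(_ i)[]] := Hg x Dx.
- exact: bsupp_partial Hg sg.
Qed.

(** [g] may take arbitrary values on the frontier; the representative [psi] takes the limits there
    instead, which also confines its support to the ball of radius [|r|]. *)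
Lemma adm_C1_0_closure D g dg : open D -> adm D g dg ->
  exists psi, C1_0_closure D psi /\ forall x, D x -> psi x = g x /\ forall i, partial i psi x = dg i x.
Proof.
move=> oD [Hg eg edg [r hr]].
have lim_ext h : ext D h -> exists H : V -> R, forall x, closure D x -> limin D h x (H x).
  move=> eh; have /choice[H HP] : forall x, exists l, closure D x -> limin D h x l.
    move=> x; have [cx|cx] := pselect (closure D x); last by exists 0.
    by have [l hl] := eh x cx; exists l.
  by exists H.
have lim_in h H x : (forall x, closure D x -> limin D h x (H x)) -> {for x, continuous h} -> D x -> H x = h x.
  move=> hH ch Dx; have cx : closure D x by exact: subset_closure.
  by apply: (limin_uniq cx (hH x cx)); exact: limin_cont.
have [psi psiP] := lim_ext g eg.
have /choice[dpsi dpsiP] : forall i, exists H : V -> R, forall x, closure D x -> limin D (dg i) x (H x).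
  by move=> i; exact: lim_ext.
have psiE x : D x -> psi x = g x by move=> Dx; apply: (lim_in g) => //; have [] := Hg x Dx.
have dpsiE i x : D x -> dpsi i x = dg i x.
  move=> Dx; have [_ /(_ i)[_ ci]] := Hg x Dx.
  exact: (lim_in (dg i) (dpsi i) x (dpsiP i) ci Dx).
have Hpsi : C1g D psi dg by apply: C1g_eq Hg oD _ => x /psiE.
have pE i x : D x -> partial i psi x = dg i x by move=> Dx; exact: C1g_partial Hpsi Dx.
exists psi; split; last by move=> x Dx; split; [exact: psiE|move=> i; exact: pE].
split.
  split.
  - case=> [|i [|j s]] // _.
      split=> [x Dx|_ i x Dx]; first by have [] := Hpsi x Dx.
      by have [_ /(_ i)[[]]] := Hpsi x Dx.
    split=> // x Dx; apply: (@near_eq_continuous R V D (dg i) _ x oD Dx).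
      by move=> y Dy; rewrite /= pE.
    by have [_ /(_ i)[]] := Hpsi x Dx.
  - exact: within_extension psiP.
  - case=> [|i [|j s]] // _.
      by exists psi => //; exact: within_extension psiP.
    exists (dpsi i); first by apply: within_extension (dpsiP i).
    by move=> x Dx; rewrite dpsiE // /= pE.
apply: bounded_closed_compact; last exact: closed_closure.
exists `|r|; split; first exact: num_real.
move=> M rM x /= hx; apply: le_trans (ltW rM).
have : [set x : V | closure D x /\ psi x != 0] `<=` [set x : V | `|x| <= `|r|].
  move=> y [cy py]; rewrite /= leNgt; apply/negP => ry; move/negP: py; apply.
  apply/eqP; apply: (limin_uniq cy (psiP y cy)); apply: eps_limin => e e0.
  exists (`|y| - `|r|); first by rewrite subr_gt0.
  move=> z Dz zy; rewrite hr ?subrr ?normr0 //.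
  apply: le_lt_trans (ler_norm r) _.
  have : `|y| <= `|z - y| + `|z|.
    by rewrite -{1}[y](subrK z) distrC; exact: ler_normD.
  lra.
move/closure_subset => /(_ _ hx); suff: closed [set x : V | `|x| <= `|r|] by move/closure_id => <-.
rewrite (_ : [set x : V | _] = (fun x : V => `|x|) @^-1` [set t | t <= `|r|])//.
by apply: closed_comp => [z _|]; [exact: norm_continuous|exact: closed_le].
Qed.

(** [lambda1] tests only functions of unit L2 norm, so [g] is divided by its norm; a zero norm
    forces [g = 0] on [D] by continuity. *)
Lemma stable_energy (f : R -> R) D u g dg : open D -> stable f D u ->
  lcb D (fun x => derive1 f (u x)) -> adm D g dg ->
  0 <= \int[mu]_(x in D) (\sum_i dg i x ^+ 2 - derive1 f (u x) * g x ^+ 2).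
Proof.
move=> oD st lc ag; have mD := open_measurable_rV oD.
pose I h (dh : 'I_n.+1 -> V -> R) := \int[mu]_(x in D) (\sum_i dh i x ^+ 2 - derive1 f (u x) * h x ^+ 2).
have iI h dh : adm D h dh -> ibl D (fun x => \sum_i dh i x ^+ 2 - derive1 f (u x) * h x ^+ 2).
  move=> ah; have [ih idh] := adm_ibl oD ah; apply: iblB.
    apply: ibl_sum => i _; have := idh i; rewrite (_ : (fun x => _) = (fun x => dh i x * dh i x)).
      by move=> [? ?]; apply: iblMl.
    by apply/funext => x; rewrite expr2.
  apply: iblMr => //; rewrite (_ : (fun x => _) = (fun x => h x * h x)).
    by case: ih => ? ?; apply: iblMl.
  by apply/funext => x; rewrite expr2.
have sq h dh : adm D h dh -> ibl D (fun x => h x ^+ 2).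
  move=> ah; have [[? ?] _] := adm_ibl oD ah; rewrite (_ : (fun x => _) = (fun x => h x * h x)).
    by apply: iblMl.
  by apply/funext => x; rewrite expr2.
have unit h dh : adm D h dh -> \int[mu]_(x in D) (h x ^+ 2) = 1 -> 0 <= I h dh.
  move=> ah h1; have [psi [psiC psiE]] := adm_C1_0_closure oD ah.
  have : (0 <= energy f D u psi)%E.
    apply: le_trans st _; apply: ereal_inf_lbound; exists psi => //; split=> //.
    rewrite /L2norm unlock (_ : (\int[_]_x _)%E = 1%E) ?poweR1r //.
    rewrite (_ : (\int[_]_x _)%E = \int[mu]_(x in D) (h x ^+ 2)%:E)%E.
      by rewrite -(int_rV_EFin oD (sq _ _ ah)) h1.
    rewrite [RHS]integral_mkcond; apply: eq_integral => x _.
    rewrite patchE indicE; case: ifPn => xD; last by rewrite mulr0 /= normr0 powR0.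
    rewrite mulr1 /= powR_mulrn // real_normK ?num_real //.
    by move: xD; rewrite inE => /psiE[->].
  rewrite /energy (_ : (\int[_]_(x in _) _)%E = (I h dh)%:E) ?lee_fin //.
  rewrite /I (int_rV_EFin oD (iI _ _ ah)).
  apply: eq_integral => x; rewrite inE => /psiE[E1 E2]; congr EFin.
  by rewrite E1 sqr_enorm; congr (_ - _); apply: eq_bigr => i _; rewrite mxE E2.
have [Z|NZ] := eqVneq (\int[mu]_(x in D) (g x ^+ 2)) 0.
  have g0 x : D x -> g x = 0.
    move=> Dx; apply/eqP; rewrite -sqrf_eq0; apply/eqP.
    apply: (ge0_int_rV_eq0 oD (sq _ _ ag)) => // [y _|]; first exact: sqr_ge0.
    by rewrite Z.
  rewrite int_rV0 // => x Dx; rewrite g0 // expr0n /= mulr0 subr0 big1 // => i _.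
  have [Hg _ _ _] := ag; have [_ /(_ i)[h _]] := Hg x Dx.
  rewrite (is_derive_locally0 _ h) ?expr0n //.
  have : nbhs x D by exact: open_nbhs_nbhs.
  by apply: filterS => y; exact: g0.
have P : 0 < \int[mu]_(x in D) (g x ^+ 2).
  by rewrite lt_neqAle eq_sym NZ; apply: int_rV_ge0 => x _; exact: sqr_ge0.
set N := \int[mu]_(x in D) (g x ^+ 2) in NZ P.
pose c : R := (Num.sqrt N)^-1.
have c2 : c ^+ 2 = N^-1 by rewrite exprVn sqr_sqrtr // ltW.
have ac : adm D (fun x => c * g x) (fun i x => c * dg i x).
  have [Hg eg edg sg] := ag; split; [exact: C1gZ|exact: extZ|by move=> i; exact: extZ|exact: bsuppMr].
have := unit _ _ ac.
rewrite (_ : \int[mu]_(x in D) _ = c ^+ 2 * N); last first.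
  by rewrite -int_rVZ ?(sq _ _ ag) //; [apply: eq_int_rV => x _; rewrite exprMn|exact: (sq _ _ ag)].
rewrite c2 mulVf // => /(_ erefl).
rewrite (_ : I _ _ = c ^+ 2 * I g dg); last first.
  rewrite /I -int_rVZ //; last exact: iI.
  apply: eq_int_rV => x _; rewrite mulrBr mulr_sumr; congr (_ - _); last by rewrite exprMn; ring.
  by apply: eq_bigr => i _; rewrite exprMn.
by rewrite c2 pmulr_rge0 // invr_gt0.
Qed.

End hypotheses.

(** * The solution near a boundary point *)

Section bounded_near.
Context {R : realType} {n : nat}.
Local Notation V := 'rV[R]_n.
Implicit Types (D : set V) (y : V) (r : R) (g h : V -> R).

Definition bnear D y r g := exists M, forall x, D x -> `|x - y| <= r -> `|g x| <= M.

Lemma bnearD D y r g h : bnear D y r g -> bnear D y r h -> bnear D y r (fun x => g x + h x).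
Proof.
move=> [M gM] [K hK]; exists (M + K) => x Dx xr; apply: le_trans (ler_normD _ _) _.
by apply: lerD; [exact: gM|exact: hK].
Qed.

Lemma bnearM D y r g h : bnear D y r g -> bnear D y r h -> bnear D y r (fun x => g x * h x).
Proof.
move=> [M gM] [K hK]; exists (M * K) => x Dx xr; rewrite normrM.
by apply: ler_pM => //; [exact: gM|exact: hK].
Qed.

Lemma bnear_sum D y r (I : Type) (s : seq I) (P : pred I) (g : I -> V -> R) :
  (forall i, P i -> bnear D y r (g i)) -> bnear D y r (fun x => \sum_(i <- s | P i) g i x).
Proof.
move=> h; elim: s => [|i s [M IH]]; first by exists 0 => x _ _; rewrite big_nil normr0.
have [Pi|Pi] := boolP (P i); last by exists M => x Dx xr; rewrite big_cons (negbTE Pi) IH.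
have [K hK] := h i Pi; exists (K + M) => x Dx xr; rewrite big_cons Pi.
by apply: le_trans (ler_normD _ _) _; apply: lerD; [exact: hK|exact: IH].
Qed.

Lemma bnear_fin D y r (I : finType) (g : I -> V -> R) : (forall i, bnear D y r (g i)) ->
  exists M, forall i x, D x -> `|x - y| <= r -> `|g i x| <= M.
Proof.
move=> /choice[B hB]; exists (\sum_i `|B i|) => i x Dx xr.
apply: le_trans (hB i x Dx xr) _; apply: le_trans (ler_norm _) _.
by rewrite (bigD1 i) //= lerDl sumr_ge0.
Qed.

Lemma lcb_bnear D y r g : lcb D g -> bnear D y r g.
Proof.
move=> [_ /(_ (r + `|y|)) [M hM]]; exists M => x Dx xr; apply: hM => //.
by rewrite -[x](subrK y); apply: le_trans (ler_normD _ _) _; rewrite lerD2r.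
Qed.

Lemma continuous_bnear (U D : set V) y r g :
  (forall x, U x -> {for x, continuous g}) -> (forall x, `|x - y| <= r -> U x) -> bnear D y r g.
Proof. by move=> cg yU; have [M hM] := lcb_closed_ball cg yU; exists M => x _; exact: hM. Qed.

Lemma exists_fin_min (I : finType) (r : R) (del : I -> R) : 0 < r -> (forall i, 0 < del i) ->
  exists t0 : R, [/\ 0 < t0, t0 <= r & forall i, t0 <= del i].
Proof.
move=> r0 d0; have : forall s : seq I, exists t0 : R, [/\ 0 < t0, t0 <= r & forall i, i \in s -> t0 <= del i].
  elim=> [|i s [t [tp tr ht]]]; first by exists r.
  exists (Num.min t (del i)); split; first by rewrite lt_min tp d0.
    by rewrite ge_min tr.
  by move=> j; rewrite inE => /orP[/eqP ->|/ht h]; rewrite ge_min ?lexx ?orbT // h.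
move=> /(_ (enum I)) [t [tp tr ht]]; exists t; split=> // i.
by apply: ht; rewrite mem_enum.
Qed.

(** First-order expansion at a point [y] where [g] and its derivatives have only limits: the mean
    value theorem is applied between [s d + y] and [t d + y], both inside [D], with [s] as small as
    desired. *)
Lemma endpoint_expansion D g dg y (d : V) (l t0 : R) (L : 'I_n -> R) : open D -> C1g D g dg ->
  0 < t0 -> (forall t : R, 0 < t < t0 -> D (t *: d + y)) ->
  limin D g y l -> (forall j, limin D (dg j) y (L j)) ->
  forall e : R, 0 < e -> exists2 del : R, 0 < del &
    forall t : R, 0 < t < del -> `|g (t *: d + y) - l - t * \sum_j d ord0 j * L j| <= e * t.
Proof.
move=> oD Hg t00 inD gl dgL e e0.
pose A := \sum_j d ord0 j * L j.
have LA : limin D (fun x => \sum_j d ord0 j * dg j x) y A.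
  apply: limin_sum => j _; apply: liminM; first exact: limin_cst.
  exact: dgL.
have [d1 d10 h1] := limin_eps LA e0.
pose c : R := `|d| + 1.
have c0 : 0 < c by rewrite /c ltr_wpDl.
have close t e' : 0 < t -> 0 < e' -> t < e' / c -> `|t *: d + y - y| < e'.
  move=> tp e'0 te; rewrite addrK normrZ (gtr0_norm tp); apply: (@le_lt_trans _ _ (t * c)).
    by apply: ler_wpM2l; [exact: ltW|rewrite /c lerDl].
  by rewrite -ltr_pdivlMr.
exists (Num.min t0 (d1 / c)); first by rewrite lt_min t00 divr_gt0.
move=> t /andP[tp]; rewrite lt_min => /andP[tt0 td1].
apply/ler_addgt0Pr => eta eta0.
have eta2 : 0 < eta / 2 by rewrite divr_gt0.
have [d2 d20 h2] := limin_eps gl eta2.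
(* Small enough for [|g (s d + y) - l|] and [s |A|] to be at most [eta / 2] each. *)
pose s : R := Num.min (t / 2) (Num.min (d2 / c / 2) (eta / 2 / (`|A| + 1))).
have A1 : 0 < `|A| + 1 by rewrite ltr_wpDl.
have s0 : 0 < s by rewrite !lt_min !divr_gt0.
have st : s <= t / 2 by rewrite ge_min lexx.
have sd2 : s < d2 / c.
  have p : 0 < d2 / c by rewrite divr_gt0.
  have : s <= d2 / c / 2 by rewrite !ge_min lexx orbT.
  lra.
have sA : s * `|A| <= eta / 2.
  apply: (@le_trans _ _ (s * (`|A| + 1))); first by apply: ler_wpM2l; [exact: ltW|rewrite lerDl].
  by rewrite -ler_pdivlMr // !ge_min lexx !orbT.
have Ds : D (s *: d + y) by apply: inD; rewrite s0 /=; lra.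
have gs := h2 _ Ds (close s d2 s0 d20 sd2).
have [k k01 E] := @C1g_MVT R n D g dg (s *: d + y) ((t - s) *: d) oD Hg (ltac:(
  move=> k /andP[k0 k1]; rewrite scalerA addrA -scalerDl; apply: inD; apply/andP; split; nra)).
rewrite scalerA !addrA -!scalerDl subrK in E.
set kk := k * (t - s) + s in E.
have kk0 : 0 < kk by case/andP: k01 => ? ?; rewrite /kk; nra.
have kkt : kk <= t by case/andP: k01 => ? ?; rewrite /kk; nra.
have Dk : D (kk *: d + y) by apply: inD; apply/andP; split=> //; lra.
have Ak := h1 _ Dk (close kk d1 kk0 d10 (le_lt_trans kkt td1)).
have E2 : \sum_i ((t - s) *: d) ord0 i * dg i (kk *: d + y) = (t - s) * \sum_i d ord0 i * dg i (kk *: d + y).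
  by rewrite mulr_sumr; apply: eq_bigr => i _; rewrite !mxE mulrA.
rewrite E2 in E; set B := \sum_i d ord0 i * _ in E Ak.
have -> : g (t *: d + y) - l - t * A = (t - s) * (B - A) + (g (s *: d + y) - l) - s * A.
  by rewrite mulrBr -E; ring.
apply: (@le_trans _ _ ((e * t + eta / 2) + eta / 2)); last by rewrite -addrA -splitr.
apply: le_trans (ler_normB _ _) _; apply: lerD.
  apply: le_trans (ler_normD _ _) _; apply: lerD; last exact: ltW.
  rewrite normrM ger0_norm; last by lra.
  by rewrite mulrC; apply: ler_pM => //; [lra|exact: ltW|lra].
by rewrite normrM (gtr0_norm s0).
Qed.

End bounded_near.

(** * Boundary charts and the differentiated equation *)

Section problem.
Context {R : realType} {n : nat}.
Local Notation V := 'rV[R]_n.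
Local Notation mu := (@lebesgue_rV R n).

(** The last clause is the Neumann condition, stated for the limits [tau] of the gradient at any
    frontier point [z] of [U], so that a chart at [y] also serves the frontier points near [y]. *)
Definition chart (D : set V) (u1 : 'I_n -> V -> R) (y : V) (U : set V) (phi : V -> R)
    (dphi : 'I_n -> V -> R) (d2phi : 'I_n -> 'I_n -> V -> R) :=
  [/\ open U /\ U y, C1g U phi dphi /\ (forall i, C1g U (dphi i) (d2phi i)),
    exists j, dphi j y != 0, forall z, U z -> (D z <-> phi z < 0) &
    forall z (tau : 'I_n -> R), U z -> phi z = 0 -> closure D z -> (exists j, dphi j z != 0) ->
      (forall i, limin D (u1 i) z (tau i)) -> \sum_i tau i * dphi i z = 0].

Record setup (D : set V) (f f' : R -> R) (u : V -> R) (u1 : 'I_n -> V -> R)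
    (u2 : 'I_n -> 'I_n -> V -> R) (u3 : 'I_n -> 'I_n -> 'I_n -> V -> R) : Prop := Setup {
  s_open : open D;
  s_convex : forall x y (t : R), D x -> D y -> 0 <= t <= 1 -> D (t *: x + (1 - t) *: y);
  s_connected : connected D;
  s_f : forall t : R, is_derive t 1 f (f' t);
  s_f' : continuous f';
  s_u : C1g D u u1;
  s_u1 : forall i, C1g D (u1 i) (u2 i);
  s_u2 : forall i j, C1g D (u2 i j) (u3 i j);
  s_eu : ext D u;
  s_eu1 : forall i, ext D (u1 i);
  s_eu2 : forall i j, ext D (u2 i j);
  s_eu3 : forall i j k, ext D (u3 i j k);
  s_pde : forall x, D x -> \sum_i u2 i i x = - f (u x);
  s_chart : forall y, closure D y -> ~ D y -> exists U phi dphi d2phi, chart D u1 y U phi dphi d2phi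
}.

Variables (D : set V) (f f' : R -> R) (u : V -> R) (u1 : 'I_n -> V -> R)
  (u2 : 'I_n -> 'I_n -> V -> R) (u3 : 'I_n -> 'I_n -> 'I_n -> V -> R).
Hypothesis HS : setup D f f' u u1 u2 u3.
Let oD := s_open HS.

Lemma u2_sym i j x : D x -> u2 i j x = u2 j i x.
Proof. by move=> Dx; exact: (schwarz i j oD (s_u HS) (s_u1 HS) Dx). Qed.

Lemma cont_in g dg : C1g D g dg -> forall x, D x -> {for x, continuous g}.
Proof. by move=> h x Dx; have [] := h x Dx. Qed.

(** Differentiate the equation along [k], then move [k] from the last to the first index by the
    symmetry of mixed derivatives. *)
Lemma linearized k x : D x -> \sum_j u3 k j j x = - (f' (u x) * u1 k x).
Proof.
move=> Dx.
have E i j l y : D y -> u3 i j l y = u3 j i l y.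
  move=> Dy; apply: (C1g_uniq l (s_u2 HS i j) _ Dy).
  by apply: C1g_eq (s_u2 HS j i) oD _ => z Dz; exact: u2_sym.
have H1 : C1g D (fun x => - f (u x)) (fun l x => \sum_i u3 i i l x).
  have H0 : C1g D (fun x => \sum_i u2 i i x) (fun l x => \sum_i u3 i i l x).
    exact: (@C1g_sum _ _ D _ _ xpredT (fun i => u2 i i) (fun i => u3 i i) (fun i _ => s_u2 HS i i)).
  exact: (C1g_eq H0 oD (s_pde HS)).
have H2 : C1g D (fun x => - f (u x)) (fun l x => - (f' (u x) * u1 l x)).
  apply: C1gN; apply: (C1g_comp (s_u HS)) => y Dy; split; [exact: s_f HS _|exact: s_f' HS _].
rewrite -(C1g_uniq k H1 H2 Dx); apply: eq_bigr => j _.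
rewrite E //; exact: (schwarz k j oD (s_u1 HS j) (s_u2 HS j) Dx).
Qed.

Definition W j x := \sum_i u1 i x * u2 i j x.
Definition dW j l x := \sum_i (u2 i l x * u2 i j x + u1 i x * u3 i j l x).

Lemma C1_W j : C1g D (W j) (dW j).
Proof. by apply: C1g_sum => i _; exact: C1gM (s_u1 HS i) (s_u2 HS i j). Qed.

Lemma ext_W j : ext D (W j).
Proof. by apply: ext_sum => i _; apply: extM; [exact: s_eu1 HS i|exact: s_eu2 HS i j]. Qed.

Lemma ext_dW j l : ext D (dW j l).
Proof.
apply: ext_sum => i _; apply: extD; apply: extM;
  [exact: s_eu2 HS _ _|exact: s_eu2 HS _ _|exact: s_eu1 HS _|exact: s_eu3 HS _ _ _].
Qed.

Lemma cont_dW j l x : D x -> {for x, continuous (dW j l)}.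
Proof. by move=> Dx; have [_ /(_ l)[]] := C1_W j Dx. Qed.

Lemma lcb_dW j l : lcb D (dW j l).
Proof. by apply: ext_lcb; [move=> x; exact: cont_dW|exact: ext_dW]. Qed.

Lemma lcb_W j : lcb D (W j).
Proof. by apply: ext_lcb; [move=> x; exact: cont_in (C1_W j) x|exact: ext_W]. Qed.

Lemma lcb_u1 j : lcb D (u1 j).
Proof. by apply: ext_lcb; [move=> x; exact: cont_in (s_u1 HS j) x|exact: s_eu1 HS j]. Qed.

(** Bochner's identity, the third derivatives being eliminated by the linearized equation. *)
Lemma div_W x : D x -> \sum_j dW j j x =
  \sum_i \sum_j u2 i j x ^+ 2 - f' (u x) * \sum_i u1 i x ^+ 2.
Proof.
move=> Dx; rewrite /dW exchange_big /= mulr_sumr -sumrB.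
apply: eq_bigr => i _; rewrite big_split /= -mulr_sumr linearized //.
rewrite (eq_bigr (fun j => u2 i j x ^+ 2)); first by ring.
by move=> j _; rewrite expr2.
Qed.

Section at_chart.
Variables (y : V) (U : set V) (phi : V -> R) (dphi : 'I_n -> V -> R) (d2phi : 'I_n -> 'I_n -> V -> R).
Hypothesis cy : closure D y.
Hypothesis Dy : ~ D y.
Hypothesis HC : chart D u1 y U phi dphi d2phi.

Let oU : open U. Proof. by case: HC => -[]. Qed.
Let Uy : U y. Proof. by case: HC => -[]. Qed.
Let Hphi : C1g U phi dphi. Proof. by case: HC => _ []. Qed.
Let Hdphi i : C1g U (dphi i) (d2phi i). Proof. by case: HC => _ []. Qed.
Let DU z : U z -> (D z <-> phi z < 0). Proof. by case: HC => _ _ _ h _; exact: h. Qed.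

Lemma chart_phi0 : phi y = 0.
Proof.
apply/eqP; rewrite eq_le; apply/andP; split; last first.
  by rewrite leNgt; apply/negP => /(DU Uy).
rewrite leNgt; apply/negP => py; have [cphi _] := Hphi Uy.
have [d1 d10 h1] := open_eps oU Uy; have [d2 d20 h2] := continuous_eps cphi py.
have dd : 0 < Num.min d1 d2 by rewrite lt_min d10.
have [z Dz] := closure_eps cy dd; rewrite lt_min => /andP[/h1 Uz /h2].
by have := DU Uz => -[/(_ Dz) pz _]; rewrite ltr_norml => /andP[]; lra.
Qed.

Let limU g dg : C1g U g dg -> limin U g y (g y).
Proof. by move=> h; apply: limin_cont; have [] := h y Uy. Qed.

Let tangent (tau : 'I_n -> R) : (forall i, limin D (u1 i) y (tau i)) -> \sum_i tau i * dphi i y = 0.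
Proof. by case: HC => _ _ hj _ hN ht; apply: hN => //; exact: chart_phi0. Qed.

(** If the Hessian of [phi] were negative on the tangent vector [tau], then [phi] would be negative
    at [y + t tau] and [y - t tau] for small [t > 0]; both points would lie in [D], hence so would
    their midpoint [y] by convexity. *)
Lemma boundary_hessian_ge0 (tau : 'I_n -> R) : \sum_i tau i * dphi i y = 0 ->
  0 <= \sum_i \sum_j tau i * d2phi i j y * tau j.
Proof.
move=> tang; rewrite leNgt; apply/negP => Q0; set Q := \sum_i _ in Q0.
have key (s : R) : `|s| = 1 -> exists2 t0 : R, 0 < t0 & forall t : R, 0 < t < t0 -> D (t *: (s *: \row_i tau i) + y).
  move=> s1; pose d := s *: \row_i tau i : V.
  have s2 : s * s = 1 by rewrite -expr2 -[LHS]real_normK ?num_real // s1 expr1n.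
  have [r r0 hr] := open_eps oU Uy.
  pose c : R := `|d| + 1.
  have c0 : 0 < c by rewrite /c ltr_wpDl.
  have inU t : 0 <= t -> t < r / c -> U (t *: d + y).
    move=> t0 tr; apply: hr; rewrite addrK normrZ (ger0_norm t0).
    apply: (@le_lt_trans _ _ (t * c)); first by apply: ler_wpM2l => //; rewrite /c lerDl.
    by rewrite -ltr_pdivlMr.
  pose m' (t : R) := \sum_i d ord0 i * dphi i (t *: d + y).
  (* Chosen so that the total expansion error of [m'], the derivative of [phi] along [d], is at most
     half of [t |Q|]. *)
  pose e : R := - Q / (2 * (\sum_i `|d ord0 i| + 1)).
  have S1 : 0 < \sum_i `|d ord0 i| + 1 by rewrite ltr_wpDl // sumr_ge0.
  have e0 : 0 < e by rewrite divr_gt0 ?oppr_gt0 // mulr_gt0.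
  have rc : 0 < r / c by rewrite divr_gt0.
  have /choice[del hdel] : forall i, exists del : R, 0 < del /\ forall t : R, 0 < t < del ->
     `|dphi i (t *: d + y) - dphi i y - t * \sum_j d ord0 j * d2phi i j y| <= e * t.
    move=> i; have [del d0 h] := @endpoint_expansion R n U (dphi i) (d2phi i) y d (dphi i y) (r / c)
      (fun j => d2phi i j y) oU (Hdphi i) rc (fun t ht => inU t (ltW (proj1 (andP ht))) (proj2 (andP ht)))
      (limU (Hdphi i)) (fun j => limin_cont U (proj2 (proj2 (Hdphi i Uy) j))) e e0.
    by exists del.
  have [t0 [t00 tr t0del]] := exists_fin_min rc (fun i => proj1 (hdel i)).
  have m'neg t : 0 < t -> t < t0 -> m' t <= t * (Q / 2).
    move=> tp tt0; rewrite /m'.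
    have -> : \sum_i d ord0 i * dphi i (t *: d + y) =
      \sum_i d ord0 i * (dphi i (t *: d + y) - dphi i y - t * \sum_j d ord0 j * d2phi i j y)
      + s * (\sum_i tau i * dphi i y) + t * Q.
      rewrite /Q !mulr_sumr -!big_split /=; apply: eq_bigr => i _.
      rewrite (_ : d ord0 i = s * tau i); last by rewrite !mxE.
      rewrite (_ : \sum_j d ord0 j * d2phi i j y = s * \sum_j d2phi i j y * tau j); last first.
        by rewrite mulr_sumr; apply: eq_bigr => j _; rewrite !mxE; ring.
      rewrite (_ : \sum_j tau i * d2phi i j y * tau j = tau i * \sum_j d2phi i j y * tau j); last first.
        by rewrite mulr_sumr; apply: eq_bigr => j _; ring.
      rewrite !mulrBr (_ : s * tau i * (t * (s * \sum_j _)) = s * s * (t * (tau i * \sum_j d2phi i j y * tau j))); last by ring.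
      by rewrite s2; ring.
    rewrite tang mulr0 addr0.
    suff : \sum_i d ord0 i * (dphi i (t *: d + y) - dphi i y - t * \sum_j d ord0 j * d2phi i j y) <= t * (- Q / 2) by lra.
    apply: (@le_trans _ _ (\sum_i `|d ord0 i| * (e * t))).
      apply: ler_sum => i _; apply: le_trans (ler_norm _) _; rewrite normrM; apply: ler_wpM2l => //.
      have [_ h] := hdel i; apply: h; rewrite tp /=; exact: lt_le_trans tt0 (t0del i).
    rewrite -mulr_suml; apply: (@le_trans _ _ ((\sum_i `|d ord0 i| + 1) * (e * t))).
      by apply: ler_wpM2r; [rewrite mulr_ge0 // ltW|rewrite lerDl].
    rewrite (_ : _ * (e * t) = t * (- Q / 2)) // /e; field.
    by rewrite gt_eqF.
  have step (a b : R) : 0 <= a -> 0 < b -> a + b < t0 ->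
      exists2 k : R, a <= k <= a + b & phi ((a + b) *: d + y) - phi (a *: d + y) = b * m' k.
    move=> a0 b0 ab; have [k /andP[k0 k1] E] := @C1g_MVT R n U phi dphi (a *: d + y) (b *: d) oU Hphi (ltac:(
      move=> k /andP[k0 k1]; rewrite scalerA addrA -scalerDl; apply: inU; nra)).
    exists (k * b + a); first by apply/andP; split; nra.
    move: E; rewrite scalerA !addrA -!scalerDl [b + a]addrC => ->.
    by rewrite /m' mulr_sumr; apply: eq_bigr => i _; rewrite mxE mulrA.
  exists t0 => // t /andP[tp tt0].
  have Ut : U (t *: d + y) by apply: inU; lra.
  apply/(DU Ut).
  (* The mean value point of the first half may be [0], where [m'] vanishes; the strict decrease of
     [phi] comes from the second half. *)
  have [k1 /andP[k10 k1t] E1] := step 0 (t / 2) (lexx 0) (ltac:(lra)) (ltac:(lra)).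
  have [k2 /andP[k20 k2t] E2] := step (t / 2) (t / 2) (ltac:(lra)) (ltac:(lra)) (ltac:(lra)).
  have m1 : m' k1 <= 0.
    have [k1p|k1n] := ltP 0 k1.
      by apply: le_trans (m'neg k1 k1p _) _; [lra|nra].
    have -> : k1 = 0 by apply/eqP; rewrite eq_le k1n.
    rewrite /m' scale0r add0r.
    suff -> : \sum_i d ord0 i * dphi i y = s * \sum_i tau i * dphi i y by rewrite tang mulr0.
    by rewrite mulr_sumr; apply: eq_bigr => i _; rewrite !mxE mulrA.
  have m2 : m' k2 < 0 by apply: le_lt_trans (m'neg k2 _ _) _; [lra|lra|nra].
  move: E1 E2; rewrite add0r scale0r add0r chart_phi0 -splitr.
  have : t / 2 * m' k1 <= 0 by nra.
  have : t / 2 * m' k2 < 0 by nra.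
  lra.
have [t1 t10 h1] := key 1 (normr1 _).
have [t2 t20 h2] := key (-1) (ltac:(by rewrite normrN1)).
pose t : R := Num.min t1 t2 / 2.
have tp : 0 < t by rewrite divr_gt0 // lt_min t10.
have m0 : 0 < Num.min t1 t2 by rewrite lt_min t10.
have tm : t < Num.min t1 t2 by rewrite /t; lra.
move: tm; rewrite lt_min => /andP[tt1 tt2].
have D1 := h1 t (ltac:(by rewrite tp)); have D2 := h2 t (ltac:(by rewrite tp)).
apply: Dy; have := s_convex HS (t := 1 / 2) D1 D2 (ltac:(apply/andP; split; lra)).
rewrite (_ : _ + _ = y) //; apply/rowP => i; rewrite !mxE.
by field.
Qed.

Lemma chart_C1 (X : 'I_n -> V -> R) dX : (forall i, C1g D (X i) (dX i)) ->
  C1g (D `&` U) (fun x => \sum_i X i x * dphi i x)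
    (fun l x => \sum_i (dX i l x * dphi i x + X i x * d2phi i l x)).
Proof.
move=> HX; apply: C1g_sum => i _; apply: C1gM.
  by apply: C1gS (HX i) => x [].
by apply: C1gS (Hdphi i) => x [].
Qed.

(* A C1 field X, bounded with its derivatives near y, whose normal component
   has nonpositive boundary values satisfies X . grad phi <= C |phi| near y:
   reach the boundary along a coordinate direction transversal to it. *)
Lemma normal_component_bound (X : 'I_n -> V -> R) dX : (forall i, C1g D (X i) (dX i)) ->
  (forall i, ext D (X i)) -> (forall i l, ext D (dX i l)) ->
  (exists2 rho : R, 0 < rho & forall z (T : 'I_n -> R), U z -> phi z = 0 -> closure D z -> (exists j, dphi j z != 0) ->
     `|z - y| < rho ->
     (forall i, limin D (X i) z (T i)) -> \sum_i T i * dphi i z <= 0) ->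
  exists2 r : R, 0 < r & (forall x, `|x - y| <= r -> U x) /\
    exists C, forall x, D x -> `|x - y| <= r -> \sum_i X i x * dphi i x <= C * `|phi x|.
Proof.
move=> HX eX edX [rho rho0 Xle]; have [_ _ [j j0] _ _] := HC.
have [r' [a [s [r'0 a0 s1 hr']]]] := boundary_radius oU Hphi Uy j0.
pose r : R := Num.min r' (rho / 3).
have r0 : 0 < r by rewrite lt_min r'0 divr_gt0.
have rr' : r <= r' by rewrite ge_min lexx.
have rrho : 2 * r < rho.
  have : r <= rho / 3 by rewrite ge_min lexx orbT.
  lra.
have hr x : `|x - y| <= 2 * r -> U x /\ a <= s * dphi j x.
  by move=> h; apply: hr'; lra.
have bX i : bnear (D `&` U) y (2 * r) (X i).
  have : lcb D (X i) by apply: ext_lcb => // x; exact: cont_in (HX i) x.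
  by move=> h; apply: lcb_bnear; apply: lcbS h => x [].
have bdX i l : bnear (D `&` U) y (2 * r) (dX i l).
  have : lcb D (dX i l) by apply: ext_lcb => // x Dx; have [_ /(_ l)[]] := HX i x Dx.
  by move=> h; apply: lcb_bnear; apply: lcbS h => x [].
have bp i : bnear (D `&` U) y (2 * r) (dphi i).
  by apply: (@continuous_bnear R n U) => x => [Ux|/hr[] //]; have [] := Hdphi i Ux.
have bdp i l : bnear (D `&` U) y (2 * r) (d2phi i l).
  by apply: (@continuous_bnear R n U) => x => [Ux|/hr[] //]; have [_ /(_ l)[]] := Hdphi i Ux.
have [M1 hM1] : bnear (D `&` U) y (2 * r) (fun x => \sum_i X i x * dphi i x).
  by apply: bnear_sum => i _; exact: bnearM.
have [M2 hM2] : exists M, forall l x, (D `&` U) x -> `|x - y| <= 2 * r ->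
    `|\sum_i (dX i l x * dphi i x + X i x * d2phi i l x)| <= M.
  apply: bnear_fin => l; apply: bnear_sum => i _; apply: bnearD; exact: bnearM.
exists r => //; split; first by move=> x xr; have [|] := hr x _ => //; lra.
exists (Num.max M1 M2 / a + Num.max M1 M2 / (a * r)) => x Dx xr.
apply: (@boundary_bound R n D U phi dphi oU Hphi DU y j r a s (Num.max M1 M2)
  (fun x => \sum_i X i x * dphi i x) _ r0 a0 s1 hr (chart_C1 HX)) => //.
  move=> z Dz zr; have [Uz _] := hr z zr.
  by rewrite !le_max (hM1 z) // (hM2 j z) // orbT.
move=> z Uz pz zr e e0.
have [cz|cz] := pselect (closure D z); last first.
  have : nbhs z (~` closure D) by apply: open_nbhs_nbhs; split=> //; apply: closed_openC; exact: closed_closure.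
  move=> /nbhs_eps[d d0 hd]; exists d => // w Dw wz; exfalso.
  by apply: (hd w wz); exact: subset_closure.
have hT0 i : exists l, limin D (X i) z l by exact: eX i z cz.
have /choice[T hT] := hT0.
have Xz : \sum_i T i * dphi i z <= 0.
  apply: Xle => //; last exact: le_lt_trans zr rrho.
  exists j; have [_] := hr z zr; apply: contraTneq => ->.
  by rewrite mulr0 -ltNge.
have L : limin D (fun x => \sum_i X i x * dphi i x) z (\sum_i T i * dphi i z).
  apply: limin_sum => i _; apply: liminM => //; apply: limin_cont.
  by have [] := Hdphi i Uz.
have [d d0 hd] := limin_eps L e0; exists d => // w Dw wz.
by have := hd w Dw wz; rewrite ltr_norml => /andP[_]; lra.
Qed.

End at_chart.

End problem.

(** * Sign of the boundary flux of the gradient energy *)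

Section boundary_sign.
Context {R : realType} {n : nat}.
Local Notation V := 'rV[R]_n.
Local Notation mu := (@lebesgue_rV R n).

Lemma limin_sub (D D' : set V) (g : V -> R) x l : D' `<=` D -> limin D g x l -> limin D' g x l.
Proof.
move=> DD h; apply: eps_limin => e e0; have [d d0 hd] := limin_eps h e0.
by exists d => // y /DD; exact: hd.
Qed.

Variables (D : set V) (f f' : R -> R) (u : V -> R) (u1 : 'I_n -> V -> R)
  (u2 : 'I_n -> 'I_n -> V -> R) (u3 : 'I_n -> 'I_n -> 'I_n -> V -> R).
Hypothesis HS : setup D f f' u u1 u2 u3.
Let oD := s_open HS.

Lemma chart_move y z U phi dphi d2phi : chart D u1 y U phi dphi d2phi -> U z ->
  (exists j, dphi j z != 0) -> chart D u1 z U phi dphi d2phi.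
Proof. by case=> -[? ?] ? ? ? ? ? ?; split. Qed.

Lemma chart_notin y U phi dphi d2phi z : chart D u1 y U phi dphi d2phi -> U z -> phi z = 0 -> ~ D z.
Proof. by case=> _ _ _ h _ Uz pz Dz; have := (h z Uz).1 Dz; rewrite pz ltxx. Qed.

(* Expand [grad u . grad phi], which is O(phi) near y by the Neumann condition,
   along the inward direction [tau - kappa grad phi (y)] with [tau = grad u (y)];
   as kappa -> 0 this gives [D2u (tau, grad phi) + D2phi (tau, tau) <= 0]. *)
Lemma grad_square_normal_le0 y U phi dphi d2phi (T : 'I_n -> R) :
  closure D y -> ~ D y -> chart D u1 y U phi dphi d2phi ->
  (forall j, limin D (W u1 u2 j) y (T j)) -> \sum_j T j * dphi j y <= 0.
Proof.
move=> cy Dy HC HT; have [[oU Uy] [Hphi Hdphi] _ DU hN] := HC.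
have h1 i : exists l, limin D (u1 i) y l by exact: s_eu1 HS i y cy.
have h2 i : exists L : 'I_n -> R, forall j, limin D (u2 i j) y (L j).
  have h3 j : exists l, limin D (u2 i j) y l by exact: s_eu2 HS i j y cy.
  by have /choice[L hL] := h3; exists L.
have /choice[tau htau] := h1; have /choice[H hH] := h2.
have Hsym i j : H i j = H j i.
  apply: (limin_uniq cy (hH i j)); apply: limin_eq (hH j i) => x Dx.
  exact: (u2_sym HS j i Dx).
have ET j : T j = \sum_i tau i * H i j.
  apply: (limin_uniq cy (HT j)); apply: limin_sum => i _; exact: liminM.
pose p j := dphi j y; pose q i j := d2phi i j y.
have p0 : phi y = 0 by exact: chart_phi0 cy Dy HC.
have tang : \sum_i tau i * p i = 0 by apply: hN => //; case: HC.
have Hq : 0 <= \sum_i \sum_j tau i * q i j * tau j := boundary_hessian_ge0 HS cy Dy HC (tang : \sum_i tau i * dphi i y = 0).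
pose L l := \sum_i (H i l * p i + tau i * q i l).
pose A0 := \sum_l tau l * L l; pose B0 := \sum_l p l * L l.
(* [A0] is the sum of the quantity to be bounded and of the Hessian of [phi] on [tau], which is
   nonnegative. *)
suff A0le : A0 <= 0.
  have : A0 = \sum_j T j * p j + \sum_i \sum_j tau i * q i j * tau j.
    have -> : A0 = \sum_l \sum_i tau l * H i l * p i + \sum_l \sum_i tau i * q i l * tau l.
      rewrite -big_split /=; apply: eq_bigr => l _; rewrite /L mulr_sumr -big_split /=.
      by apply: eq_bigr => i _; ring.
    congr (_ + _); rewrite exchange_big //=; apply: eq_bigr => i _.
    by rewrite ET mulr_suml; apply: eq_bigr => l _; rewrite Hsym.
  by rewrite /p; lra.
have [r r0 [rU [C hC]]] : exists2 r : R, 0 < r & (forall x, `|x - y| <= r -> U x) /\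
    exists C, forall x, D x -> `|x - y| <= r -> \sum_i u1 i x * dphi i x <= C * `|phi x|.
  apply: (normal_component_bound HC (s_u1 HS) (s_eu1 HS) (s_eu2 HS)).
  exists 1 => // z tz Uz pz cz jz _ htz.
  by rewrite (hN z tz Uz pz cz jz htz).
pose P2 := \sum_i p i ^+ 2.
have P20 : 0 < P2.
  have [_ _ [j j0] _ _] := HC; rewrite /P2 (bigD1 j) //=.
  apply: ltr_wpDr; first by apply: sumr_ge0 => i _; exact: sqr_ge0.
  by rewrite lt_neqAle eq_sym sqrf_eq0 j0 sqr_ge0.
pose K := `|B0| + 1 + `|C| * (P2 + P2).
have K0 : 0 <= K by rewrite !addr_ge0 // mulr_ge0 // addr_ge0 // ltW.
suff key (ka : R) : 0 < ka -> ka <= 1 -> A0 <= ka * K.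
  rewrite leNgt; apply/negP => A0p.
  pose ka : R := Num.min 1 (A0 / (2 * (K + 1))).
  have K1 : 0 < 2 * (K + 1) by lra.
  have ka0 : 0 < ka by rewrite lt_min ltr01 divr_gt0.
  have := key ka ka0; rewrite ge_min lexx => /(_ isT).
  have : ka <= A0 / (2 * (K + 1)) by rewrite ge_min lexx orbT.
  rewrite ler_pdivlMr // => h.
  have : 0 <= ka * K by rewrite mulr_ge0 // ltW.
  lra.
move=> ka0 ka1.
pose d : V := \row_i (tau i - ka * p i).
have dE i : d ord0 i = tau i - ka * p i by rewrite mxE.
have dp : \sum_j d ord0 j * p j = - (ka * P2).
  rewrite (eq_bigr (fun j => tau j * p j - ka * p j ^+ 2)); last by move=> j _; rewrite dE; ring.
  by rewrite sumrB tang sub0r -mulr_sumr.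
have dL : \sum_l d ord0 l * L l = A0 - ka * B0.
  rewrite /A0 /B0 mulr_sumr -sumrB; apply: eq_bigr => l _; rewrite dE; ring.
pose c : R := `|d| + 1.
have c0 : 0 < c by rewrite /c ltr_wpDl.
have inB (t : R) : 0 < t < r / c -> `|t *: d + y - y| <= r.
  move=> /andP[t0 tr]; rewrite addrK normrZ (gtr0_norm t0); apply: (@le_trans _ _ (t * c)).
    by apply: ler_wpM2l; [exact: ltW|rewrite /c lerDl].
  by rewrite -ler_pdivlMr // ltW.
have rc0 : 0 < r / c by rewrite divr_gt0.
pose e1 : R := ka * P2 / 2.
have e10 : 0 < e1 by rewrite divr_gt0 // mulr_gt0.
have cphi : limin U phi y 0 by rewrite -p0; apply: limin_cont; have [] := Hphi y Uy.
have cdphi i : limin U (dphi i) y (p i) by apply: limin_cont; have [] := Hdphi i y Uy.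
have cd2 i j : limin U (d2phi i j) y (q i j).
  by apply: limin_cont; have [_ /(_ j)[]] := Hdphi i y Uy.
have [t1 t10 ht1] := endpoint_expansion oU Hphi rc0 (fun t ht => rU _ (inB t ht)) cphi cdphi e10.
have phit (t : R) : 0 < t < Num.min (r / c) t1 -> - (2 * ka * P2 * t) <= phi (t *: d + y) < 0.
  move=> /andP[t0]; rewrite lt_min => /andP[_ tt1]; have := ht1 t (ltac:(by rewrite t0)).
  rewrite dp subr0 ler_norml => /andP[+ +].
  have : 0 < ka * P2 * t by rewrite !mulr_gt0.
  by rewrite /e1; move: (phi _) => w; move=> ? ? ?; apply/andP; split; lra.
have m0 : 0 < Num.min (r / c) t1 by rewrite lt_min rc0.
have inDU (t : R) : 0 < t < Num.min (r / c) t1 -> (D `&` U) (t *: d + y).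
  move=> ht; have [t0] := andP ht; rewrite lt_min => /andP[trc _].
  have Ut : U (t *: d + y) by apply: rU; apply: inB; rewrite t0.
  by split=> //; apply/(DU _ Ut); have /andP[] := phit t ht.
have lh : limin (D `&` U) (fun x => \sum_i u1 i x * dphi i x) y 0.
  suff : limin (D `&` U) (fun x => \sum_i u1 i x * dphi i x) y (\sum_i tau i * p i) by rewrite tang.
  apply: limin_sum => i _; apply: liminM; [apply: limin_sub (htau i)|apply: limin_sub (cdphi i)];
    by move=> x [].
have ldh l : limin (D `&` U) (fun x => \sum_i (u2 i l x * dphi i x + u1 i x * d2phi i l x)) y (L l).
  apply: limin_sum => i _; apply: liminD; apply: liminM.
  - by apply: limin_sub (hH i l) => x [].
  - by apply: limin_sub (cdphi i) => x [].
  - by apply: limin_sub (htau i) => x [].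
  - by apply: limin_sub (cd2 i l) => x [].
have [t2 t20 ht2] := endpoint_expansion (openI oD oU) (chart_C1 HC (s_u1 HS)) m0 inDU lh ldh ka0.
pose t : R := Num.min (Num.min (r / c) t1) t2 / 2.
have mm0 : 0 < Num.min (Num.min (r / c) t1) t2 by rewrite lt_min m0.
have t0 : 0 < t by rewrite divr_gt0.
have : t < Num.min (Num.min (r / c) t1) t2 by rewrite /t; lra.
rewrite lt_min => /andP[tm tt2].
have ht : 0 < t < Num.min (r / c) t1 by rewrite t0.
have [Dt Ut] := inDU t ht.
have H2 := ht2 t (ltac:(by rewrite t0)).
have trc : 0 < t < r / c by rewrite t0 /=; move: tm; rewrite lt_min => /andP[].
have H1 := hC _ Dt (inB t trc).
have /andP[P1 P3] := phit t ht.
move: H2; rewrite subr0 dL ler_norml => /andP[H2 _].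
have H3 : C * `|phi (t *: d + y)| <= `|C| * (2 * ka * P2 * t).
  apply: le_trans (ler_norm _) _; rewrite normrM normr_id; apply: ler_wpM2l => //.
  by rewrite ltr0_norm //; lra.
have H4 : t * (A0 - ka * B0) <= ka * t + `|C| * (2 * ka * P2 * t).
  by move: H1 H2 H3; move: (\sum_i _) (C * _) => a b; lra.
have H5 : A0 - ka * B0 <= ka + `|C| * (2 * ka * P2).
  by rewrite -(ler_pM2l t0); lra.
have : ka * B0 <= ka * `|B0| by apply: ler_wpM2l; [exact: ltW|exact: ler_norm].
rewrite /K; lra.
Qed.

Lemma flux_boundary y U phi dphi d2phi (X : 'I_n -> V -> R) dX :
  chart D u1 y U phi dphi d2phi -> (forall i, C1g D (X i) (dX i)) ->
  (forall i, ext D (X i)) -> (forall i l, ext D (dX i l)) ->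
  (exists2 rho : R, 0 < rho & forall z (T : 'I_n -> R), U z -> phi z = 0 -> closure D z -> (exists j, dphi j z != 0) ->
     `|z - y| < rho ->
     (forall i, limin D (X i) z (T i)) -> \sum_i T i * dphi i z <= 0) ->
  exists2 r : R, 0 < r & forall theta dtheta, C1g setT theta dtheta -> (forall x, 0 <= theta x) ->
    (forall x, r < `|x - y| -> theta x = 0) ->
    \int[mu]_(x in D) (\sum_i (dtheta i x * X i x + theta x * dX i i x)) <= 0.
Proof.
move=> HC HX eX edX Xle; have [[oU Uy] [Hphi Hdphi] _ DU hN] := HC.
have [r r0 [rU [C hC]]] := normal_component_bound HC HX eX edX Xle.
exists r => // theta dtheta Ht t0 tr.
have bX i : bnear D y r (X i).
  by apply: lcb_bnear; apply: ext_lcb => // x; exact: cont_in (HX i) x.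
have bdX i l : bnear D y r (dX i l).
  by apply: lcb_bnear; apply: ext_lcb => // x Dx; have [_ /(_ l)[]] := HX i x Dx.
have [M1 hM1] := bnear_fin bX.
have [M2 hM2] := bnear_fin (fun i => bdX i i).
apply: (@flux_le0 R n D U phi dphi oD Hphi DU y r C (Num.max M1 M2) rU theta dtheta Ht t0 tr X dX) => //.
- by move=> i; apply: C1gS (HX i) => x [].
- by move=> i x Dx xr; rewrite !le_max hM1 // hM2 // orbT.
Qed.

(** Inside [D] the flux is exactly [0], away from the closure the integrand vanishes, and at the
    frontier [grad_square_normal_le0] supplies the sign required by [flux_boundary]. *)
Lemma flux_local_W y : exists2 r : R, 0 < r & forall theta dtheta, C1g setT theta dtheta ->
  (forall x, 0 <= theta x) -> (forall x, r < `|x - y| -> theta x = 0) ->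
  \int[mu]_(x in D) (\sum_i (dtheta i x * W u1 u2 i x + theta x * dW u1 u2 u3 i i x)) <= 0.
Proof.
have [Dy|Dy] := pselect (D y).
  have [r r0 hr] := open_eps oD Dy.
  exists (r / 2); first by rewrite divr_gt0.
  move=> theta dtheta Ht t0 tr; pose K := [set x : V | `|x - y| <= r / 2].
  have cK : closed K.
    rewrite (_ : K = ~` [set x | r / 2 < `|x - y|]); first by apply: open_closedC; exact: open_outside.
    by apply/seteqP; split=> x; rewrite /K /= => h; [apply/negP; rewrite -leNgt|rewrite leNgt; apply/negP].
  have KD : K `<=` D by move=> x /= h; apply: hr; apply: le_lt_trans h _; lra.
  have outK x : ~ K x -> r / 2 < `|x - y| by move=> /negP; rewrite -ltNge.
  have H i : C1g setT (fun x => theta x * W u1 u2 i x)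
      (fun l x => dtheta l x * W u1 u2 i x + theta x * dW u1 u2 u3 i l x).
    apply: (C1g_glue cK KD).
    - exact: C1gM (C1gS (@subsetT _ D) Ht) (C1_W HS i).
    - by move=> x /outK h; rewrite tr // mul0r.
    - by move=> l x /outK h; rewrite tr // (dtheta_outside Ht tr) // !mul0r addr0.
  have cH i : continuous (fun x => dtheta i x * W u1 u2 i x + theta x * dW u1 u2 u3 i i x).
    by move=> x; have [_ /(_ i)[]] := H i x I.
  have sH i : bsupp setT (fun x => theta x * W u1 u2 i x).
    exists (r / 2 + `|y|) => x _ h; rewrite tr ?mul0r //.
    rewrite -(ltrD2r `|y|); apply: lt_le_trans h _.
    by rewrite -{1}[x](subrK y); exact: ler_normD.
  rewrite int_rV_sum //; last first.
    move=> i _; split; first exact: lcb_continuous.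
    exists (r / 2 + `|y|) => x _ h.
    have h' : r / 2 < `|x - y|.
      rewrite -(ltrD2r `|y|); apply: lt_le_trans h _.
      by rewrite -{1}[x](subrK y); exact: ler_normD.
    by rewrite tr // (dtheta_outside Ht tr) // !mul0r addr0.
  rewrite big1 // => i _.
  apply: (@int_partial0 R n D K i (fun x => theta x * W u1 u2 i x) _ oD cK KD _ (cH i) _ (sH i)).
    by move=> x; have [_ /(_ i)[]] := H i x I.
  by move=> x /outK h; rewrite tr // mul0r.
have [cy|cy] := pselect (closure D y); last first.
  have : nbhs y (~` closure D) by apply: open_nbhs_nbhs; split=> //; apply: closed_openC; exact: closed_closure.
  move=> /nbhs_eps[r r0 hr]; exists (r / 2); first by rewrite divr_gt0.
  move=> theta dtheta Ht t0 tr; rewrite int_rV0 // => x Dx.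
  have h : r / 2 < `|x - y|.
    rewrite ltNge; apply/negP => h; apply: (hr x); first by apply: le_lt_trans h _; lra.
    exact: subset_closure.
  by rewrite big1 // => i _; rewrite tr // (dtheta_outside Ht tr) // !mul0r addr0.
have [U [phi [dphi [d2phi HC]]]] := s_chart HS cy Dy.
apply: (flux_boundary HC (C1_W HS) (ext_W HS) (ext_dW HS)).
exists 1 => // z T Uz pz cz jz _ hT.
have HCz := chart_move HC Uz jz.
exact: grad_square_normal_le0 cz (chart_notin HC Uz pz) HCz hT.
Qed.

(** The squared Euclidean distance, smooth in [x], whereas [|x - y|] is the sup norm. *)
Definition qdist (y x : V) : R := \sum_i (x ord0 i - y ord0 i) ^+ 2.

Lemma qdist_ge0 y x : 0 <= qdist y x.
Proof. by apply: sumr_ge0 => i _; exact: sqr_ge0. Qed.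

Lemma C1g_qdist y E : C1g E (qdist y) (fun i x => 2 * (x ord0 i - y ord0 i)).
Proof.
have H k : C1g E (fun x : V => (x ord0 k - y ord0 k) ^+ 2)
   (fun i x => 2 * (x ord0 k - y ord0 k) * (i == k)%:R).
  apply: (C1g_ext _ _ (@C1g_comp R n E (fun x => x ord0 k - y ord0 k) (fun i _ => (i == k)%:R)
     (fun t => t ^+ 2) (fun t => 2 * t) _ _)) => //.
  - apply: (C1g_ext _ _ (C1gB (@C1g_coord R n E k) (@C1g_cst R n E (y ord0 k)))) => // i x.
    by rewrite subr0.
  - move=> x _; split; first by have := is_derive_pow 1 (x ord0 k - y ord0 k); rewrite expr1.
    apply: (@continuousM R R (cst 2) id); first exact: cst_continuous.
    exact: cvg_id.
apply: (C1g_ext _ _ (@C1g_sum R n E _ (index_enum _) xpredT _ _ (fun k _ => H k))) => // i x.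
rewrite (bigD1 i) //= eqxx mulr1 big1 ?addr0 // => k ki.
by rewrite eq_sym (negbTE ki) mulr0.
Qed.

Lemma norm_qdist y x : `|x - y| ^+ 2 <= qdist y x.
Proof.
have q0 := qdist_ge0 y x.
have h : `|x - y| <= Num.sqrt (qdist y x).
  rewrite (normv_leP _ (sqrtr_ge0 _)) => i; rewrite -(@ler_pXn2r _ 2) ?nnegrE ?sqrtr_ge0 //.
  rewrite sqr_sqrtr // real_normK ?num_real // /qdist (bigD1 i) //= !mxE lerDl.
  by apply: sumr_ge0 => j _; exact: sqr_ge0.
by have := h; rewrite -(@ler_pXn2r _ 2) ?nnegrE ?sqrtr_ge0 // sqr_sqrtr.
Qed.

Lemma bump_C1 (y : V) (r : R) : C1g setT (fun x => pos (r ^+ 2 - qdist y x) ^+ 2)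
  (fun i x => 2 * pos (r ^+ 2 - qdist y x) * (- (2 * (x ord0 i - y ord0 i)))).
Proof.
apply: (C1g_ext _ _ (@C1g_comp R n setT (fun x => r ^+ 2 - qdist y x) (fun i x => - (2 * (x ord0 i - y ord0 i)))
     (fun t => pos t ^+ 2) (fun t => 2 * pos t) _ _)) => //.
- apply: (C1g_ext _ _ (C1gB (@C1g_cst R n setT (r ^+ 2)) (@C1g_qdist y setT))) => // i x.
  by rewrite sub0r.
- move=> x _; split; first by have := is_derive_posX 0 (r ^+ 2 - qdist y x); rewrite expr1.
  by apply: (@continuousM R R (cst 2) pos); [exact: cst_continuous|exact: pos_continuous].
Qed.

Lemma qdist_continuous (y : V) : continuous (qdist y).
Proof. by move=> x; have [] := C1g_qdist y (x := x) (E := setT) I. Qed.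

Lemma qball_compact (y : V) (rho : R) : 0 <= rho -> compact [set x | qdist y x <= rho ^+ 2].
Proof.
move=> r0; apply: bounded_closed_compact.
  exists (rho + `|y|); split; first exact: num_real.
  move=> M rM x /= xr; apply: le_trans (ltW rM).
  rewrite -[x](subrK y); apply: le_trans (ler_normD _ _) _; rewrite lerD2r.
  rewrite -(@ler_pXn2r _ 2) ?nnegrE //; apply: le_trans (norm_qdist _ _) xr.
rewrite (_ : [set x | _] = qdist y @^-1` [set t | t <= rho ^+ 2])//.
by apply: closed_comp => [x _|]; [exact: qdist_continuous|exact: closed_le].
Qed.

(** The radius in [flux_local_W] depends on the point, so [theta] is split by a partition of unity
    attached to a finite cover of the ball outside which it vanishes. *)
Lemma flux_W_le0 theta dtheta (rho : R) : 0 <= rho -> C1g setT theta dtheta ->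
  (forall x, 0 <= theta x) -> (forall x, rho ^+ 2 < qdist 0 x -> theta x = 0) ->
  \int[mu]_(x in D) (\sum_i (dtheta i x * W u1 u2 i x + theta x * dW u1 u2 u3 i i x)) <= 0.
Proof.
move=> rho0 Ht t0 tr.
have hr y : exists r : R, 0 < r /\ forall theta dtheta, C1g setT theta dtheta ->
  (forall x, 0 <= theta x) -> (forall x, r < `|x - y| -> theta x = 0) ->
  \int[mu]_(x in D) (\sum_i (dtheta i x * W u1 u2 i x + theta x * dW u1 u2 u3 i i x)) <= 0.
  by have [r r0 h] := flux_local_W y; exists r.
have /choice[r rP] := hr.
pose b y x := pos (r y ^+ 2 - qdist y x) ^+ 2.
have := @qball_compact 0 rho rho0; rewrite compact_cover.
move=> /(_ V setT (fun y => [set x | qdist y x < r y ^+ 2]))[].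
- move=> y _; rewrite (_ : [set x | _] = qdist y @^-1` [set t | t < r y ^+ 2]) //.
  by apply: open_comp => [x _|]; [exact: qdist_continuous|exact: open_lt].
- move=> x _; exists x => //=; have [r0 _] := rP x.
  rewrite /qdist big1 ?exprn_gt0 // => i _.
  by rewrite subrr expr0n.
move=> Y _ hY.
pose s : seq V := finmap.enum_fset Y.
have hcov x : qdist 0 x <= rho ^+ 2 -> exists2 y, y \in s & qdist y x < r y ^+ 2.
  by move=> /hY[y /= yY h]; exists y.
(* [om] vanishes on the ball and is positive outside, so that the denominator [Sb] has no zero and
   the quotients are C1 everywhere. *)
pose om x := pos (qdist 0 x - rho ^+ 2) ^+ 2.
pose Sb x := \sum_(y <- s) b y x + om x.
have b0 y x : 0 <= b y x by exact: sqr_ge0.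
have Sb0 x : 0 < Sb x.
  rewrite /Sb; have [h|h] := leP (qdist 0 x) (rho ^+ 2).
    have [y ys hy] := hcov x h; apply: ltr_wpDr; first exact: sqr_ge0.
    rewrite (big_rem y) //=; apply: ltr_wpDr; first by apply: sumr_ge0.
    by rewrite /b pos_id ?exprn_gt0 //; [rewrite subr_gt0|rewrite subr_ge0 ltW].
  apply: ltr_wpDl; first by apply: sumr_ge0.
  by rewrite /om pos_id ?exprn_gt0 //; [rewrite subr_gt0|rewrite subr_ge0 ltW].
have Hom : exists dom, C1g setT om dom.
  eexists; apply: (@C1g_comp R n setT (fun x => qdist 0 x - rho ^+ 2) _ (fun t => pos t ^+ 2) (fun t => 2 * pos t)).
    exact: C1gB (@C1g_qdist 0 setT) (@C1g_cst R n setT (rho ^+ 2)).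
  move=> x _; split; first by have := is_derive_posX 0 (qdist 0 x - rho ^+ 2); rewrite expr1.
  by apply: (@continuousM R R (cst 2) pos); [exact: cst_continuous|exact: pos_continuous].
have [dom Hdom] := Hom.
have HSb := C1gD (@C1g_sum R n setT V s xpredT _ _ (fun y _ => bump_C1 y (r y))) Hdom.
have Hinv : exists dinv, C1g setT (fun x => (Sb x)^-1) dinv.
  eexists; apply: (@C1g_comp R n setT Sb _ (fun t => t^-1) (fun t => - t ^- 2) HSb).
  move=> x _; have Sx : Sb x != 0 by rewrite gt_eqF.
  split.
    have h := @is_deriveV R id (Sb x) 1 1 Sx (is_derive_id _ _).
    by apply: (is_derive_eq h); rewrite [_ *: _]mulr1.
  apply: (@continuousN R R R (fun t => t ^- 2)); apply: continuousV; first by rewrite expf_neq0.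
  exact: exprn_continuous.
have [dinv Hdinv] := Hinv.
pose th y x := theta x * (b y x * (Sb x)^-1).
have Hth y : exists dth, C1g setT (th y) dth.
  by eexists; exact: C1gM Ht (C1gM (bump_C1 y (r y)) Hdinv).
have /choice[dth Hdth] := Hth.
have thE x : theta x = \sum_(y <- s) th y x.
  have [h|h] := leP (qdist 0 x) (rho ^+ 2); last first.
    by rewrite tr // big1 // => y _; rewrite /th tr // mul0r.
  rewrite /th -mulr_sumr -mulr_suml.
  have -> : \sum_(y <- s) b y x = Sb x.
    by rewrite /Sb /om pos_nonpos ?subr_le0 // expr0n addr0.
  by rewrite divff ?mulr1 // gt_eqF.
have dthE i x : dtheta i x = \sum_(y <- s) dth y i x.
  have H := @C1g_sum R n setT V s xpredT th dth (fun y _ => Hdth y).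
  have H' : C1g setT theta (fun i x => \sum_(y <- s) dth y i x).
    by apply: C1g_ext H => // z; rewrite thE.
  exact: (C1g_uniq i Ht H' (I : [set: V] x)).
have bs theta' dtheta' : C1g setT theta' dtheta' -> (forall x, rho ^+ 2 < qdist 0 x -> theta' x = 0) ->
  ibl D (fun x => \sum_i (dtheta' i x * W u1 u2 i x + theta' x * dW u1 u2 u3 i i x)).
  move=> H h0; apply: ibl_sum => i _.
  have tsupp x : rho < `|x| -> theta' x = 0.
    move=> h; apply: h0; apply: lt_le_trans (norm_qdist 0 x); rewrite subr0.
    by rewrite ltr_pXn2r // nnegrE.
  have c1 : continuous theta' by move=> x; have [] := H x I.
  have c2 : continuous (dtheta' i) by move=> x; have [_ /(_ i)[]] := H x I.
  apply: iblD; apply: iblMl; [split|exact: lcb_W HS _|split|exact: lcb_dW HS _ _]; try exact: lcb_continuous.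
    exists rho => x _ h; apply: (@dtheta_outside R n theta' dtheta' 0 rho H) => [z|]; rewrite subr0 //.
    exact: tsupp.
  by exists rho => x _ h; exact: tsupp.
have th0 y x : rho ^+ 2 < qdist 0 x -> th y x = 0 by move=> h; rewrite /th tr // mul0r.
rewrite (eq_int_rV (G := fun x => \sum_(y <- s) \sum_i (dth y i x * W u1 u2 i x + th y x * dW u1 u2 u3 i i x))); last first.
  move=> x Dx; rewrite exchange_big /=; apply: eq_bigr => i _.
  by rewrite dthE thE !mulr_suml -big_split.
rewrite int_rV_sum //; last by move=> y _; apply: bs => // x; exact: th0.
apply: sumr_le0 => y _; have [r0 h] := rP y; apply: h => //.
- by move=> x; rewrite /th; apply: mulr_ge0 => //; apply: mulr_ge0; [exact: sqr_ge0|rewrite invr_ge0 ltW].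
- move=> x h; rewrite /th /b pos_nonpos ?expr0n ?mul0r ?mulr0 //.
  rewrite subr_le0; apply: le_trans (norm_qdist _ _).
  by rewrite ler_pXn2r ?nnegrE // ltW.
Qed.

End boundary_sign.

(** * The second variation *)

Section quadratic_form.
Context {R : realType} {n : nat}.
Local Notation V := 'rV[R]_n.+1.
Local Notation mu := (@lebesgue_rV R n.+1).
Implicit Types (g h : V -> R) (dg dh : 'I_n.+1 -> V -> R).

Lemma adm_mul (D : set V) g dg h dh : C1g D h dh -> ext D h -> (forall i, ext D (dh i)) ->
  adm D g dg -> adm D (fun x => h x * g x) (fun i x => dh i x * g x + h x * dg i x).
Proof.
move=> Hh eh edh [Hg eg edg sg]; split.
- exact: C1gM.
- exact: extM.
- by move=> i; apply: extD; apply: extM.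
- exact: bsuppMr.
Qed.

Lemma admD (D : set V) g dg h dh : adm D g dg -> adm D h dh ->
  adm D (fun x => g x + h x) (fun i x => dg i x + dh i x).
Proof.
move=> [Hg eg edg sg] [Hh eh edh sh]; split; [exact: C1gD|exact: extD| |exact: bsuppD].
by move=> i; exact: extD.
Qed.

Lemma admZ (D : set V) g dg (a : R) : adm D g dg -> adm D (fun x => a * g x) (fun i x => a * dg i x).
Proof.
move=> [Hg eg edg sg]; split; [exact: C1gZ|exact: extZ| |exact: bsuppMr].
by move=> i; exact: extZ.
Qed.

Lemma adm_sum (D : set V) (I : Type) (s : seq I) (G : I -> V -> R) dG : (forall i, adm D (G i) (dG i)) ->
  adm D (fun x => \sum_(i <- s) G i x) (fun j x => \sum_(i <- s) dG i j x).
Proof.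
move=> H; split.
- exact: (@C1g_sum R n.+1 D I s xpredT G dG (fun i _ => let: And4 h _ _ _ := H i in h)).
- by apply: ext_sum => i _; have [] := H i.
- by move=> j; apply: ext_sum => i _; have [_ _ /(_ j)] := H i.
- by apply: bsupp_sum => i _; have [] := H i.
Qed.

Variables (D : set V) (c : V -> R).
Hypothesis oD : open D.
Hypothesis lc : lcb D c.

Definition stabform g dg h dh := \int[mu]_(x in D) (\sum_i dg i x * dh i x - c x * (g x * h x)).

Lemma Q_ibl g dg h dh : adm D g dg -> lcb D h -> (forall i, lcb D (dh i)) ->
  ibl D (fun x => \sum_i dg i x * dh i x - c x * (g x * h x)).
Proof.
move=> /(adm_ibl oD)[ig idg] lh ldh; apply: iblB.
  by apply: ibl_sum => i _; exact: iblMl.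
by apply: iblMr => //; exact: iblMl.
Qed.

Lemma adm_lcb g dg : adm D g dg -> lcb D g /\ forall i, lcb D (dg i).
Proof. by move=> /(adm_ibl oD)[[]] ? _ h; split=> // i; case: (h i). Qed.

Lemma Q_ibl2 g dg h dh : adm D g dg -> adm D h dh ->
  ibl D (fun x => \sum_i dg i x * dh i x - c x * (g x * h x)).
Proof. by move=> Hg /adm_lcb[lh ldh]; exact: Q_ibl. Qed.

Lemma QX g dg h dh (t : R) : adm D g dg -> adm D h dh ->
  stabform (fun x => g x + t * h x) (fun i x => dg i x + t * dh i x)
    (fun x => g x + t * h x) (fun i x => dg i x + t * dh i x) =
  stabform g dg g dg + (2 * t * stabform g dg h dh + t ^+ 2 * stabform h dh h dh).
Proof.
move=> Hg Hh; have i1 := Q_ibl2 Hg Hg; have i2 := Q_ibl2 Hg Hh; have i3 := Q_ibl2 Hh Hh.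
rewrite /stabform -(int_rVZ (2 * t) oD i2) -(int_rVZ (t ^+ 2) oD i3).
rewrite -(int_rVD oD (iblZ _ i2) (iblZ _ i3)) -(int_rVD oD i1 (iblD (iblZ _ i2) (iblZ _ i3))).
apply: eq_int_rV => x _; rewrite !mulrBr !mulr_sumr.
set A := \sum_i _; set B := \sum_i _; set C := \sum_i _; set E := \sum_i _.
have -> : A = B + C + E by rewrite /A /B /C /E -!big_split /=; apply: eq_bigr => i _; ring.
ring.
Qed.

Hypothesis Q_ge0 : forall g dg, adm D g dg -> 0 <= stabform g dg g dg.

(** Discriminant of the nonnegative polynomial [t -> Q (g + t h)]. *)
Lemma Q_schwarz g dg h dh : adm D g dg -> adm D h dh ->
  stabform g dg h dh ^+ 2 <= stabform g dg g dg * stabform h dh h dh.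
Proof.
move=> Hg Hh; have P (t : R) : 0 <= stabform g dg g dg + (2 * t * stabform g dg h dh + t ^+ 2 * stabform h dh h dh).
  by rewrite -QX //; apply: Q_ge0; exact: admD Hg (admZ t Hh).
have A0 := Q_ge0 Hg; have B0 := Q_ge0 Hh.
move: P A0 B0; move: (stabform g dg h dh) (stabform g dg g dg) (stabform h dh h dh) => b a d P a0 d0.
have [d1|d1] := eqVneq d 0.
  rewrite d1 mulr0; have [-> |b0] := eqVneq b 0; first by rewrite expr0n.
  (* When [d = 0] the polynomial is the affine function [a + 2 t b]; this [t] gives it the value
     [-1]. *)
  have := P (- (a + 1) / (2 * b)); rewrite d1.
  have -> : 2 * (- (a + 1) / (2 * b)) * b = - (a + 1) by field.
  lra.
have {d0}d0 : 0 < d by rewrite lt_neqAle eq_sym d1.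
have := P (- b / d).
have -> : a + (2 * (- b / d) * b + (- b / d) ^+ 2 * d) = (a * d - b ^+ 2) / d by field.
by rewrite pmulr_lge0 ?invr_gt0 // subr_ge0.
Qed.

Lemma Q_parallelogram g dg h dh : adm D g dg -> adm D h dh ->
  stabform (fun x => g x + h x) (fun i x => dg i x + dh i x)
    (fun x => g x + h x) (fun i x => dg i x + dh i x) <= 2 * stabform g dg g dg + 2 * stabform h dh h dh.
Proof.
move=> Hg Hh; have := QX (-1) Hg Hh.
have := Q_ge0 (admD Hg (admZ (-1) Hh)).
have -> : stabform (fun x => g x + h x) (fun i x => dg i x + dh i x)
    (fun x => g x + h x) (fun i x => dg i x + dh i x) =
    stabform (fun x => g x + 1 * h x) (fun i x => dg i x + 1 * dh i x)
    (fun x => g x + 1 * h x) (fun i x => dg i x + 1 * dh i x).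
  apply: eq_int_rV => x _; rewrite mul1r; congr (_ - _); apply: eq_bigr => i _.
  by rewrite mul1r.
rewrite (QX 1 Hg Hh) => + E; rewrite E; lra.
Qed.

(** Repeated parallelogram inequality; the exponential constant is harmless because the sums to come
    have as many terms as the dimension. *)
Lemma Q_sum_le (I : Type) (s : seq I) (G : I -> V -> R) dG : (forall i, adm D (G i) (dG i)) ->
  stabform (fun x => \sum_(i <- s) G i x) (fun j x => \sum_(i <- s) dG i j x)
    (fun x => \sum_(i <- s) G i x) (fun j x => \sum_(i <- s) dG i j x)
  <= 2 ^+ size s * \sum_(i <- s) stabform (G i) (dG i) (G i) (dG i).
Proof.
move=> H; elim: s => [|i s IH].
  rewrite big_nil mulr0 /stabform int_rV0 // => x _; rewrite !big_nil mulr0 mulr0 subr0.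
  by rewrite big1 // => j _; rewrite big_nil mul0r.
have := Q_parallelogram (H i) (adm_sum s H).
rewrite (_ : stabform _ _ _ _ = stabform (fun x => \sum_(k <- i :: s) G k x) (fun j x => \sum_(k <- i :: s) dG k j x)
    (fun x => \sum_(k <- i :: s) G k x) (fun j x => \sum_(k <- i :: s) dG k j x)); last first.
  apply: eq_int_rV => x _; rewrite !big_cons; congr (_ - _); apply: eq_bigr => j _.
  by rewrite !big_cons.
move=> h; apply: le_trans h _; rewrite big_cons /= exprS mulrDr -mulrA.
apply: lerD; last by rewrite -mulrA; apply: ler_wpM2l.
rewrite mulrA; apply: ler_wpM2r; first exact: Q_ge0.
by rewrite ler_peMr // exprn_ege1 // ler1n.
Qed.

(* [|grad (w eta)|^2 - c (w eta)^2] with [w = sqrt (v^2 + k^2)] is pointwise at most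
   [|grad (v eta)|^2 - c (v eta)^2 + k^2 (|grad eta|^2 - c eta^2)]
   because [w dw = v dv] and [|dw| <= |dv|]. *)
Definition wk (v : V -> R) (k : R) x := Num.sqrt (v x ^+ 2 + k ^+ 2).
Definition dwk (v : V -> R) (dv : 'I_n.+1 -> V -> R) (k : R) i x := v x * dv i x / wk v k x.

Lemma wk_gt0 v (k : R) x : 0 < k -> 0 < wk v k x.
Proof. by move=> k0; rewrite /wk sqrtr_gt0 ltr_wpDl ?sqr_ge0 // exprn_gt0. Qed.

Lemma sqr_wk v (k : R) x : wk v k x ^+ 2 = v x ^+ 2 + k ^+ 2.
Proof. by rewrite /wk sqr_sqrtr // addr_ge0 ?sqr_ge0. Qed.

Lemma wk_bounds v (k : R) x : 0 < k -> `|v x| <= wk v k x <= `|v x| + k.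
Proof.
move=> k0; have w0 := wk_gt0 v x k0; have E := sqr_wk v k x.
apply/andP; split; rewrite -(@ler_pXn2r _ 2) ?nnegrE ?addr_ge0 //; try exact: ltW.
  by rewrite E real_normK ?num_real // lerDl sqr_ge0.
rewrite E sqrrD real_normK ?num_real // -addrA (addrC (`|v x| * k *+ 2)) addrA lerDl.
by rewrite mulrn_wge0 // mulr_ge0 // ltW.
Qed.

Lemma C1_wk v dv (k : R) : 0 < k -> C1g D v dv -> C1g D (wk v k) (dwk v dv k).
Proof.
move=> k0 Hv.
have H1 : C1g D (fun x => v x ^+ 2 + k ^+ 2) (fun i x => 2 * v x * dv i x).
  apply: (C1g_ext _ _ (C1gD (C1gM Hv Hv) (@C1g_cst R n.+1 D (k ^+ 2)))).
    by move=> x; rewrite expr2.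
  by move=> i x; rewrite /=; ring.
apply: (C1g_ext _ _ (@C1g_comp R n.+1 D _ _ Num.sqrt (fun t => (2 * Num.sqrt t)^-1) H1 _)) => //.
  move=> i x; have w0 := wk_gt0 v x k0; rewrite /dwk -/(wk v k x).
  by have w1 := lt0r_neq0 w0; field.
move=> x Dx; have p0 : 0 < v x ^+ 2 + k ^+ 2 by rewrite ltr_wpDl ?sqr_ge0 // exprn_gt0.
split; first exact: is_derive1_sqrt.
apply: continuousV; first by rewrite mulf_neq0 // gt_eqF // sqrtr_gt0.
apply: (@continuousM R R (cst 2) Num.sqrt); first exact: cst_continuous.
exact: sqrt_continuous.
Qed.

Lemma ext_inv (g : V -> R) (a : R) : 0 < a -> (forall x, D x -> a <= g x) -> ext D g ->
  ext D (fun x => (g x)^-1).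
Proof.
move=> a0 ga eg x cx; have [l hl] := eg x cx; exists l^-1.
have la : a <= l by apply: (limin_le cx _ hl ga); exact: limin_cst.
apply: (@limin_comp _ _ D g (fun t => t^-1)) => //.
by apply: continuousV => //; rewrite gt_eqF // (lt_le_trans a0).
Qed.

Lemma ext_wk v dv (k : R) : 0 < k -> ext D v -> (forall i, ext D (dv i)) ->
  ext D (wk v k) /\ forall i, ext D (dwk v dv k i).
Proof.
move=> k0 ev edv.
have ew : ext D (wk v k).
  apply: (@ext_comp _ _ D (fun x => v x ^+ 2 + k ^+ 2) Num.sqrt); first exact: sqrt_continuous.
  apply: extD; last exact: ext_cst.
  by apply: (ext_eq (f := fun x => v x * v x)); [move=> y _; rewrite expr2|exact: extM].
split=> // i; apply: extM; first exact: extM.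
apply: (ext_inv k0) => // x _.
rewrite -(@ler_pXn2r _ 2) ?nnegrE ?sqr_wk //; try exact: ltW.
  by rewrite lerDr sqr_ge0.
by apply: ltW; exact: wk_gt0.
Qed.

Lemma Q_wk_le v dv eta deta (k : R) : 0 < k -> C1g D v dv -> ext D v -> (forall i, ext D (dv i)) ->
  adm D eta deta ->
  stabform (fun x => wk v k x * eta x) (fun i x => dwk v dv k i x * eta x + wk v k x * deta i x)
    (fun x => wk v k x * eta x) (fun i x => dwk v dv k i x * eta x + wk v k x * deta i x) <=
  stabform (fun x => v x * eta x) (fun i x => dv i x * eta x + v x * deta i x)
    (fun x => v x * eta x) (fun i x => dv i x * eta x + v x * deta i x) +
  k ^+ 2 * stabform eta deta eta deta.
Proof.
move=> k0 Hv ev edv Ha; have [ew edw] := ext_wk k0 ev edv.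
have A1 := adm_mul (C1_wk k0 Hv) ew edw Ha.
have A2 := adm_mul Hv ev edv Ha.
have i1 := Q_ibl2 A1 A1; have i2 := Q_ibl2 A2 A2; have i3 := Q_ibl2 Ha Ha.
rewrite /stabform -(int_rVZ (k ^+ 2) oD i3) -(int_rVD oD i2 (iblZ _ i3)).
apply: le_int_rV => //; first exact: iblD i2 (iblZ _ i3).
move=> x Dx; have w0 := wk_gt0 v x k0; have E := sqr_wk v k x.
rewrite mulrBr mulr_sumr.
suff H : \sum_i (dwk v dv k i x * eta x + wk v k x * deta i x) * (dwk v dv k i x * eta x + wk v k x * deta i x)
   <= \sum_i (dv i x * eta x + v x * deta i x) * (dv i x * eta x + v x * deta i x)
    + \sum_i k ^+ 2 * (deta i x * deta i x).
  have -> : c x * (wk v k x * eta x * (wk v k x * eta x)) =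
     c x * (v x * eta x * (v x * eta x)) + k ^+ 2 * (c x * (eta x * eta x)).
    have -> : wk v k x * eta x * (wk v k x * eta x) = wk v k x ^+ 2 * eta x ^+ 2 by ring.
    rewrite E; ring.
  by move: H; lra.
rewrite -big_split /=; apply: ler_sum => i _.
have -> : dwk v dv k i x = v x * dv i x / wk v k x by [].
move: w0 E; move: (wk v k x) (v x) (dv i x) (eta x) (deta i x) => w v0 p e q w0 E.
have -> : (v0 * p / w * e + w * q) * (v0 * p / w * e + w * q) =
   (v0 * p / w * e) ^+ 2 + 2 * v0 * p * e * q + w ^+ 2 * q ^+ 2 by field; rewrite gt_eqF.
(* Since [w ^ 2 = v0 ^ 2 + k ^ 2], the mixed terms and those in [q ^ 2] agree on both sides; what is
   left is [v0 ^ 2 <= w ^ 2]. *)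
suff : (v0 * p / w * e) ^+ 2 <= (p * e) ^+ 2 by rewrite E; nra.
have -> : (v0 * p / w * e) ^+ 2 = (v0 ^+ 2 / w ^+ 2) * (p * e) ^+ 2 by field; rewrite gt_eqF.
rewrite ler_piMl ?sqr_ge0 // ler_pdivrMr ?exprn_gt0 // mul1r E lerDl sqr_ge0 //.
Qed.

(** By the Cauchy-Schwarz inequality for the form, functions whose energies tend to [0] become
    orthogonal to every fixed test function. *)
Lemma Q_null_limit (G : nat -> V -> R) dG h dh (e : nat -> R) : (forall k, adm D (G k) (dG k)) ->
  adm D h dh -> (forall k, stabform (G k) (dG k) (G k) (dG k) <= e k) -> e @ \oo --> (0 : R) ->
  (fun k => stabform (G k) (dG k) h dh) @ \oo --> (0 : R).
Proof.
move=> HG Hh Ge e0; apply/cvgr0Pnorm_lt => eps eps0.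
pose B := stabform h dh h dh.
have B0 : 0 <= B by exact: Q_ge0.
have d0 : 0 < eps ^+ 2 / (B + 1) by rewrite divr_gt0 ?exprn_gt0 // ltr_wpDl.
have /cvgr0Pnorm_lt/(_ _ d0) := e0; apply: filterS => k hk.
rewrite -(@ltr_pXn2r _ 2) ?nnegrE //; last exact: ltW.
rewrite real_normK ?num_real //; apply: le_lt_trans (Q_schwarz (HG k) Hh) _.
apply: (@le_lt_trans _ _ (e k * B)); first by apply: ler_wpM2r.
apply: (@le_lt_trans _ _ (`|e k| * (B + 1))).
  apply: ler_pM => //; last by rewrite lerDl.
    exact: le_trans (Q_ge0 (HG k)) (Ge k).
  exact: ler_norm.
by rewrite -ltr_pdivlMr // ltr_wpDl.
Qed.

End quadratic_form.

Lemma sqr_sum_disjoint (R : realType) (I : finType) (a : I -> R) :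
  (forall i j, i != j -> a i * a j = 0) -> (\sum_i a i) ^+ 2 = \sum_i a i ^+ 2.
Proof.
move=> h; rewrite expr2 mulr_suml; apply: eq_bigr => i _.
by rewrite mulr_sumr (bigD1 i) //= big1 ?addr0 ?expr2 // => j ji; rewrite h // eq_sym.
Qed.

(** * Logarithmic cutoffs *)

Section cutoffs.
Context {R : realType} {n : nat}.
Local Notation V := 'rV[R]_n.+1.
Local Notation mu := (@lebesgue_rV R n.+1).

(** [chi m] falls from [1] to [0] while the squared distance to the origin grows from [4 ^ m] to
    [2 * 4 ^ m]; these annuli are disjoint for distinct [m]. *)
Definition chi (m : nat) (x : V) : R := 1 - sstep (4 ^- m * qdist 0 x).
Definition dchi (m : nat) (i : 'I_n.+1) (x : V) : R :=
  - (sstep' (4 ^- m * qdist 0 x) * (4 ^- m * (2 * x ord0 i))).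

Let p4 (m : nat) : 0 < (4 : R) ^- m. Proof. by rewrite invr_gt0 exprn_gt0. Qed.

Lemma C1_chi m : C1g setT (chi m) (dchi m).
Proof.
have H := C1gB (@C1g_cst R n.+1 setT 1) (@C1g_comp R n.+1 setT _ _ sstep sstep'
  (C1gZ (4 ^- m) (@C1g_qdist R n.+1 0 setT)) (fun x _ => conj (is_derive_sstep _) (@sstep'_continuous R _))).
apply: (C1g_ext _ _ H) => // i x.
by rewrite sub0r /dchi mxE subr0.
Qed.

Lemma chi_bounds m x : 0 <= chi m x <= 1.
Proof. by rewrite /chi; have [/andP[? ?] _ _] := sstep_cases (4 ^- m * qdist 0 x); apply/andP; split; lra. Qed.

Lemma chi1 m x : qdist 0 x <= 4 ^+ m -> chi m x = 1 /\ forall i, dchi m i x = 0.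
Proof.
move=> h; have /sstep0[E1 E2] : 4 ^- m * qdist 0 x <= 1.
  by rewrite mulrC ler_pdivrMr ?exprn_gt0 // mul1r.
by rewrite /chi /dchi E1 subr0; split=> // i; rewrite E2 mul0r oppr0.
Qed.

Lemma chi0 m x : 2 * 4 ^+ m <= qdist 0 x -> chi m x = 0 /\ forall i, dchi m i x = 0.
Proof.
move=> h; have /sstep1[E1 E2] : 2 <= 4 ^- m * qdist 0 x.
  by rewrite (mulrC (4 ^- m)) ler_pdivlMr ?exprn_gt0.
by rewrite /chi /dchi E1 subrr; split=> // i; rewrite E2 mul0r oppr0.
Qed.

Lemma dchi0 m i x : 2 * 4 ^+ m <= qdist 0 x -> dchi m i x = 0.
Proof. by move=> h; exact: (chi0 h).2. Qed.

Lemma dchi_disjoint m m' i x : m != m' -> dchi m i x * dchi m' i x = 0.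
Proof.
have H k k' : (k < k')%N -> dchi k i x * dchi k' i x = 0.
  move=> kk; have [/chi1[_ h]|h] := leP (qdist 0 x) (4 ^+ k'); first by rewrite h mulr0.
  rewrite dchi0 ?mul0r //; apply: le_trans (ltW h).
  apply: (@le_trans _ _ (4 ^+ k.+1)); first by rewrite exprS ler_wpM2r ?exprn_ge0 //; lra.
  by rewrite -!natrX ler_nat leq_exp2l.
by rewrite neq_ltn => /orP[/H//|/H h]; rewrite mulrC.
Qed.

(** [32 = 2 ^ 2 * 4 * 2]: the factors bound [sstep'] squared, come from the squared gradient
    [4 * qdist] of [qdist], and bound [4 ^- m * qdist] where [chi m] is not yet [0]. *)
Lemma dchi_sqr m x : 0 <= \sum_i dchi m i x ^+ 2 <= 32 * 4 ^- m.
Proof.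
apply/andP; split; first by apply: sumr_ge0 => i _; exact: sqr_ge0.
have [h|h] := leP (2 * 4 ^+ m) (qdist 0 x).
  rewrite big1; first by rewrite mulr_ge0 // ltW.
  by move=> i _; rewrite dchi0 // expr0n.
have [_ s0 s2] := sstep_cases (4 ^- m * qdist 0 x); set s := sstep' _ in s0 s2 *.
have -> : \sum_i dchi m i x ^+ 2 = s ^+ 2 * (4 * 4 ^- m ^+ 2 * qdist 0 x).
  rewrite {1}/qdist !mulr_sumr; apply: eq_bigr => i _; rewrite /dchi mxE subr0 -/s.
  by move: (4 ^- m) (x _ _) => b c; ring.
have a0 := p4 m; have q0 := qdist_ge0 0 x.
have : 4 ^- m * qdist 0 x <= 2 by rewrite mulrC ler_pdivrMr ?exprn_gt0 // ltW.
move: a0 q0; move: (4 ^- m) (qdist 0 x) => a q a0 q0 aq.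
have -> : s ^+ 2 * (4 * a ^+ 2 * q) = (s ^+ 2 * 4) * ((a * q) * a) by ring.
have -> : 32 * a = (2 ^+ 2 * 4) * (2 * a) by ring.
apply: ler_pM; [by rewrite mulr_ge0 ?sqr_ge0|by rewrite !mulr_ge0 // ltW| |by rewrite ler_wpM2r // ltW].
by rewrite ler_wpM2r // ler_pXn2r ?nnegrE.
Qed.

(** Averaging [k + 1] cutoffs whose gradients have disjoint supports divides the energy by [k + 1].
    The scales run from [k + 1] to [2 k + 1], so the region where [cutoff k] equals [1] exhausts the
    space. *)
Definition cutoff (k : nat) x : R := k.+1%:R^-1 * \sum_(m < k.+1) chi (k.+1 + m) x.
Definition dcutoff (k : nat) i x : R := k.+1%:R^-1 * \sum_(m < k.+1) dchi (k.+1 + m) i x.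

Lemma C1_cutoff k : C1g setT (cutoff k) (dcutoff k).
Proof. by apply: C1gZ; exact: (@C1g_sum R n.+1 setT 'I_k.+1 _ xpredT _ _ (fun m _ => C1_chi (k.+1 + m))). Qed.

Lemma cutoff_bounds k x : 0 <= cutoff k x <= 1.
Proof.
apply/andP; split.
  by rewrite mulr_ge0 // sumr_ge0 // => m _; case/andP: (chi_bounds (k.+1 + m) x).
rewrite /cutoff mulrC ler_pdivrMr // mul1r.
apply: (@le_trans _ _ (\sum_(m < k.+1) 1)); last by rewrite sumr_const card_ord.
by apply: ler_sum => m _; case/andP: (chi_bounds (k.+1 + m) x).
Qed.

Lemma cutoff1 k x : qdist 0 x <= k%:R -> cutoff k x = 1 /\ forall i, dcutoff k i x = 0.
Proof.
move=> h; have H m : qdist 0 x <= 4 ^+ (k.+1 + m).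
  apply: le_trans h _; rewrite -natrX ler_nat; apply: ltnW.
  by apply: (leq_trans (ltn_expl k (isT : 1 < 4)%N)); rewrite leq_exp2l // addSn -addnS leq_addr.
split; last first.
  by move=> i; rewrite /dcutoff big1 ?mulr0 // => m _; exact: (chi1 (H m)).2.
rewrite /cutoff (eq_bigr (fun=> 1)); last by move=> m _; exact: (chi1 (H m)).1.
by rewrite sumr_const card_ord mulVf.
Qed.

Lemma cutoff_near r : exists k0 : nat, forall k, (k0 <= k)%N -> forall x, `|x| <= r ->
  cutoff k x = 1 /\ forall i, dcutoff k i x = 0.
Proof.
have [k0 hk0] : exists k0 : nat, \sum_(i < n.+1) r ^+ 2 <= k0%:R.
  by exists (Num.bound (\sum_(i < n.+1) r ^+ 2)); apply: ltW; apply: archi_boundP; apply: sumr_ge0 => i _; exact: sqr_ge0.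
exists k0 => k kk x xr; apply: cutoff1; apply: le_trans (_ : k0%:R <= _); last by rewrite ler_nat.
apply: le_trans hk0; apply: ler_sum => i _; rewrite mxE subr0.
rewrite -real_normK ?num_real // ler_pXn2r ?nnegrE //; last exact: le_trans xr.
exact: le_trans (coord_le_norm _ _) xr.
Qed.

Lemma cutoff_supp k : exists2 rho : R, 0 <= rho & forall x, rho ^+ 2 < qdist 0 x -> cutoff k x = 0.
Proof.
exists (2 * 4 ^+ (k.+1 + k)); first by rewrite mulr_ge0 // exprn_ge0.
move=> x h; rewrite /cutoff big1 ?mulr0 // => m _; apply: (chi0 _).1.
apply: le_trans (ltW h); rewrite exprMn -!natrX -!natrM ler_nat.
apply: (@leq_trans (2 * 4 ^ (k.+1 + k))); first by rewrite leq_mul2l leq_exp2l // leq_add2l -ltnS ltn_ord.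
by apply: leq_mul => //; rewrite leq_pmulr // expn_gt0.
Qed.

Lemma cutoff_adm (D : set V) k : adm D (cutoff k) (dcutoff k).
Proof.
split.
- exact: C1gS (@subsetT _ D) (C1_cutoff k).
- by apply: ext_continuous => x; have [] := C1_cutoff k (x := x) I.
- by move=> i; apply: ext_continuous => x; have [_ /(_ i)[]] := C1_cutoff k (x := x) I.
- have [rho r0 h] := cutoff_supp k; exists rho => x _ xr; apply: h.
  by apply: lt_le_trans (norm_qdist 0 x); rewrite subr0 ltr_pXn2r ?nnegrE.
Qed.

Lemma qdist_enorm (x : V) : qdist 0 x = enorm x ^+ 2.
Proof. by rewrite sqr_enorm; apply: eq_bigr => i _; rewrite mxE subr0. Qed.

Lemma dchi_ibl (D : set V) m : ibl D (fun x => \sum_i dchi m i x ^+ 2).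
Proof.
split.
  apply: lcb_sum => i _; apply: lcbX; apply: lcb_continuous => x.
  by have [_ /(_ i)[]] := C1_chi m (x := x) I.
exists (Num.sqrt (2 * 4 ^+ m)) => x _ h; rewrite big1 // => i _.
rewrite dchi0 ?expr0n //.
apply: le_trans (norm_qdist 0 x); rewrite subr0 -[X in X <= _]sqr_sqrtr ?mulr_ge0 ?exprn_ge0 //.
by rewrite ler_pXn2r ?nnegrE ?sqrtr_ge0 //; exact: ltW.
Qed.

(** The energy of [chi m] is at most [32 * 4 ^- m] times the volume [C * 2 * 4 ^ m], that is [64 C]
    whatever the scale. *)
Lemma cutoff_energy (D : set V) (C : R) : open D -> 0 <= C ->
  (forall r : R, 1 <= r -> (mu (D `&` [set x : V | (enorm x <= r)%R]) <= (C * r ^+ 2)%:E)%E) ->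
  forall k, \int[mu]_(x in D) (\sum_i dcutoff k i x ^+ 2) <= 64 * C / k.+1%:R.
Proof.
move=> oD C0 hC k.
have one m : \int[mu]_(x in D) (\sum_i dchi m i x ^+ 2) <= 64 * C.
  pose r : R := Num.sqrt (2 * 4 ^+ m).
  have r2 : r ^+ 2 = 2 * 4 ^+ m by rewrite sqr_sqrtr // mulr_ge0 // exprn_ge0.
  have r1 : 1 <= r.
    rewrite -(@ler_pXn2r _ 2) ?nnegrE ?sqrtr_ge0 // expr1n r2.
    by have : 1 <= (4 : R) ^+ m by [rewrite exprn_ege1 // ler1n]; lra.
  have h := integral_le_measure oD (measurable_eball r) (hC r r1) _ (dchi_ibl D m) _ _.
  have -> : 64 * C = 32 * 4 ^- m * (C * r ^+ 2).
    by rewrite r2; field; rewrite gt_eqF // exprn_gt0.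
  apply: h; first by rewrite mulr_ge0 // ltW.
    by move=> x _; exact: dchi_sqr.
  move=> x _ /negP; rewrite -ltNge => rx; rewrite big1 // => i _; rewrite dchi0 ?expr0n //.
  rewrite -r2 qdist_enorm ler_pXn2r ?nnegrE ?sqrtr_ge0 //; exact: ltW.
rewrite (eq_int_rV (G := fun x => k.+1%:R^-1 ^+ 2 * \sum_(m < k.+1) \sum_i dchi (k.+1 + m) i x ^+ 2)); last first.
  move=> x _; rewrite exchange_big mulr_sumr; apply: eq_bigr => i _.
  rewrite /dcutoff exprMn; congr (_ * _); apply: sqr_sum_disjoint => a b ab.
  by apply: dchi_disjoint; rewrite eqn_add2l.
have ib (m : 'I_k.+1) : ibl D (fun x => \sum_i dchi (k.+1 + m) i x ^+ 2) by exact: dchi_ibl.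
rewrite int_rVZ //; last by apply: ibl_sum => m _; exact: ib.
rewrite int_rV_sum //.
apply: (@le_trans _ _ (k.+1%:R^-1 ^+ 2 * \sum_(m < k.+1) 64 * C)).
  by rewrite ler_wpM2l ?sqr_ge0 //; apply: ler_sum => m _; exact: one.
rewrite sumr_const card_ord -[64 * C *+ _]mulr_natr expr2.
have := ltr0Sn R k; move: k.+1%:R => K K0.
have -> : K^-1 / K * (64 * C * K) = 64 * C / K by field; rewrite gt_eqF.
by [].
Qed.

End cutoffs.

(** * Directional derivatives are weak null vectors *)

Section liouville.
Context {R : realType} {n : nat}.
Local Notation V := 'rV[R]_n.+1.
Local Notation mu := (@lebesgue_rV R n.+1).
Variables (D : set V) (f f' : R -> R) (u : V -> R) (u1 : 'I_n.+1 -> V -> R)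
  (u2 : 'I_n.+1 -> 'I_n.+1 -> V -> R) (u3 : 'I_n.+1 -> 'I_n.+1 -> 'I_n.+1 -> V -> R).
Hypothesis HS : setup D f f' u u1 u2 u3.
Let oD := s_open HS.
Let c x := f' (u x).

Lemma lcb_c : lcb D c.
Proof.
apply: lcb_comp; first exact: s_f' HS.
by apply: ext_lcb (s_eu HS) => x; exact: cont_in (s_u HS) x.
Qed.

Variables (C M : R).
Hypothesis C0 : 0 <= C.
Hypothesis hC : forall r : R, 1 <= r ->
  (mu (D `&` [set x : V | (enorm x <= r)%R]) <= (C * r ^+ 2)%:E)%E.
Hypothesis hM : forall x, D x -> \sum_i u1 i x ^+ 2 <= M ^+ 2.
Hypothesis hQ : forall g dg, adm D g dg -> 0 <= stabform D c g dg g dg.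

Let lc := lcb_c.

Lemma adm_u1_cutoff i k : adm D (fun x => u1 i x * cutoff k x)
  (fun j x => u2 i j x * cutoff k x + u1 i x * dcutoff k j x).
Proof. exact: adm_mul (s_u1 HS i) (s_eu1 HS i) (s_eu2 HS i) (cutoff_adm D k). Qed.

Lemma sum_Q_u1_cutoff k : \sum_i stabform D c (fun x => u1 i x * cutoff k x)
     (fun j x => u2 i j x * cutoff k x + u1 i x * dcutoff k j x)
     (fun x => u1 i x * cutoff k x) (fun j x => u2 i j x * cutoff k x + u1 i x * dcutoff k j x)
  <= M ^+ 2 * (64 * C) / k.+1%:R.
Proof.
have iQ i := Q_ibl2 oD lc (adm_u1_cutoff i k) (adm_u1_cutoff i k).
have [ie ide] := adm_ibl oD (cutoff_adm D k).
have lu1 i := lcb_u1 HS i; have [le _] := ie.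
have lde i : lcb D (dcutoff k i) by case: (ide i).
rewrite /stabform -int_rV_sum //.
pose th (x : V) : R := cutoff k x * cutoff k x.
pose dth (i : 'I_n.+1) (x : V) : R := dcutoff k i x * cutoff k x + cutoff k x * dcutoff k i x.
have Hth : C1g setT th dth by exact: C1gM (C1_cutoff k) (C1_cutoff k).
have iF : ibl D (fun x => \sum_i u1 i x ^+ 2 * \sum_j dcutoff k j x ^+ 2).
  rewrite (_ : (fun x => _) = fun x => (\sum_j dcutoff k j x ^+ 2) * \sum_i u1 i x ^+ 2); last first.
    by apply/funext => x; rewrite mulr_sumr; apply: eq_bigr => i _; rewrite mulrC.
  apply: iblMl; last by apply: lcb_sum => i _; exact: lcbX.
  apply: ibl_sum => j _; split; first exact: lcbX.
  by apply: (@bsuppX _ _ D _ 1); case: (ide j).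
have iG : ibl D (fun x => \sum_i (dth i x * W u1 u2 i x + th x * dW u1 u2 u3 i i x)).
  apply: ibl_sum => i _; apply: iblD; apply: iblMl; [|exact: lcb_W HS _| |exact: lcb_dW HS _ _].
    by apply: iblD; [exact: iblMl|exact: iblMl].
  exact: iblMl.
(* With [eta = cutoff k], [div_W] turns the integrand into [|grad u| ^ 2 |grad eta| ^ 2 + div (eta ^
   2 W)], whose second term has a nonpositive integral. *)
rewrite (eq_int_rV (G := fun x => (\sum_i u1 i x ^+ 2 * \sum_j dcutoff k j x ^+ 2) +
   \sum_i (dth i x * W u1 u2 i x + th x * dW u1 u2 u3 i i x))); last first.
  move=> x Dx; have E := div_W HS Dx.
  rewrite sumrB [X in _ = _ + X]big_split /= -[X in _ + (_ + X)]mulr_sumr E mulrBr /th /dth.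
  have -> : \sum_i (dcutoff k i x * cutoff k x + cutoff k x * dcutoff k i x) * W u1 u2 i x =
     \sum_i \sum_j 2 * cutoff k x * dcutoff k j x * (u1 i x * u2 i j x).
    rewrite exchange_big /=; apply: eq_bigr => j _; rewrite /W mulr_sumr; apply: eq_bigr => i _.
    ring.
  have -> : cutoff k x * cutoff k x * (f' (u x) * \sum_i u1 i x ^+ 2) =
     \sum_i c x * (u1 i x * cutoff k x * (u1 i x * cutoff k x)).
    by rewrite mulrA mulr_sumr; apply: eq_bigr => i _; rewrite /c; ring.
  rewrite !addrA; congr (_ - _); rewrite mulr_sumr -!big_split /=; apply: eq_bigr => i _.
  rewrite !mulr_sumr -!big_split /=; apply: eq_bigr => j _; ring.
rewrite int_rVD //.
have : \int[mu]_(x in D) (\sum_i (dth i x * W u1 u2 i x + th x * dW u1 u2 u3 i i x)) <= 0.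
  have [rho rho0 h] := cutoff_supp (R := R) (n := n) k.
  apply: (flux_W_le0 HS rho0 Hth) => [x|x xr]; first exact: sqr_ge0.
  by rewrite /th h // mul0r.
suff : \int[mu]_(x in D) (\sum_i u1 i x ^+ 2 * \sum_j dcutoff k j x ^+ 2) <= M ^+ 2 * (64 * C) / k.+1%:R.
  by move=> h1 h2; rewrite -[X in _ <= X]addr0; exact: lerD.
have ie2 : ibl D (fun x => \sum_j dcutoff k j x ^+ 2).
  apply: ibl_sum => j _; split; first exact: lcbX.
  by apply: (@bsuppX _ _ D _ 1); case: (ide j).
apply: (@le_trans _ _ (\int[mu]_(x in D) (M ^+ 2 * \sum_j dcutoff k j x ^+ 2))).
  apply: le_int_rV => //; first exact: iblZ.
  move=> x Dx; rewrite -mulr_suml; apply: ler_wpM2r; last exact: hM.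
  by apply: sumr_ge0 => j _; exact: sqr_ge0.
rewrite int_rVZ // -mulrA; apply: ler_wpM2l; first exact: sqr_ge0.
exact: cutoff_energy.
Qed.

Variable e : 'I_n.+1 -> R.
Definition dirder x := \sum_i e i * u1 i x.
Definition dirder1 j x := \sum_i e i * u2 i j x.
Local Notation v := dirder.
Local Notation v1 := dirder1.

Lemma C1_v : C1g D v v1.
Proof.
apply: (@C1g_sum R n.+1 D _ _ xpredT (fun i x => e i * u1 i x) (fun i j x => e i * u2 i j x)) => i _.
exact: C1gZ (s_u1 HS i).
Qed.

Lemma ext_v : ext D v.
Proof. by apply: ext_sum => i _; apply: extZ; exact: s_eu1 HS i. Qed.

Lemma ext_v1 j : ext D (v1 j).
Proof. by apply: ext_sum => i _; apply: extZ; exact: s_eu2 HS i j. Qed.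

Lemma adm_v_cutoff k : adm D (fun x => v x * cutoff k x) (fun j x => v1 j x * cutoff k x + v x * dcutoff k j x).
Proof. exact: adm_mul C1_v ext_v ext_v1 (cutoff_adm D k). Qed.

Lemma Q_v_cutoff : exists2 B : R, 0 <= B & forall k,
  stabform D c (fun x => v x * cutoff k x) (fun j x => v1 j x * cutoff k x + v x * dcutoff k j x)
   (fun x => v x * cutoff k x) (fun j x => v1 j x * cutoff k x + v x * dcutoff k j x) <= B / k.+1%:R.
Proof.
pose E := \sum_i e i ^+ 2.
have E0 : 0 <= E by apply: sumr_ge0 => i _; exact: sqr_ge0.
exists (2 ^+ size (index_enum 'I_n.+1) * (E * (M ^+ 2 * (64 * C)))).
  by apply: mulr_ge0; [exact: exprn_ge0|apply: mulr_ge0 => //; apply: mulr_ge0; [exact: sqr_ge0|exact: mulr_ge0]].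
move=> k.
pose G i x := e i * (u1 i x * cutoff k x).
pose dG i j x := e i * (u2 i j x * cutoff k x + u1 i x * dcutoff k j x).
have HG i : adm D (G i) (dG i) := admZ (e i) (adm_u1_cutoff i k).
have := Q_sum_le oD lc hQ (index_enum 'I_n.+1) HG.
have -> : stabform D c (fun x => v x * cutoff k x) (fun j x => v1 j x * cutoff k x + v x * dcutoff k j x)
   (fun x => v x * cutoff k x) (fun j x => v1 j x * cutoff k x + v x * dcutoff k j x) =
  stabform D c (fun x => \sum_i G i x) (fun j x => \sum_i dG i j x) (fun x => \sum_i G i x) (fun j x => \sum_i dG i j x).
  have E1 x : v x * cutoff k x = \sum_i G i x.
    by rewrite /dirder /G mulr_suml; apply: eq_bigr => i _; rewrite mulrA.
  have E2 j x : v1 j x * cutoff k x + v x * dcutoff k j x = \sum_i dG i j x.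
    by rewrite /dirder /dirder1 /dG !mulr_suml -big_split; apply: eq_bigr => i _; rewrite mulrDr !mulrA.
  apply: eq_int_rV => x _; rewrite E1; congr (_ - _); apply: eq_bigr => j _.
  by rewrite E2.
move=> h; apply: le_trans h _; rewrite -!mulrA; apply: ler_wpM2l; first exact: exprn_ge0.
apply: (@le_trans _ _ (\sum_i E * stabform D c (fun x => u1 i x * cutoff k x)
     (fun j x => u2 i j x * cutoff k x + u1 i x * dcutoff k j x)
     (fun x => u1 i x * cutoff k x) (fun j x => u2 i j x * cutoff k x + u1 i x * dcutoff k j x))).
  apply: ler_sum => i _.
  have -> : stabform D c (G i) (dG i) (G i) (dG i) = e i ^+ 2 * stabform D c (fun x => u1 i x * cutoff k x)
     (fun j x => u2 i j x * cutoff k x + u1 i x * dcutoff k j x)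
     (fun x => u1 i x * cutoff k x) (fun j x => u2 i j x * cutoff k x + u1 i x * dcutoff k j x).
    rewrite /stabform -int_rVZ //; last exact: Q_ibl2 (adm_u1_cutoff i k) (adm_u1_cutoff i k).
    apply: eq_int_rV => x _; rewrite mulrBr mulr_sumr /G; congr (_ - _); last by ring.
    by apply: eq_bigr => j _; rewrite /dG; ring.
  apply: ler_wpM2r; first exact: hQ (adm_u1_cutoff i k).
  by rewrite /E (bigD1 i) //= lerDl; apply: sumr_ge0 => j _; exact: sqr_ge0.
rewrite -mulr_sumr; apply: ler_wpM2l => //.
by have := sum_Q_u1_cutoff k; rewrite -!mulrA.
Qed.

Lemma cvg_harmonic_scale (B : R) : (fun k => B / k.+1%:R) @ \oo --> (0 : R).
Proof.
rewrite -(mulr0 B); apply: cvgM; first exact: cvg_cst.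
exact: cvg_harmonic.
Qed.

(** Once [cutoff k] is [1] on the support of [h], the value of the form no longer depends on [k],
    while it tends to [0] by [Q_null_limit]. As [h] need not vanish on the frontier, the identity
    also encodes a boundary condition for [v]. *)
Lemma weak_v h dh : adm D h dh -> \int[mu]_(x in D) (\sum_i v1 i x * dh i x - c x * (v x * h x)) = 0.
Proof.
move=> Hh; have [B B0 hB] := Q_v_cutoff.
have lim := Q_null_limit oD lc hQ adm_v_cutoff Hh hB (cvg_harmonic_scale B).
have [Ch _ _ [r hr]] := Hh.
have hdr j : exists r, forall x, D x -> r < `|x| -> dh j x = 0 by exact: bsupp_partial Ch (ex_intro _ r hr).
have /choice[rd hrd] := hdr.
have [k0 hk0] := @cutoff_near R n (`|r| + \sum_j `|rd j|).
apply: (@cvg_unique _ _ ((fun k => stabform D c (fun x => v x * cutoff k x)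
  (fun j x => v1 j x * cutoff k x + v x * dcutoff k j x) h dh) @ \oo)) => //.
apply: cvg_near_cst; exists k0 => // k /= kk; apply/eqP; rewrite eq_sym; apply/eqP.
apply: eq_int_rV => x Dx.
have [xr|xr] := leP `|x| (`|r| + \sum_j `|rd j|).
  have [-> dE] := hk0 k kk x xr; congr (_ - _); last by rewrite !mulr1.
  by apply: eq_bigr => j _; rewrite dE mulr0 addr0 mulr1.
have s0 : 0 <= \sum_j `|rd j| by exact: sumr_ge0.
rewrite hr //; last by apply: le_lt_trans xr; apply: le_trans (ler_norm _) _; rewrite lerDl.
rewrite !mulr0 !subr0 !big1 // => j _; rewrite hrd ?mulr0 //;
 apply: le_lt_trans xr; apply: le_trans (ler_norm _) _; rewrite (bigD1 j) //= addrCA lerDl addr_ge0 // sumr_ge0 //.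
Qed.

(** The equation is tested in very weak form, with no derivative of [|v|]. The C1 approximations
    [wk v (ka k)], multiplied by the cutoffs, still have energies tending to [0]; integrating by
    parts puts the derivatives on [psi], with no boundary term since [psi] vanishes off the closed
    set [K] inside [D]; then [ka k] tends to [0] by dominated convergence. *)
Lemma weak_abs_v (K : set V) (r : R) psi psi1 psi2 : closed K -> K `<=` D ->
  (forall x, K x -> `|x| <= r) ->
  C1g setT psi psi1 -> (forall i, C1g setT (psi1 i) (psi2 i)) ->
  (forall x, ~ K x -> [/\ psi x = 0, forall i, psi1 i x = 0 & forall i j, psi2 i j x = 0]) ->
  \int[mu]_(x in D) (`|v x| * (- (\sum_i psi2 i i x) - c x * psi x)) = 0.
Proof.
move=> cK KD Kr H1 H2 H0.
have out x : r < `|x| -> ~ K x by move=> h /Kr; rewrite leNgt h.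
have c0 : continuous psi by move=> x; have [] := H1 x I.
have c1 i : continuous (psi1 i) by move=> x; have [] := H2 i x I.
have c2 i j : continuous (psi2 i j) by move=> x; have [_ /(_ j)[]] := H2 i x I.
have i0 : ibl D psi.
  by split; [exact: lcb_continuous|exists r => x _ /out /H0[]].
have i1 i : ibl D (psi1 i).
  by split; [exact: lcb_continuous|exists r => x _ /out /H0[_ ->]].
have i2 i j : ibl D (psi2 i j).
  by split; [exact: lcb_continuous|exists r => x _ /out /H0[_ _ ->]].
have aP : adm D psi psi1.
  split; [exact: C1gS (@subsetT _ D) H1|exact: ext_continuous|by move=> i; exact: ext_continuous|by case: i0].
pose Z k := stabform D c (cutoff k) (dcutoff k) (cutoff k) (dcutoff k).
have Z0 k : 0 <= Z k by exact: hQ (cutoff_adm D k).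
(* However large [Z k] is, [ka k ^ 2 * Z k] and [ka k] are both at most [1 / (k + 1)]. *)
pose ka k : R := ((1 + Z k) * k.+1%:R)^-1.
have K1 (k : nat) : 1 <= k.+1%:R :> R by rewrite ler1n.
have ka0 k : 0 < ka k.
  by rewrite invr_gt0 mulr_gt0 // ltr_wpDr.
have kaK k : ka k <= k.+1%:R^-1.
  rewrite lef_pV2 ?posrE // ?ltr_peMl //; last by rewrite mulr_gt0 // ltr_wpDr.
  by rewrite ler_peMl // lerDl.
have ka1 k : ka k <= 1 by apply: le_trans (kaK k) _; rewrite invf_le1.
have kaZ k : ka k ^+ 2 * Z k <= k.+1%:R^-1.
  rewrite expr2 -mulrA; apply: (@le_trans _ _ (1 * k.+1%:R^-1)); last by rewrite mul1r.
  apply: ler_pM => //; [exact: ltW|by rewrite mulr_ge0 // ltW|].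
  rewrite /ka invfM mulrAC -[X in _ <= X]mul1r; apply: ler_wpM2r; first by rewrite invr_ge0.
  by rewrite mulrC ler_pdivrMr ?mul1r ?lerDr // ltr_wpDr.
pose w k := wk v (ka k); pose dw k := dwk v v1 (ka k).
have Hw k : C1g D (w k) (dw k) := C1_wk (ka0 k) C1_v.
have aG k : adm D (fun x => w k x * cutoff k x) (fun i x => dw k i x * cutoff k x + w k x * dcutoff k i x).
  have [e1 e2] := ext_wk (ka0 k) ext_v ext_v1.
  exact: adm_mul (Hw k) e1 e2 (cutoff_adm D k).
have [B B0 hB] := Q_v_cutoff.
have Gle k : stabform D c (fun x => w k x * cutoff k x) (fun i x => dw k i x * cutoff k x + w k x * dcutoff k i x)
    (fun x => w k x * cutoff k x) (fun i x => dw k i x * cutoff k x + w k x * dcutoff k i x)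
   <= (B + 1) / k.+1%:R.
  apply: le_trans (Q_wk_le oD lc (ka0 k) C1_v ext_v ext_v1 (cutoff_adm D k)) _.
  by rewrite mulrDl mul1r; apply: lerD; [exact: hB|exact: kaZ].
have lim0 := Q_null_limit oD lc hQ aG aP Gle (cvg_harmonic_scale (B + 1)).
pose H x : R := - (\sum_i psi2 i i x) - c x * psi x.
have iH : ibl D H.
  by apply: iblB; [apply: iblN; apply: ibl_sum => i _|exact: iblMr].
have lw k : lcb D (w k).
  have [e1 _] := ext_wk (ka0 k) ext_v ext_v1.
  by apply: ext_lcb e1 => x; exact: cont_in (Hw k) x.
have ldw k i : lcb D (dw k i).
  have [_ e2] := ext_wk (ka0 k) ext_v ext_v1.
  by apply: ext_lcb (e2 i) => x Dx; have [_ /(_ i)[]] := Hw k x Dx.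
have lv : lcb D v by apply: ext_lcb ext_v => x; exact: cont_in C1_v x.
have lim1 : (fun k => \int[mu]_(x in D) (w k x * H x)) @ \oo --> \int[mu]_(x in D) (`|v x| * H x).
  apply: (@dominated_cvg_rV R n.+1 D _ _ (fun x => (`|v x| + 1) * `|H x|) oD).
  - by move=> k; exact: iblMr.
  - by apply: iblMr => //; exact: lcb_abs.
  - by apply: iblMr; [apply: lcbD; [exact: lcb_abs|exact: lcb_cst]|exact: ibl_abs].
  - move=> k x Dx; rewrite normrM; apply: ler_wpM2r => //.
    have /andP[_ h] := wk_bounds v x (ka0 k); rewrite gtr0_norm; last exact: wk_gt0.
    by apply: le_trans h _; rewrite lerD2l.
  move=> x Dx; apply: cvgM; last exact: cvg_cst.
  apply: (@squeeze_cvgr _ _ _ _ (fun=> `|v x|) (fun k => `|v x| + 1 / k.+1%:R)).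
  - apply: nearW => k; have /andP[h1 h2] := wk_bounds v x (ka0 k); rewrite h1 /=.
    by apply: le_trans h2 _; rewrite lerD2l mul1r.
  - exact: cvg_cst.
  rewrite -[X in _ --> X]addr0; apply: cvgD; first exact: cvg_cst.
  exact: cvg_harmonic_scale.
have [k0 hk0] := @cutoff_near R n r.
have E k : (k0 <= k)%N -> stabform D c (fun x => w k x * cutoff k x)
    (fun i x => dw k i x * cutoff k x + w k x * dcutoff k i x) psi psi1 = \int[mu]_(x in D) (w k x * H x).
  move=> kk.
  pose dF i l x := dw k l x * psi1 i x + w k x * psi2 i l x.
  have HF i : C1g setT (fun x => w k x * psi1 i x) (dF i).
    apply: (C1g_glue cK KD).
    - exact: C1gM (Hw k) (C1gS (@subsetT _ D) (H2 i)).
    - by move=> x /H0[_ -> _]; rewrite mulr0.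
    - by move=> l x /H0[_ h1 h2]; rewrite /dF h1 h2 !mulr0 addr0.
  have idF i : ibl D (dF i i) by apply: iblD; apply: iblMr.
  have F0 i : \int[mu]_(x in D) dF i i x = 0.
    apply: (@int_partial0 R n.+1 D K i (fun x => w k x * psi1 i x) _ oD cK KD).
    - by move=> x; have [_ /(_ i)[]] := HF i x I.
    - by move=> x; have [_ /(_ i)[]] := HF i x I.
    - by move=> x /H0[_ -> _]; rewrite mulr0.
    - by exists r => x _ /out /H0[_ -> _]; rewrite mulr0.
  transitivity (\int[mu]_(x in D) (\sum_i dF i i x + w k x * H x)).
    apply: eq_int_rV => x Dx; have [xr|/out /H0[p0 p1 p2]] := leP `|x| r; last first.
      have -> : \sum_i dF i i x = 0 by rewrite big1 // => i _; rewrite /dF p1 p2 !mulr0 addr0.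
      have -> : \sum_i (dw k i x * cutoff k x + w k x * dcutoff k i x) * psi1 i x = 0.
        by rewrite big1 // => i _; rewrite p1 mulr0.
      have S0 : \sum_i psi2 i i x = 0 by rewrite big1 // => i _; exact: p2.
      by rewrite /H p0 S0 !mulr0 oppr0 !addr0 mulr0 addr0.
    have [-> dE] := hk0 k kk x xr; rewrite /H mulrBr mulrN mulr_sumr addrA -sumrB.
    congr (_ - _); last by ring.
    by apply: eq_bigr => i _; rewrite dE /dF; ring.
  rewrite int_rVD //; [|by apply: ibl_sum => i _|exact: iblMr].
  by rewrite int_rV_sum // big1 ?add0r // => i _; exact: F0.
apply: (@cvg_unique _ _ ((fun k => \int[mu]_(x in D) (w k x * H x)) @ \oo)) => //.
apply: cvg_trans lim0; apply: near_eq_cvg; by exists k0.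
Qed.

End liouville.

(** * The barrier *)

Lemma is_derive_congr (R : realType) (V : normedModType R) (f g : V -> R) (x v : V) (d d' : R) :
  is_derive x v f d -> (forall y, f y = g y) -> d = d' -> is_derive x v g d'.
Proof. by move=> h e <-; exact: is_derive_ext h. Qed.

Section inverse_power.
Context {R : realType} (N : nat).
Implicit Types s t : R.

(* [spow s = s ^ (- (2 N + 1) / 4)], slightly more singular than the radial derivative
   of the fundamental solution written as a function of [s = |x|^2]. *)
Definition pexp : R := (2 * N%:R + 1) / 4.
Definition spow s : R := expR (- pexp * ln s).
Definition spow_prim s : R := s * spow s / (pexp - 1).

Lemma pexp_gt0 : 0 < pexp. Proof. by rewrite /pexp divr_gt0 // ltr_wpDl // mulr_ge0. Qed.

(** By parity, [2 N] cannot be [3]. Hence the antiderivative [spow_prim] is never logarithmic. *)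
Lemma pexp_neq1 : pexp - 1 != 0.
Proof.
apply/eqP => h; have : 2 * N%:R = 3 :> R by move: h; rewrite /pexp; lra.
by move/eqP; rewrite -natrM eqr_nat => /eqP h'; move: (congr1 odd h'); rewrite mul2n odd_double.
Qed.

Lemma spow_gt0 s : 0 < spow s. Proof. exact: expR_gt0. Qed.

Lemma is_derive_spow s : 0 < s -> is_derive s 1 spow (- (pexp * spow s / s)).
Proof.
move=> s0; have h1 := is_derive1_ln s0.
have h2 : is_derive s 1 (fun s => - pexp * ln s) (- pexp * s^-1).
  by have := @is_deriveZ R R R (@ln R) (- pexp) s 1 _ h1.
have h3 := @is_derive1_comp R expR (fun s => - pexp * ln s) s _ _ (is_derive_expR _) h2.
by apply: (is_derive_congr h3) => //; rewrite /spow; ring.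
Qed.

Lemma is_derive_spow_prim s : 0 < s -> is_derive s 1 spow_prim (- spow s).
Proof.
move=> s0; have h1 := is_derive_spow s0.
have h2 := @is_deriveM R R id spow s 1 _ _ (is_derive_id s 1) h1.
have h3 := @is_deriveZ R R R (id * spow) (pexp - 1)^-1 s 1 _ h2.
apply: (is_derive_congr h3) => [t|]; first by rewrite /spow_prim [RHS]mulrC.
by rewrite /GRing.scale /=; field; rewrite gt_eqF //= pexp_neq1.
Qed.

Lemma spow_le s t : 0 < s -> s <= t -> spow t <= spow s.
Proof.
move=> s0 st; rewrite ler_expR !mulNr lerN2; apply: ler_wpM2l; first exact: ltW pexp_gt0.
by rewrite ler_ln ?posrE // (lt_le_trans s0).
Qed.

Lemma spow_ge1 s : 0 < s -> s <= 1 -> 1 <= spow s.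
Proof.
move=> s0 s1; rewrite -expR0 ler_expR mulNr oppr_ge0; apply: mulr_ge0_le0; first exact: ltW pexp_gt0.
exact: ln_le0.
Qed.

(** At a fourth power the exponent [(2 N + 1) / 4] becomes an integer, so that the final estimate
    only involves integer powers. *)
Lemma spow_pow4 t : 0 < t -> spow (t ^+ 4) = t ^- (2 * N + 1).
Proof.
move=> t0; rewrite /spow lnXn //.
have -> : - pexp * (ln t *+ 4) = - (ln t *+ (2 * N + 1)).
  rewrite -mulr_natr -(mulr_natr (ln t)) natrD natrM /pexp; by field.
by rewrite expRN -mulr_natl expRM_natl lnK // posrE.
Qed.

Lemma spow_prim_diff s t : 0 < s -> s <= t -> (t - s) * spow t <= spow_prim s - spow_prim t <= (t - s) * spow s.
Proof.
move=> s0 st.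
have d0 x : x \in `]s, t[ -> is_derive x 1 spow_prim (- spow x).
  by rewrite in_itv => /andP[h _]; apply: is_derive_spow_prim; exact: lt_trans h.
have c0 : {within `[s, t], continuous spow_prim}.
  apply: continuous_in_subspaceT => x; rewrite inE /= in_itv => /andP[h _].
  exact: is_derive_continuous1 (is_derive_spow_prim (lt_le_trans s0 h)).
have [k +] := @MVT_segment R spow_prim (fun x => - spow x) s t st d0 c0.
rewrite in_itv /= => /andP[sk kt] E1.
have -> : spow_prim s - spow_prim t = (t - s) * spow k by rewrite -opprB E1; ring.
by apply/andP; split; apply: ler_wpM2l; rewrite ?subr_ge0 //; apply: spow_le => //; exact: lt_le_trans sk.
Qed.

Variables (S0 a : R).
Hypothesis a0 : 0 < a.

(** A primitive of the singular profile, normalized to vanish where [t + a = S0]. The shift [a > 0]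
    removes the singularity at [t = 0], and composing with [ramp] truncates it to [0] beyond [S0]
    while keeping two continuous derivatives. *)
Definition barrier_arg t : R := spow_prim (t + a) - spow_prim S0.
Definition barrier_fun t := ramp (barrier_arg t).
Definition barrier_fun' t := - (ramp' (barrier_arg t) * spow (t + a)).
Definition barrier_fun'' t := ramp'' (barrier_arg t) * spow (t + a) ^+ 2 + ramp' (barrier_arg t) * (pexp * spow (t + a) / (t + a)).

Lemma is_derive_shiftD (h : R -> R) (t d : R) : is_derive (t + a) 1 h d -> is_derive t 1 (fun t => h (t + a)) d.
Proof.
move=> H; have -> : (fun t => h (t + a)) = (fun t => h (t - (- a))) by apply/funext => x; rewrite opprK.
by apply: is_derive_shift1; rewrite opprK.
Qed.

Lemma is_derive_barrier_arg t : 0 <= t -> is_derive t 1 barrier_arg (- spow (t + a)).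
Proof.
move=> t0; have h := is_derive_shiftD (is_derive_spow_prim (ltr_wpDl t0 a0)).
have := @is_deriveB R R R _ _ t 1 _ _ h (is_derive_cst (spow_prim S0) t 1).
by rewrite subr0.
Qed.

Lemma is_derive_barrier_fun t : 0 <= t -> is_derive t 1 barrier_fun (barrier_fun' t).
Proof.
move=> t0; have := @is_derive1_comp R ramp barrier_arg t _ _ (is_derive_ramp _) (is_derive_barrier_arg t0).
by move=> /is_derive_congr; apply=> //; rewrite /barrier_fun'; ring.
Qed.

Lemma is_derive_barrier_fun' t : 0 <= t -> is_derive t 1 barrier_fun' (barrier_fun'' t).
Proof.
move=> t0; have h1 := @is_derive1_comp R ramp' barrier_arg t _ _ (is_derive_ramp' _) (is_derive_barrier_arg t0).
have h2 := is_derive_shiftD (is_derive_spow (ltr_wpDl t0 a0)).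
have h3 := @is_deriveM R R _ _ t 1 _ _ h1 h2.
have h4 := @is_deriveN R R R _ t 1 _ h3.
by apply: (is_derive_congr h4) => //; rewrite /barrier_fun'' /GRing.scale /=; ring.
Qed.

Lemma barrier_fun''_continuous t : 0 <= t -> {for t, continuous barrier_fun''}.
Proof.
move=> t0; have ta : 0 < t + a by exact: ltr_wpDl.
have cg := is_derive_continuous1 (is_derive_barrier_arg t0).
have cE := is_derive_continuous1 (is_derive_shiftD (is_derive_spow ta)).
have cP2 : {for t, continuous (fun t => ramp'' (barrier_arg t))}.
  by apply: continuous_comp => //; exact: ramp''_continuous.
have cP1 : {for t, continuous (fun t => ramp' (barrier_arg t))}.
  by apply: continuous_comp => //; exact: is_derive_continuous1 (is_derive_ramp' _).
have ci : {for t, continuous (fun t => (t + a)^-1)}.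
  apply: continuousV; first by rewrite gt_eqF.
  exact: is_derive_continuous1 (is_derive_shiftD (is_derive_id (t + a) 1)).
apply: (@continuousD R R R (fun t => ramp'' (barrier_arg t) * spow (t + a) ^+ 2)); apply: continuousM => //.
  by rewrite (_ : (fun t => _) = fun t => spow (t + a) * spow (t + a)); [apply: continuousM|apply/funext => z; rewrite expr2].
apply: (@continuousM R R (fun t => pexp * spow (t + a))) => //.
by apply: (@continuousM R R (cst pexp)) => //; exact: cst_continuous.
Qed.

Lemma barrier_arg_bounds t : 0 <= t -> 0 < S0 -> [/\ barrier_arg t <= S0 * spow (t + a),
  S0 <= t + a -> barrier_arg t <= 0 & t + a <= S0 -> (S0 - (t + a)) * spow S0 <= barrier_arg t].
Proof.
move=> t0 S00; have ta : 0 < t + a by exact: ltr_wpDl.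
have h1 : S0 <= t + a -> barrier_arg t <= 0.
  move=> h; have /andP[+ _] := spow_prim_diff S00 h.
  by rewrite /barrier_arg => h2; have := spow_gt0 (t + a); nra.
split=> //.
  have [h|h] := leP S0 (t + a).
    by apply: le_trans (h1 h) _; rewrite mulr_ge0 ?ltW // spow_gt0.
  have /andP[_ h2] := spow_prim_diff ta (ltW h); apply: le_trans h2 _.
  by apply: ler_wpM2r; [exact: ltW (spow_gt0 _)|lra].
by move=> h; have /andP[] := spow_prim_diff ta h.
Qed.

End inverse_power.

Section barrier_function.
Context {R : realType} {n : nat}.
Local Notation V := 'rV[R]_n.+1.
Variables (y : V) (S0 a : R).
Hypothesis a0 : 0 < a.
Hypothesis S00 : 0 < S0.
Local Notation N := n.+1.

Definition psi x : R := barrier_fun N S0 a (qdist y x).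
Definition psi1 (i : 'I_N) x : R := barrier_fun' N S0 a (qdist y x) * (2 * (x ord0 i - y ord0 i)).
Definition psi2 (i j : 'I_N) x : R := barrier_fun'' N S0 a (qdist y x) * (2 * (x ord0 j - y ord0 j)) * (2 * (x ord0 i - y ord0 i))
  + barrier_fun' N S0 a (qdist y x) * (2 * (j == i)%:R).

Lemma C1_psi : C1g setT psi psi1.
Proof.
apply: (C1g_comp (@C1g_qdist R N y setT)) => x _; split; first by apply: is_derive_barrier_fun => //; exact: qdist_ge0.
by apply: (@is_derive_continuous1 _ _ _ (barrier_fun'' N S0 a (qdist y x))); apply: is_derive_barrier_fun' => //; exact: qdist_ge0.
Qed.

Lemma C1_psi1 i : C1g setT (psi1 i) (psi2 i).
Proof.
have H1 : C1g setT (fun x : V => 2 * (x ord0 i - y ord0 i)) (fun j _ => 2 * (j == i)%:R).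
  apply: C1gZ; apply: (C1g_ext _ _ (C1gB (@C1g_coord R N setT i) (@C1g_cst R N setT (y ord0 i)))) => // j x.
  by rewrite subr0.
apply: C1gM H1; apply: (C1g_comp (@C1g_qdist R N y setT)) => x _.
by split; [apply: is_derive_barrier_fun'|apply: barrier_fun''_continuous] => //; exact: qdist_ge0.
Qed.

Lemma psi_outside x : S0 <= qdist y x -> [/\ psi x = 0, forall i, psi1 i x = 0 & forall i j, psi2 i j x = 0].
Proof.
move=> h; have [_ /(_ (le_trans h (ltW _)))g0 _] := barrier_arg_bounds N a0 (qdist_ge0 y x) S00.
have {}g0 := g0 (ltac:(by rewrite ltrDl)).
have [p0 p1] := ramp_le0 g0.
have p2 : ramp'' (barrier_arg N S0 a (qdist y x)) = 0.
  by rewrite /ramp'' pos_nonpos // addr0 invr1 !expr1n; ring.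
have P1 : barrier_fun' N S0 a (qdist y x) = 0 by rewrite /barrier_fun' p1 mul0r oppr0.
split=> [|i|i j]; first exact: p0.
  by rewrite /psi1 P1 mul0r.
have P2 : barrier_fun'' N S0 a (qdist y x) = 0 by rewrite /barrier_fun'' p1 p2 !mul0r addr0.
by rewrite /psi2 P1 P2 !mul0r addr0.
Qed.

(** The radial Laplacian [4 q b'' + 2 N b'] with [q = qdist y x]. Since [4 pexp = 2 N + 1], the
    exponent leaves an excess of [1] over [2 N], a term of good sign; the shift [a] spoils it only
    where [q] is of order [a]. *)
Lemma lap_psi x : \sum_i psi2 i i x = ramp'' (barrier_arg N S0 a (qdist y x)) * spow N (qdist y x + a) ^+ 2 * (4 * qdist y x)
   + ramp' (barrier_arg N S0 a (qdist y x)) * spow N (qdist y x + a) * (1 - (2 * N%:R + 1) * a / (qdist y x + a)).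
Proof.
have q0 := qdist_ge0 y x; have qa : 0 < qdist y x + a by exact: ltr_wpDl.
rewrite /psi2 big_split /= (eq_bigr (fun i => barrier_fun'' N S0 a (qdist y x) * 4 * (x ord0 i - y ord0 i) ^+ 2)); last first.
  by move=> i _; ring.
rewrite -mulr_sumr -/(qdist y x) (eq_bigr (fun=> barrier_fun' N S0 a (qdist y x) * 2)); last first.
  by move=> i _; rewrite eqxx mulr1.
rewrite sumr_const card_ord -[_ *+ N]mulr_natr /barrier_fun' /barrier_fun'' /pexp.
by field; rewrite gt_eqF.
Qed.

(** [psi] is a strict subsolution near [y], except where [qdist] is of order [a]. The two factors
    [1 - sstep] are continuous stand-ins for the indicators of [x1 <= S0 / 2] and of that
    exceptional region. *)
Lemma barrier_lower (L x1 : R) (x : V) : S0 <= 1 -> 0 <= L -> 4 * (L * S0) <= 1 -> a <= S0 / 4 ->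
  x1 = qdist y x -> S0 > x1 ->
  (1 - (1 + S0 / 4)^-1) ^+ 2 / 2 * (1 - sstep (4 / S0 * x1))
    - (2 * N%:R + 2) * spow N a * (1 - sstep (x1 / (4 * (2 * N%:R + 1) * a)))
  <= \sum_i psi2 i i x - L * psi x.
Proof.
move=> S01 L0 LS aS qE qS; rewrite lap_psi -qE.
have q0 : 0 <= x1 by rewrite qE; exact: qdist_ge0.
have s0 : 0 < x1 + a by exact: ltr_wpDl.
have [gle gnp gge] := barrier_arg_bounds N a0 q0 S00.
have Es := spow_gt0 N (x1 + a).
rewrite /psi -qE /barrier_fun; set g := barrier_arg N S0 a x1 in gle gnp gge *.
have [P0 P10 P11 P20 PP1] := ramp_bounds g.
have n1 : (0 : R) < 2 * N%:R + 1 by rewrite ltr_wpDl // mulr_ge0.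
have posg : pos g <= S0 * spow N (x1 + a).
  by rewrite /pos ge_max gle mulr_ge0 // ltW.
have [sa1 _ _] := sstep_cases (4 / S0 * x1).
have [sb1 _ _] := sstep_cases (x1 / (4 * (2 * N%:R + 1) * a)).
set h := sstep (4 / S0 * x1) in sa1 *; set k := sstep (x1 / _) in sb1 *.
have ka1 : (1 - (1 + S0 / 4)^-1) ^+ 2 <= 1.
  have i0 : 0 <= (1 + S0 / 4)^-1 by rewrite invr_ge0; lra.
  have i1 : (1 + S0 / 4)^-1 <= 1 by rewrite invf_le1; lra.
  by rewrite expr_le1 //; lra.
have ka0 : 0 <= (1 - (1 + S0 / 4)^-1) ^+ 2 by exact: sqr_ge0.
set ka : R := (1 - (1 + S0 / 4)^-1) ^+ 2 in ka0 ka1 *.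
pose rr := (2 * N%:R + 1) * a / (x1 + a).
rewrite -/rr.
(* The zeroth order term is absorbed: [ramp g <= pos g * ramp' g] and [pos g <= S0 * spow] give
   [L psi <= ramp' g * spow / 4], which lowers [1] to [3 / 4]. *)
have base : ramp' g * spow N (x1 + a) * (3 / 4 - rr) <=
   ramp'' g * spow N (x1 + a) ^+ 2 * (4 * x1) + ramp' g * spow N (x1 + a) * (1 - rr) - L * ramp g.
  have t1 : 0 <= ramp'' g * spow N (x1 + a) ^+ 2 * (4 * x1).
    apply: mulr_ge0; last exact: mulr_ge0.
    by apply: mulr_ge0 => //; exact: sqr_ge0.
  have t2 : L * ramp g <= ramp' g * spow N (x1 + a) / 4.
    apply: (@le_trans _ _ (L * (S0 * spow N (x1 + a) * ramp' g))).
      apply: ler_wpM2l => //; apply: le_trans PP1 _; exact: ler_wpM2r.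
    have -> : L * (S0 * spow N (x1 + a) * ramp' g) = (4 * (L * S0)) * (ramp' g * spow N (x1 + a) / 4) by field.
    by rewrite ler_piMl // divr_ge0 // mulr_ge0 // ltW.
  lra.
apply: le_trans base.
have rr0 : 0 <= rr by rewrite divr_ge0 ?mulr_ge0 // ltW.
(* In the first case [rr <= 1 / 4], and half of the good term survives; in the second, everything is
   charged to [spow N a]. *)
have [big|small] := leP (4 * (2 * N%:R + 1) * a) x1.
  have r4 : rr <= 1 / 4.
    rewrite /rr ler_pdivrMr //; apply: (@le_trans _ _ (x1 / 4)); first by rewrite ler_pdivlMr // mulrC mulrA.
    by rewrite mul1r mulrC ler_pM2l ?invr_gt0 // lerDl ltW.
  apply: (@le_trans _ _ (ramp' g * spow N (x1 + a) / 2)); last first.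
    by apply: ler_wpM2l; [by rewrite mulr_ge0 // ltW|lra].
  apply: (@le_trans _ _ (ka / 2 * (1 - h))).
    rewrite lerBlDr lerDl; apply: mulr_ge0; last by lra.
    by apply: mulr_ge0; [lra|exact: ltW (spow_gt0 _ _)].
  have [xS|xS] := leP (2 * x1) S0; last first.
    have -> : h = 1.
      apply: (sstep1 _).1; rewrite mulrAC ler_pdivlMr //; lra.
    by rewrite subrr mulr0 divr_ge0 // mulr_ge0 // ltW.
  have sS : x1 + a <= S0 by lra.
  have ES1 : 1 <= spow N S0 by exact: spow_ge1.
  have Es1 : 1 <= spow N (x1 + a) by apply: spow_ge1 => //; lra.
  have gS : S0 / 4 <= g.
    apply: le_trans (gge sS); apply: (@le_trans _ _ ((S0 - (x1 + a)) * 1)); first by lra.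
    by apply: ler_wpM2l => //; lra.
  have := @ramp'_lower R (S0 / 4) g (ltac:(lra)) gS; rewrite -/ka => kg.
  have : ka * 1 <= ramp' g * spow N (x1 + a) by apply: ler_pM.
  have : ka * (1 - h) <= ka by rewrite ler_piMr //; lra.
  lra.
have -> : k = 0.
  apply: (sstep0 _).1; rewrite ler_pdivrMr ?mul1r; first exact: ltW.
  by rewrite mulr_gt0 // mulr_gt0.
have EE : spow N (x1 + a) <= spow N a by apply: spow_le => //; lra.
have Ea1 : 1 <= spow N a by apply: spow_ge1 => //; lra.
have r1 : rr <= 2 * N%:R + 1.
  by rewrite /rr ler_pdivrMr // ler_pM2l // lerDr.
have : ka / 2 * (1 - h) <= 1.
  case/andP: sa1 => h0 h1; move: ka0 ka1 h0 h1; move: ka h => k1 h1; nra.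
have : ramp' g * spow N (x1 + a) * rr <= 1 * spow N a * (2 * N%:R + 1).
  apply: ler_pM => //; first by rewrite mulr_ge0 // ltW.
  by apply: ler_pM => //; exact: ltW.
have : 0 <= ramp' g * spow N (x1 + a) by rewrite mulr_ge0 // ltW.
rewrite subr0 mulr1 mul1r; move: (spow N a) (ramp' g * _) Ea1 => Ea pe Ea1 p1 p2 p3.
have : pe * (3 / 4 - rr) = 3 / 4 * pe - pe * rr by ring.
move: (ka / 2 * _) p3 => z p3 ->.
move: (N%:R : R) p2 => m p2; lra.
Qed.

End barrier_function.

Lemma barrier_arith (R : realType) (k w h sm cp e ch K : R) :
  w * (k / 2 * h - e * ch) <= w * (sm + cp) -> e * (w * ch) <= K ->
  k / 2 * (w * h) + w * (- sm - cp) <= K.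
Proof. lra. Qed.

Section barrier.
Context {R : realType} {n : nat}.
Local Notation V := 'rV[R]_n.+1.
Local Notation mu := (@lebesgue_rV R n.+1).

Lemma qdist_bsupp (D : set V) (y : V) (t : R) (F : V -> R) : (forall x, t <= qdist y x -> F x = 0) -> bsupp D F.
Proof.
move=> h; exists (`|y| + (`|t| + 1)) => x _ xr; apply: h.
have h1 : `|t| + 1 < `|x - y|.
  have : `|x| <= `|x - y| + `|y| by rewrite -{1}[x](subrK y); exact: ler_normD.
  lra.
apply: le_trans (norm_qdist y x); apply: le_trans (ler_norm t) _.
have t0 : 0 <= `|t| by [].
by nra.
Qed.

Lemma step_qdist_continuous (y : V) (al : R) : continuous (fun x => 1 - sstep (al * qdist y x)).
Proof.
have H := C1gB (@C1g_cst R n.+1 setT 1) (@C1g_comp R n.+1 setT _ _ sstep sstep'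
  (C1gZ al (@C1g_qdist R n.+1 y setT)) (fun x _ => conj (is_derive_sstep _) (@sstep'_continuous R _))).
by move=> x; have [] := H x I.
Qed.

Lemma qdist_self (y : V) : qdist y y = 0.
Proof. by rewrite /qdist big1 // => i _; rewrite subrr expr0n. Qed.

(* Testing [- Laplace w - c w >= 0] against the truncated singular function [psi], the
   error made near [y], where [w = O(|x - y|)], vanishes as the regularization [a -> 0]. *)
Lemma barrier (D : set V) (w c : V -> R) (y : V) (C L rho r : R) :
  open D -> lcb D w -> lcb D c -> 0 < r -> 0 < rho -> 0 <= C -> 0 <= L ->
  (forall x, D x -> 0 <= w x) -> (forall x, D x -> `|x - y| <= r -> w x <= C * `|x - y|) ->
  (forall x, D x -> `|x - y| <= r -> `|c x| <= L) ->
  (forall p (p1 : 'I_n.+1 -> V -> R) (p2 : 'I_n.+1 -> 'I_n.+1 -> V -> R), C1g setT p p1 -> (forall i, C1g setT (p1 i) (p2 i)) ->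
    (forall x, rho ^+ 2 <= qdist y x -> [/\ p x = 0, forall i, p1 i x = 0 & forall i j, p2 i j x = 0]) ->
    \int[mu]_(x in D) (w x * (- (\sum_i p2 i i x) - c x * p x)) = 0) ->
  exists2 d : R, 0 < d & forall x, D x -> `|x - y| < d -> w x = 0.
Proof.
move=> oD lw lc r0 rho0 C0 L0 w0 wC cL weak.
(* [S0 <= 1] gives [spow >= 1] on the support; [rho] and [r] keep the support of [psi] where the
   hypotheses hold; the last entry gives [4 L S0 <= 1]. *)
pose S0 : R := Num.min (Num.min 1 (rho ^+ 2)) (Num.min (r ^+ 2) (4 * (L + 1))^-1).
have L1 : 0 < 4 * (L + 1) by lra.
have S00 : 0 < S0 by rewrite !lt_min ltr01 !exprn_gt0 // invr_gt0.
have S01 : S0 <= 1 by rewrite !ge_min lexx.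
have Srho : S0 <= rho ^+ 2 by rewrite !ge_min lexx orbT.
have Sr : S0 <= r ^+ 2 by rewrite !ge_min lexx orbT.
have LS : 4 * (L * S0) <= 1.
  have : S0 <= (4 * (L + 1))^-1 by rewrite !ge_min lexx !orbT.
  rewrite -[_^-1]mul1r ler_pdivlMr // => h.
  by nra.
pose b : R := 4 * (2 * n.+1%:R + 1).
have n1 : (0 : R) < n.+1%:R by [].
have b4 : 4 <= b by rewrite /b; lra.
pose ka : R := (1 - (1 + S0 / 4)^-1) ^+ 2.
have ka0 : 0 < ka.
  by rewrite exprn_gt0 // subr_gt0 invf_lt1; lra.
pose h x := 1 - sstep (4 / S0 * qdist y x).
have ch : continuous h by exact: step_qdist_continuous.
have h0 x : S0 / 2 <= qdist y x -> h x = 0.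
  move=> hx; rewrite /h (sstep1 _).1 ?subrr // mulrAC ler_pdivlMr //; lra.
have ih : ibl D h by split; [exact: lcb_continuous|exact: qdist_bsupp h0].
have hb x : 0 <= h x <= 1.
  by have [+ _ _] := sstep_cases (4 / S0 * qdist y x); rewrite /h => /andP[? ?]; apply/andP; split; lra.
have iwh : ibl D (fun x => w x * h x) by exact: iblMr.
pose I0 := \int[mu]_(x in D) (w x * h x).
pose C3 : R := (2 * n.+1%:R + 2) * C * b * (2 * b) ^+ n.+1.
have C30 : 0 <= C3 by rewrite !mulr_ge0 ?exprn_ge0 //; lra.
have key (tau : R) : 0 < tau -> tau <= 1 -> tau <= S0 / 4 -> b * tau <= r -> ka / 2 * I0 <= C3 * tau.
  move=> t0 t1 tS tr; pose a : R := tau ^+ 4.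
  have a0 : 0 < a by exact: exprn_gt0.
  have at_ : a <= tau by rewrite /a -[X in _ <= X]expr1; apply: ler_wiXn2l => //; exact: ltW.
  have aS : a <= S0 / 4 by exact: le_trans tS.
  pose ch_ x := 1 - sstep (qdist y x / (b * a)).
  have ba0 : 0 < b * a by rewrite mulr_gt0 //; lra.
  have cch : continuous ch_.
    rewrite (_ : ch_ = fun x => 1 - sstep ((b * a)^-1 * qdist y x)); first exact: step_qdist_continuous.
    by apply/funext => x; rewrite /ch_ mulrC.
  have ch0 x : 2 * (b * a) <= qdist y x -> ch_ x = 0.
    by move=> hx; rewrite /ch_ (sstep1 _).1 ?subrr // ler_pdivlMr.
  have ich : ibl D ch_ by split; [exact: lcb_continuous|exact: qdist_bsupp ch0].
  have chb x : 0 <= ch_ x <= 1.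
    by have [+ _ _] := sstep_cases (qdist y x / (b * a)); rewrite /ch_ => /andP[? ?]; apply/andP; split; lra.
  pose p := psi y S0 a; pose p1 := psi1 y S0 a; pose p2 := psi2 y S0 a.
  have Hp : C1g setT p p1 by exact: C1_psi.
  have Hp1 i : C1g setT (p1 i) (p2 i) by exact: C1_psi1.
  have pS x : S0 <= qdist y x -> [/\ p x = 0, forall i, p1 i x = 0 & forall i j, p2 i j x = 0].
    by apply: psi_outside.
  have W0 := weak p p1 p2 Hp Hp1 (fun x hx => pS x (le_trans Srho hx)).
  pose F x := w x * (- (\sum_i p2 i i x) - c x * p x).
  have ip : ibl D p.
    split; first by apply: lcb_continuous => x; have [] := Hp x I.
    by apply: (@qdist_bsupp D y S0) => x /pS[].
  have ip2 i : ibl D (p2 i i).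
    split; first by apply: lcb_continuous => x; have [_ /(_ i)[]] := Hp1 i x I.
    by apply: (@qdist_bsupp D y S0) => x /pS[].
  have iF : ibl D F.
    apply: iblMr => //; apply: iblB; last exact: iblMr.
    by apply: iblN; apply: ibl_sum => i _.
  pose K : R := (2 * n.+1%:R + 2) * spow n.+1 a * (C * (b * tau ^+ 2)).
  have E0 : 0 <= spow n.+1 a by exact: ltW (spow_gt0 _ _).
  have bt0 : 0 <= b * tau ^+ 2 by rewrite mulr_ge0 ?sqr_ge0 //; lra.
  have K0 : 0 <= K.
    apply: mulr_ge0; last exact: mulr_ge0.
    by apply: mulr_ge0 => //; rewrite addr_ge0 // mulr_ge0.
  have small x : qdist y x < 2 * (b * a) -> `|x - y| <= b * tau ^+ 2.
    move=> hx; rewrite -(@ler_pXn2r _ 2) ?nnegrE //; apply: le_trans (norm_qdist y x) _.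
    apply: le_trans (ltW hx) _; rewrite exprMn -exprM -/a expr2 -mulrA mulrCA.
    have b2 : 2 <= b by apply: le_trans b4; rewrite ler_nat.
    by apply: ler_wpM2l; [exact: le_trans b2|apply: ler_wpM2r; [exact: ltW|]].
  have wch x : D x -> w x * ch_ x <= C * (b * tau ^+ 2) * ch_ x.
    move=> Dx; have [/ch0 ->|hx] := leP (2 * (b * a)) (qdist y x); first by rewrite !mulr0.
    apply: ler_wpM2r; first by case/andP: (chb x).
    have sx := small x hx; apply: le_trans (wC x Dx _) _; last exact: ler_wpM2l.
    apply: le_trans sx _; apply: le_trans tr; rewrite expr2 mulrA.
    by rewrite ler_piMr // mulr_ge0 // ?ltW //; lra.
  have pw x : D x -> ka / 2 * (w x * h x) + F x <= K * ch_ x.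
    move=> Dx; have w0x := w0 x Dx; have [hx|hx] := leP S0 (qdist y x).
      have [q0 _ q2] := pS x hx.
      rewrite h0; last by lra.
      rewrite /F q0 big1 => [|i _]; last exact: q2.
      by rewrite !mulr0 oppr0 !addr0 mulr0 addr0 mulr_ge0 //; case/andP: (chb x).
    have xr : `|x - y| <= r.
      rewrite -(@ler_pXn2r _ 2) ?nnegrE ?(ltW r0) //; apply: le_trans (norm_qdist y x) _.
      exact: le_trans (ltW hx) Sr.
    have low := @barrier_lower R n y S0 a a0 S00 L _ x S01 L0 LS aS erefl hx.
    rewrite -/ka -/(h x) -/(ch_ x) -/b in low.
    have p0 : 0 <= p x by have [] := ramp_bounds (barrier_arg n.+1 S0 a (qdist y x)).
    have cx : - L <= c x by have := cL x Dx xr; rewrite ler_norml => /andP[].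
    have low2 : ka / 2 * h x - (2 * n.+1%:R + 2) * spow n.+1 a * ch_ x <= \sum_i p2 i i x + c x * p x.
      apply: le_trans low _; rewrite lerD2l -mulNr; exact: ler_wpM2r.
    have m1 := ler_wpM2l w0x low2.
    have m2 : (2 * n.+1%:R + 2) * spow n.+1 a * (w x * ch_ x) <= K * ch_ x.
      by rewrite /K -[X in _ <= X]mulrA; apply: ler_wpM2l; [apply: mulr_ge0 => //; lra|exact: wch].
    exact: barrier_arith m1 m2.
  have i1 : ibl D (fun x => ka / 2 * (w x * h x)) by exact: iblZ.
  have := le_int_rV oD (iblD i1 iF) (iblZ K ich) pw.
  rewrite int_rVD // int_rVZ // (_ : \int[mu]_(x in D) F x = 0) // addr0 int_rVZ // -/I0 => le1.
  apply: le_trans le1 _.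
  have vol : \int[mu]_(x in D) ch_ x <= 1 * (2 * (b * tau ^+ 2)) ^+ n.+1.
    pose B := [set x | qdist y x < 2 * (b * a)].
    have oB : open B.
      have -> : B = qdist y @^-1` [set t | t < 2 * (b * a)] by [].
      by apply: open_comp => [x _|]; [exact: qdist_continuous|exact: open_lt].
    have mB := open_measurable_rV oB.
    apply: (integral_le_measure oD mB) => //.
      apply: lebesgue_ball_le bt0 _ _; first by apply: measurableI => //; exact: open_measurable_rV.
      by move=> x [_]; exact: small.
    by move=> x _ /negP; rewrite -leNgt; exact: ch0.
  apply: (@le_trans _ _ (K * (2 * (b * tau ^+ 2)) ^+ n.+1)).
    by apply: ler_wpM2l => //; rewrite -[X in _ <= X]mul1r.
  rewrite /K /a spow_pow4 // (_ : 2 * (b * tau ^+ 2) = 2 * b * tau ^+ 2); last by rewrite mulrA.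
  rewrite exprMn -exprM /C3.
  (* With [N = n + 1], the singularity costs [tau ^ -(2 N + 1)], the bound [w = O(|x - y|)] gains
     [tau ^ 2] and the volume [tau ^ (2 N)]: one power of [tau] remains, so the error vanishes in
     the limit. *)
  have tn : tau ^- (2 * n.+1 + 1) * tau ^+ 2 * tau ^+ (2 * n.+1) = tau.
    rewrite exprD expr1; field; rewrite expf_neq0 ?gt_eqF //.
  rewrite le_eqVlt; apply/orP; left; apply/eqP.
  rewrite -[in RHS]tn; ring.
have I0le : I0 <= 0.
  rewrite leNgt; apply/negP => Ip.
  pose tau : R := Num.min (Num.min 1 (S0 / 4)) (Num.min (r / b) (ka / 2 * I0 / (2 * (C3 + 1)))).
  have kI : 0 < ka / 2 * I0 by rewrite mulr_gt0 // divr_gt0.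
  have c31 : 0 < 2 * (C3 + 1) by lra.
  have t0 : 0 < tau by rewrite !lt_min ltr01 !divr_gt0 //; lra.
  have t1 : tau <= 1 by rewrite !ge_min lexx.
  have t2 : tau <= S0 / 4 by rewrite !ge_min lexx orbT.
  have t3 : b * tau <= r.
    by rewrite mulrC -ler_pdivlMr; [rewrite !ge_min lexx !orbT|lra].
  have t4 : tau * (2 * (C3 + 1)) <= ka / 2 * I0.
    by rewrite -ler_pdivlMr // !ge_min lexx !orbT.
  have := key tau t0 t1 t2 t3; have : 0 <= C3 * tau by rewrite mulr_ge0 // ltW.
  lra.
have wh0 x : D x -> 0 <= w x * h x by move=> Dx; rewrite mulr_ge0 ?w0 //; case/andP: (hb x).
have Z := ge0_int_rV_eq0 oD iwh wh0 I0le.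
have S4 : 0 < S0 / 4 by lra.
have [d d0 hd] := continuous_eps (@qdist_continuous R n.+1 y y) S4.
exists d => // x Dx xd; have := hd x xd; rewrite qdist_self subr0 ger0_norm ?qdist_ge0 // => qx.
have := Z x Dx; rewrite /h (sstep0 _).1 ?subr0 ?mulr1 //.
by rewrite mulrAC ler_pdivrMr //; lra.
Qed.

End barrier.

(** * The direction of the gradient *)

Section lipschitz.
Context {R : realType} {n : nat}.
Local Notation V := 'rV[R]_n.

Lemma test_ibl (D : set V) th dth y (r : R) : C1g setT th dth -> (forall x, r < `|x - y| -> th x = 0) ->
  ibl D th /\ forall i, ibl D (dth i).
Proof.
move=> H h0; have far x : r + `|y| < `|x| -> r < `|x - y|.
  by move=> xr; rewrite -(ltrD2r `|y|); apply: lt_le_trans xr _; rewrite -{1}[x](subrK y); exact: ler_normD.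
split=> [|i]; split.
- by apply: lcb_continuous => x; have [] := H x I.
- by exists (r + `|y|) => x _ /far/h0.
- by apply: lcb_continuous => x; have [_ /(_ i)[]] := H x I.
- by exists (r + `|y|) => x _ /far xr; exact: dtheta_outside H h0 _ _ xr.
Qed.

Lemma C1_lipschitz_ball (U : set V) g dg (y : V) (r : R) : open U -> C1g U g dg -> 0 < r ->
  (forall x, `|x - y| <= r -> U x) ->
  exists2 B : R, 0 <= B & forall x, `|x - y| <= r -> `|g x - g y| <= B * `|x - y|.
Proof.
move=> oU Hg r0 rU.
have cd i x : U x -> {for x, continuous (dg i)} by move=> /Hg[_ /(_ i)[]].
have /choice[B hB] : forall i, exists M, forall x, `|x - y| <= r -> `|dg i x| <= M.
  by move=> i; apply: lcb_closed_ball rU; exact: cd.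
exists (\sum_i `|B i|); first exact: sumr_ge0.
move=> x xr; have [k /andP[k0 k1] E] := @C1g_MVT R n U g dg y (x - y) oU Hg (ltac:(
  move=> k /andP[k0 k1]; apply: rU; rewrite addrK normrZ ger0_norm //;
  apply: le_trans xr; rewrite ler_piMl //)).
rewrite subrK in E; rewrite E; apply: le_trans (ler_norm_sum _ _ _) _.
rewrite mulr_suml; apply: ler_sum => i _; rewrite normrM mulrC; apply: ler_pM => //.
  apply: le_trans (ler_norm _); apply: hB; rewrite addrK normrZ ger0_norm //.
  by apply: le_trans xr; rewrite ler_piMl.
exact: coord_le_norm.
Qed.

End lipschitz.

Section flatness.
Context {R : realType} {n : nat}.
Local Notation V := 'rV[R]_n.+1.
Local Notation mu := (@lebesgue_rV R n.+1).
Variables (D : set V) (f f' : R -> R) (u : V -> R) (u1 : 'I_n.+1 -> V -> R)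
  (u2 : 'I_n.+1 -> 'I_n.+1 -> V -> R) (u3 : 'I_n.+1 -> 'I_n.+1 -> 'I_n.+1 -> V -> R).
Hypothesis HS : setup D f f' u u1 u2 u3.
Let oD := s_open HS.
Let c x := f' (u x).
Variables (C M : R).
Hypothesis C0 : 0 <= C.
Hypothesis hC : forall r : R, 1 <= r ->
  (mu (D `&` [set x : V | (enorm x <= r)%R]) <= (C * r ^+ 2)%:E)%E.
Hypothesis hM : forall x, D x -> \sum_i u1 i x ^+ 2 <= M ^+ 2.
Hypothesis hQ : forall g dg, adm D g dg -> 0 <= stabform D c g dg g dg.

Lemma segment_in x y (t : R) : D x -> D y -> 0 <= t <= 1 -> D (t *: (x - y) + y).
Proof.
move=> Dx Dy ht; have := s_convex HS Dx Dy ht.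
by rewrite scalerBl scale1r scalerBr addrAC addrA.
Qed.

Section direction.
Variable e : 'I_n.+1 -> R.
Local Notation v := (dirder u1 e).
Local Notation v1 := (dirder1 u2 e).

Lemma lcb_v : lcb D v.
Proof. by apply: ext_lcb (ext_v HS e) => x; exact: cont_in (C1_v HS e) x. Qed.

Lemma c_bound y r : exists2 L, 0 <= L & forall x, D x -> `|x - y| <= r -> `|c x| <= L.
Proof.
have [L hL] : bnear D y r c by exact: lcb_bnear (lcb_c HS).
exists `|L| => // x Dx xr; apply: le_trans (ler_norm L); exact: hL.
Qed.

(** At an interior zero the C1 function [v] is [O(|x - x0|)]. The barrier asks for a nonnegative
    solution, which is why it is applied to [|v|]. *)
Lemma v_zero_local x0 : D x0 -> v x0 = 0 -> exists2 d : R, 0 < d & forall x, `|x - x0| < d -> D x /\ v x = 0.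
Proof.
move=> Dx0 vx0; have [r r0 hr] := open_eps oD Dx0.
have r2 : 0 < r / 2 by rewrite divr_gt0.
have rD x : `|x - x0| <= r / 2 -> D x by move=> h; apply: hr; apply: le_lt_trans h _; lra.
have [B B0 hB] := C1_lipschitz_ball oD (C1_v HS e) r2 rD.
have [L L0 hL] := c_bound x0 (r / 2).
have qr x : qdist x0 x <= (r / 2) ^+ 2 -> `|x - x0| <= r / 2.
  move=> h; rewrite -(@ler_pXn2r _ 2) ?nnegrE //; last exact: ltW.
  exact: le_trans (norm_qdist _ _) h.
have cK : closed [set x | qdist x0 x <= (r / 2) ^+ 2].
  rewrite (_ : [set x | _] = qdist x0 @^-1` [set t | t <= (r / 2) ^+ 2]) //.
  by apply: closed_comp => [x _|]; [exact: qdist_continuous|exact: closed_le].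
have weak p (p1 : 'I_n.+1 -> V -> R) (p2 : 'I_n.+1 -> 'I_n.+1 -> V -> R) : C1g setT p p1 -> (forall i, C1g setT (p1 i) (p2 i)) ->
    (forall x, (r / 2) ^+ 2 <= qdist x0 x -> [/\ p x = 0, forall i, p1 i x = 0 & forall i j, p2 i j x = 0]) ->
    \int[mu]_(x in D) (`|v x| * (- (\sum_i p2 i i x) - c x * p x)) = 0.
  move=> Hp Hp1 h0.
  apply: (@weak_abs_v R n D f f' u u1 u2 u3 HS C M C0 hC hM hQ e _ (r / 2 + `|x0|) p p1 p2 cK) => //.
  - by move=> x /qr/rD.
  - move=> x /qr h; rewrite -{1}[x](subrK x0); apply: le_trans (ler_normD _ _) _.
    by rewrite lerD2r.
  - by move=> x /negP; rewrite -ltNge => h; apply: h0; exact: ltW.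
have vB x : D x -> `|x - x0| <= r / 2 -> `|v x| <= B * `|x - x0|.
  by move=> _ /hB; rewrite vx0 subr0.
have [d d0 hd] := @barrier R n D (fun x => `|v x|) c x0 B L (r / 2) (r / 2) oD (lcb_abs lcb_v) (lcb_c HS) r2 r2 B0 L0
  (fun x _ => normr_ge0 _) vB hL weak.
exists (Num.min d (r / 2)); first by rewrite lt_min d0.
move=> x; rewrite lt_min => /andP[xd xr]; have Dx := rD x (ltW xr).
by split=> //; apply/eqP; rewrite -normr_eq0; apply/eqP; exact: hd.
Qed.

(** The zero set of [v] is closed in the connected set [D] by continuity and open by
    [v_zero_local]. *)
Lemma v_dichotomy x0 : D x0 -> v x0 = 0 -> forall x, D x -> v x = 0.
Proof.
move=> Dx0 v0; pose Z := D `&` [set x | v x = 0].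
suff ZD : Z = D by move=> x; rewrite -{1}ZD => -[].
have oZ : open Z.
  rewrite openE => x [Dx vx]; have [d d0 h] := v_zero_local Dx vx.
  by apply: (eps_nbhs d0) => y /h[].
have oN : open (D `&` [set x | v x != 0]).
  rewrite openE => x [Dx vx].
  have vp : 0 < `|v x| by rewrite normr_gt0.
  have [d1 d10 h1] := open_eps oD Dx.
  have [d d0 h] := continuous_eps (cont_in (C1_v HS e) Dx) vp.
  have m0 : 0 < Num.min d1 d by rewrite lt_min d10.
  apply: (eps_nbhs m0) => y; rewrite lt_min => /andP[/h1 Dy /h hy]; split=> //=.
  apply/eqP => vy; move: hy; rewrite vy sub0r normrN ltxx //.
apply: (s_connected HS); first by exists x0.
  by exists Z => //; rewrite /Z setIA setIid.
exists (~` (D `&` [set x | v x != 0])); first exact: open_closedC.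
apply/seteqP; split=> x; first by move=> [Dx vx]; split=> // -[_ /=]; rewrite vx eqxx.
by move=> [Dx h]; split=> //=; apply/eqP; apply/negPn/negP => vx; apply: h.
Qed.

Lemma v_pos x0 : D x0 -> 0 < v x0 -> forall x, D x -> 0 < v x.
Proof.
move=> Dx0 v0 x Dx; rewrite ltNge; apply/negP => vx.
have Dt (t : R) : 0 <= t <= 1 -> D (t *: (x - x0) + x0).
  exact: segment_in.
have ct : {within `[0, 1], continuous (fun t : R => v (t *: (x - x0) + x0))}.
  apply: continuous_in_subspaceT => t; rewrite inE /= in_itv /= => ht.
  exact: is_derive_continuous1 (C1g_line oD (C1_v HS e) (Dt t ht)).
have h0 : Num.min (v (0 *: (x - x0) + x0)) (v (1 *: (x - x0) + x0)) <= 0 <=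
    Num.max (v (0 *: (x - x0) + x0)) (v (1 *: (x - x0) + x0)).
  by rewrite scale0r add0r scale1r subrK ge_min le_max vx (ltW v0) orbT.
have [t +] := IVT ler01 ct h0.
rewrite in_itv /= => ht vt.
by have := v_dichotomy (Dt t ht) vt Dx0 => E; rewrite E ltxx in v0.
Qed.

End direction.

Section nonconstant.
Variable x0 : V.
Hypothesis Dx0 : D x0.
Hypothesis gx0 : exists i, u1 i x0 != 0.

Definition gnorm := Num.sqrt (\sum_i u1 i x0 ^+ 2).
Definition e0 i := u1 i x0 / gnorm.
Local Notation v := (dirder u1 e0).
Local Notation v1 := (dirder1 u2 e0).

Lemma gnorm_gt0 : 0 < gnorm.
Proof.
rewrite sqrtr_gt0; have [i hi] := gx0; rewrite (bigD1 i) //=.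
apply: ltr_wpDr; first by apply: sumr_ge0 => j _; exact: sqr_ge0.
by rewrite lt_neqAle eq_sym sqrf_eq0 hi sqr_ge0.
Qed.

Lemma sum_sqr_e0 : \sum_i e0 i ^+ 2 = 1.
Proof.
rewrite (eq_bigr (fun i => gnorm ^- 2 * u1 i x0 ^+ 2)); last by move=> i _; rewrite /e0 exprMn exprVn mulrC.
rewrite -mulr_sumr sqr_sqrtr; last by apply: sumr_ge0 => i _; exact: sqr_ge0.
rewrite mulVf // gt_eqF // -[X in 0 < X]sqr_sqrtr ?exprn_gt0 ?gnorm_gt0 //.
by apply: sumr_ge0 => i _; exact: sqr_ge0.
Qed.

Lemma v_gt0 x : D x -> 0 < v x.
Proof.
apply: (v_pos Dx0); rewrite /dirder (eq_bigr (fun i => gnorm * e0 i ^+ 2)); last first.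
  by move=> i _; rewrite /e0; field; rewrite gt_eqF // gnorm_gt0.
by rewrite -mulr_sumr sum_sqr_e0 mulr1 gnorm_gt0.
Qed.

(** The direction [e], the [i]-th axis minus its component along [e0], is orthogonal to the gradient
    at [x0]; by [v_dichotomy] the derivative of [u] along it vanishes everywhere. *)
Lemma grad_e0 i x : D x -> u1 i x = e0 i * v x.
Proof.
move=> Dx; pose e (j : 'I_n.+1) : R := (j == i)%:R - e0 i * e0 j.
have vE z : dirder u1 e z = u1 i z - e0 i * v z.
  rewrite /dirder /e mulr_sumr (bigD1 i) //= [in RHS](bigD1 i) //= eqxx.
  rewrite (eq_bigr (fun j => - (e0 i * (e0 j * u1 j z)))); last first.
    by move=> j ji; rewrite (negbTE ji) mulr0n; ring.
  by rewrite sumrN (_ : true%:R = 1 :> R) //; ring.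
have v0 : dirder u1 e x0 = 0.
  rewrite vE; have -> : v x0 = gnorm.
    rewrite /dirder (eq_bigr (fun i => gnorm * e0 i ^+ 2)); first by rewrite -mulr_sumr sum_sqr_e0 mulr1.
    by move=> j _; rewrite /e0; field; rewrite gt_eqF // gnorm_gt0.
  by rewrite /e0 divfK ?subrr // gt_eqF // gnorm_gt0.
by have := v_dichotomy Dx0 v0 Dx; rewrite vE => /eqP; rewrite subr_eq0 => /eqP.
Qed.

Definition dote (x : V) := \sum_i x ord0 i * e0 i.

Lemma doteD x y : dote (x + y) = dote x + dote y.
Proof. by rewrite /dote -big_split; apply: eq_bigr => i _; rewrite !mxE mulrDl. Qed.

Lemma doteZ t x : dote (t *: x) = t * dote x.
Proof. by rewrite /dote mulr_sumr; apply: eq_bigr => i _; rewrite !mxE mulrA. Qed.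

Lemma doteB x y : dote (x - y) = dote x - dote y.
Proof. by rewrite doteD -scaleN1r doteZ mulN1r. Qed.

Lemma u_increment x y : D x -> D y -> exists2 z, D z & u y - u x = v z * dote (y - x).
Proof.
move=> Dx Dy; have [k k01 E] := @C1g_MVT R n.+1 D u u1 x (y - x) oD (s_u HS) (fun t => segment_in Dy Dx).
rewrite subrK in E; exists (k *: (y - x) + x); first exact: segment_in.
have Dz := segment_in Dy Dx k01.
rewrite E /dote mulr_sumr; apply: eq_bigr => i _; rewrite (grad_e0 i Dz); ring.
Qed.

(** The gradient tends to [l e0] at [z], where [l] is the limit of [v], and the Neumann condition
    reads [l (e0 . grad phi) = 0]. *)
Lemma v_limit y U phi dphi d2phi : closure D y -> ~ D y -> chart D u1 y U phi dphi d2phi ->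
  \sum_i e0 i * dphi i y != 0 ->
  exists2 r : R, 0 < r & forall z, U z -> phi z = 0 -> closure D z -> (exists j, dphi j z != 0) ->
    `|z - y| < r -> \sum_i e0 i * dphi i z != 0 /\ limin D v z 0.
Proof.
move=> cy Dy HC p0; have [[oU Uy] [Hphi Hdphi] _ DU hN] := HC.
have cp : {for y, continuous (fun z => \sum_i e0 i * dphi i z)}.
  apply: continuous_sum_fin => i _; apply: (@continuousM R V (cst (e0 i))); first exact: cst_continuous.
  by have [] := Hdphi i y Uy.
have pp : 0 < `|\sum_i e0 i * dphi i y| by rewrite normr_gt0.
have [r r0 hr] := continuous_eps cp pp; exists r => // z Uz pz cz jz zr.
have nz : \sum_i e0 i * dphi i z != 0.
  by apply/eqP => E; have := hr z zr; rewrite E sub0r normrN ltxx.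
split=> //; have [l hl] := ext_v HS e0 cz.
suff : l = 0 by move=> <-.
have hl' i : limin D (u1 i) z (e0 i * l).
  have h := liminM (@limin_cst R V D z (e0 i)) hl.
  by apply: limin_eq h => x Dx; rewrite -grad_e0.
have := hN z (fun i => e0 i * l) Uz pz cz jz hl'.
rewrite (eq_bigr (fun i => l * (e0 i * dphi i z))); last by move=> i _; ring.
by rewrite -mulr_sumr => /eqP; rewrite mulf_eq0 (negbTE nz) orbF => /eqP.
Qed.

Lemma limin_scale0 z (a : R) : limin D v z 0 -> limin D (fun x => a * v x) z 0.
Proof. by move=> h; have := liminM (@limin_cst R V D z a) h; rewrite mulr0. Qed.

Lemma v_boundary_bound y U phi dphi d2phi : closure D y -> ~ D y -> chart D u1 y U phi dphi d2phi ->
  \sum_i e0 i * dphi i y != 0 ->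
  exists B r : R, [/\ 0 <= B, 0 < r & forall x, D x -> `|x - y| <= r -> v x <= B * `|x - y|].
Proof.
move=> cy Dy HC p0; have [[oU Uy] [Hphi Hdphi] _ DU hN] := HC.
have [r1 r10 hlim] := v_limit cy Dy HC p0.
pose P := \sum_i e0 i * dphi i y.
(* The factor [P] fixes the sign: near [y], [X . grad phi] is at least [P ^ 2 / 2] times [v], so its
   bound by [|phi|], hence by [|x - y|], passes to [v]. *)
pose X i x := P * (e0 i * v x); pose dX i l x := P * (e0 i * v1 l x).
have HX i : C1g D (X i) (dX i) by apply: C1gZ; apply: C1gZ; exact: C1_v HS e0.
have eX i : ext D (X i) by apply: extZ; apply: extZ; exact: ext_v HS e0.
have edX i l : ext D (dX i l) by apply: extZ; apply: extZ; exact: ext_v1 HS e0 l.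
have hyp : exists2 rho : R, 0 < rho & forall z (T : 'I_n.+1 -> R), U z -> phi z = 0 -> closure D z ->
    (exists j, dphi j z != 0) -> `|z - y| < rho ->
    (forall i, limin D (X i) z (T i)) -> \sum_i T i * dphi i z <= 0.
  exists r1 => // z T Uz pz cz jz zr hT; have [_ lz] := hlim z Uz pz cz jz zr.
  rewrite big1 // => i _.
  have h : limin D (X i) z 0.
    by apply: limin_eq (limin_scale0 (P * e0 i) lz) => x _; rewrite /X mulrA.
  by rewrite (limin_uniq cz (hT i) h) mul0r.
have [r2 r20 [rU [B hB]]] := normal_component_bound HC HX eX edX hyp.
have p2 : 0 < P ^+ 2 / 2 by rewrite divr_gt0 // lt_neqAle eq_sym sqrf_eq0 p0 sqr_ge0.
have cp : {for y, continuous (fun z => P * \sum_i e0 i * dphi i z)}.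
  apply: (@continuousM R V (cst P)); first exact: cst_continuous.
  apply: continuous_sum_fin => i _; apply: (@continuousM R V (cst (e0 i))); first exact: cst_continuous.
  by have [] := Hdphi i y Uy.
have [r3 r30 h3] := continuous_eps cp p2.
have [K K0 hK] := C1_lipschitz_ball oU Hphi r20 rU.
exists (`|B| * K / (P ^+ 2 / 2)), (Num.min r2 (r3 / 2)); split.
- by apply: divr_ge0; [exact: mulr_ge0|exact: ltW].
- by rewrite lt_min r20 divr_gt0.
move=> x Dx; rewrite le_min => /andP[xr2 xr3].
have vx := v_gt0 Dx.
have h1 := hB x Dx xr2.
have h2 : P ^+ 2 / 2 <= P * \sum_i e0 i * dphi i x.
  have xr : `|x - y| < r3 by apply: le_lt_trans xr3 _; lra.
  by have := h3 x xr; rewrite -/P -expr2 ltr_norml => /andP[h _]; lra.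
have E : \sum_i X i x * dphi i x = P * (\sum_i e0 i * dphi i x) * v x.
  by rewrite /X mulr_sumr mulr_suml; apply: eq_bigr => i _; ring.
rewrite E in h1.
have h4 : `|phi x| <= K * `|x - y| by have := hK x xr2; rewrite (chart_phi0 cy Dy HC) subr0.
rewrite mulrAC ler_pdivlMr // mulrC; apply: (@le_trans _ _ (P * (\sum_i e0 i * dphi i x) * v x)).
  by apply: ler_wpM2r => //; exact: ltW.
apply: le_trans h1 _; apply: (@le_trans _ _ (`|B| * `|phi x|)).
  by apply: ler_wpM2r => //; exact: ler_norm.
by rewrite -mulrA; apply: ler_wpM2l.
Qed.

(** The fields [v] and [- v] along any axis have zero boundary values near [y], so both fluxes are
    nonpositive. *)
Lemma flux_zero y U phi dphi d2phi : closure D y -> ~ D y -> chart D u1 y U phi dphi d2phi ->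
  \sum_i e0 i * dphi i y != 0 ->
  exists2 r : R, 0 < r & forall j th dth, C1g setT th dth ->
    (forall x, r ^+ 2 <= qdist y x -> th x = 0) ->
    \int[mu]_(x in D) (dth j x * v x + th x * v1 j x) = 0.
Proof.
move=> cy Dy HC p0.
have [r1 r10 hlim] := v_limit cy Dy HC p0.
have lv := lcb_v e0.
have lv1 j : lcb D (v1 j).
  by apply: ext_lcb (ext_v1 HS e0 j) => x Dx; have [_ /(_ j)[]] := C1_v HS e0 Dx.
have fluxs (j : 'I_n.+1) (s : R) : exists r, 0 < r /\ forall th dth, C1g setT th dth -> (forall x, 0 <= th x) ->
    (forall x, r < `|x - y| -> th x = 0) ->
    s * \int[mu]_(x in D) (dth j x * v x + th x * v1 j x) <= 0.
  pose X (i : 'I_n.+1) x : R := s * (j == i)%:R * v x.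
  pose dX (i l : 'I_n.+1) x : R := s * (j == i)%:R * v1 l x.
  have HX i : C1g D (X i) (dX i) by apply: C1gZ; exact: C1_v HS e0.
  have eX i : ext D (X i) by apply: extZ; exact: ext_v HS e0.
  have edX i l : ext D (dX i l) by apply: extZ; exact: ext_v1 HS e0 l.
  have hyp : exists2 rho : R, 0 < rho & forall z (T : 'I_n.+1 -> R), U z -> phi z = 0 -> closure D z ->
    (exists j, dphi j z != 0) -> `|z - y| < rho ->
    (forall i, limin D (X i) z (T i)) -> \sum_i T i * dphi i z <= 0.
    exists r1 => // z T Uz pz cz jz zr hT; have [_ lz] := hlim z Uz pz cz jz zr.
    rewrite big1 // => i _.
    by rewrite (limin_uniq cz (hT i) (limin_scale0 _ lz)) mul0r.
  have [r r0 hr] := flux_boundary HS HC HX eX edX hyp.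
  exists r; split=> // th dth Hth th0 thr.
  have i1 : ibl D (fun x => dth j x * v x + th x * v1 j x).
    have [bs bd] := @test_ibl R n.+1 D th dth y r Hth thr.
    by apply: iblD; apply: iblMl.
  rewrite -int_rVZ //; have := hr th dth Hth th0 thr.
  rewrite (eq_int_rV (G := fun x => s * (dth j x * v x + th x * v1 j x))) // => x Dx.
  rewrite (bigD1 j) //= big1 => [|i ij]; first by rewrite /X /dX eqxx addr0 (_ : true%:R = 1 :> R) //; ring.
  by rewrite /X /dX eq_sym (negbTE ij) mulr0 !mul0r !mulr0 addr0.
have /choice[ra hra] := fun j => fluxs j 1; have /choice[rb hrb] := fun j => fluxs j (-1).
have [r [r0 _ ra_]] := exists_fin_min ltr01 (fun j => (hra j).1).
have [r' [r'0 r'r rb_]] := exists_fin_min r0 (fun j => (hrb j).1).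
have flux0 j th dth : C1g setT th dth -> (forall x, 0 <= th x) -> (forall x, r' < `|x - y| -> th x = 0) ->
    \int[mu]_(x in D) (dth j x * v x + th x * v1 j x) = 0.
  move=> H h0 h1; have A := (hra j).2 th dth H h0 (fun x hx => h1 x (le_lt_trans (le_trans r'r (ra_ j)) hx)).
  have B := (hrb j).2 th dth H h0 (fun x hx => h1 x (le_lt_trans (rb_ j) hx)).
  by apply/eqP; rewrite eq_le; apply/andP; split; lra.
have r'2 : 0 < r' / 2 by rewrite divr_gt0.
exists (r' / 2) => // j th dth H h0.
have far x : r' / 2 < `|x - y| -> th x = 0.
  move=> h; apply: h0; apply: ltW; apply: lt_le_trans (norm_qdist y x).
  by rewrite ltr_pXn2r ?nnegrE // ltW.
pose eta x := pos (r' ^+ 2 - qdist y x) ^+ 2.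
pose deta (i : 'I_n.+1) (x : V) := 2 * pos (r' ^+ 2 - qdist y x) * (- (2 * (x ord0 i - y ord0 i))).
have Heta : C1g setT eta deta by exact: bump_C1.
have eta0 x : r' < `|x - y| -> eta x = 0.
  move=> h; rewrite /eta pos_nonpos ?expr0n // subr_le0; apply: le_trans (norm_qdist y x).
  by rewrite ler_pXn2r ?nnegrE // ltW.
have [K hK] : exists K, forall x, `|x - y| <= r' / 2 -> `|th x| <= K.
  by apply: (@lcb_closed_ball R n.+1 setT) => // x _; have [] := H x I.
(* The flux inequality asks for a nonnegative multiplier; a signed [th] becomes nonnegative by
   adding [K' * eta], whose own flux is [0]. *)
pose K' := `|K| / ((r' ^+ 2 - (r' / 2) ^+ 2) ^+ 2).
have d0 : 0 < r' ^+ 2 - (r' / 2) ^+ 2 by nra.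
have K'0 : 0 <= K' by rewrite divr_ge0 // exprn_ge0 // ltW.
have HK := C1gZ K' Heta.
have iv f1 df1 : C1g setT f1 df1 -> (forall x, r' < `|x - y| -> f1 x = 0) ->
   ibl D (fun x => df1 j x * v x + f1 x * v1 j x).
  move=> H1 h1; have [bs bd] := @test_ibl R n.+1 D f1 df1 y r' H1 h1.
  by apply: iblD; apply: iblMl.
have far2 x : r' < `|x - y| -> th x = 0 by move=> h; apply: far; apply: le_lt_trans h; lra.
have A := flux0 j _ _ HK (ltac:(by move=> x; rewrite mulr_ge0 // sqr_ge0)) (ltac:(by move=> x /eta0 ->; rewrite mulr0)).
have pos x : 0 <= th x + K' * eta x.
  have [/far ->|xr] := ltP (r' / 2) `|x - y|; first by rewrite add0r mulr_ge0 // sqr_ge0.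
  have [q|q] := leP ((r' / 2) ^+ 2) (qdist y x); first by rewrite h0 // add0r mulr_ge0 // sqr_ge0.
  have : `|K| <= K' * eta x.
    rewrite /K' mulrAC ler_pdivlMr ?exprn_gt0 //; apply: ler_wpM2l => //.
    rewrite /eta pos_id; last by lra.
    by rewrite ler_pXn2r ?nnegrE //; lra.
  have := hK x xr; rewrite ler_norml => /andP[+ _]; have := ler_norm K; lra.
have B := flux0 j _ _ (C1gD H HK) pos (ltac:(by move=> x h /=; rewrite far2 // eta0 // mulr0 addr0)).
rewrite (eq_int_rV (G := fun x => (dth j x * v x + th x * v1 j x) + (K' * deta j x * v x + K' * eta x * v1 j x))) in B; last first.
  by move=> x _; ring.
rewrite int_rVD // in B; first by rewrite A addr0 in B.
  exact: iv.
by apply: iv HK _ => x /eta0 ->; rewrite mulr0.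
Qed.

(* Where [e0] is not tangent to the frontier the Neumann condition forces [v = 0], so that
   [v] extended by [0] is a weak solution across the frontier and the barrier applies. *)
Lemma e0_tangent y U phi dphi d2phi : closure D y -> ~ D y -> chart D u1 y U phi dphi d2phi ->
  \sum_i e0 i * dphi i y = 0.
Proof.
move=> cy Dy HC; apply/eqP; apply/negPn/negP => p0.
have [B [r1 [B0 r10 hB]]] := v_boundary_bound cy Dy HC p0.
have [r2 r20 hflux] := flux_zero cy Dy HC p0.
have [L L0 hL] := c_bound y r1.
have lv := lcb_v e0.
have lv1 j : lcb D (v1 j).
  by apply: ext_lcb (ext_v1 HS e0 j) => x Dx; have [_ /(_ j)[]] := C1_v HS e0 Dx.
have weak p (p1 : 'I_n.+1 -> V -> R) (p2 : 'I_n.+1 -> 'I_n.+1 -> V -> R) : C1g setT p p1 -> (forall i, C1g setT (p1 i) (p2 i)) ->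
    (forall x, r2 ^+ 2 <= qdist y x -> [/\ p x = 0, forall i, p1 i x = 0 & forall i j, p2 i j x = 0]) ->
    \int[mu]_(x in D) (v x * (- (\sum_i p2 i i x) - c x * p x)) = 0.
  move=> Hp Hp1 h0.
  have far x : r2 < `|x - y| -> r2 ^+ 2 <= qdist y x.
    move=> h; apply: ltW; apply: lt_le_trans (norm_qdist y x).
    by rewrite ltr_pXn2r ?nnegrE // ltW.
  have [ip _] := @test_ibl R n.+1 D p p1 y r2 Hp (fun x h => let: And3 a _ _ := h0 x (far x h) in a).
  have ip1 i := @test_ibl R n.+1 D (p1 i) (p2 i) y r2 (Hp1 i) (fun x h => let: And3 _ a _ := h0 x (far x h) in a i).
  have ap : adm D p p1.
    split; [exact: C1gS (@subsetT _ D) Hp| | |by case: ip].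
      by apply: ext_continuous => x; have [] := Hp x I.
    by move=> i; apply: ext_continuous => x; have [] := Hp1 i x I.
  have W0 := weak_v HS C0 hC hM hQ e0 ap.
  have F0 i : \int[mu]_(x in D) (p2 i i x * v x + p1 i x * v1 i x) = 0.
    by apply: (hflux i (p1 i) (p2 i) (Hp1 i)) => x /h0[_ ->].
  have iF i : ibl D (fun x => p2 i i x * v x + p1 i x * v1 i x).
    by have [a b] := ip1 i; apply: iblD; apply: iblMl.
  have iW : ibl D (fun x => \sum_i v1 i x * p1 i x - c x * (v x * p x)).
    apply: iblB; last by apply: iblMr; [exact: lcb_c HS|exact: iblMr].
    by apply: ibl_sum => i _; apply: iblMr => //; case: (ip1 i).
  rewrite (eq_int_rV (G := fun x => (\sum_i v1 i x * p1 i x - c x * (v x * p x)) -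
     \sum_i (p2 i i x * v x + p1 i x * v1 i x))); last first.
    move=> x _; rewrite big_split /= -mulr_suml.
    have -> : \sum_i p1 i x * v1 i x = \sum_i v1 i x * p1 i x by apply: eq_bigr => i _; rewrite mulrC.
    ring.
  rewrite int_rVB // ?W0; last by apply: ibl_sum => i _; exact: iF.
  by rewrite int_rV_sum // big1 ?subr0 // => i _; exact: F0.
have [d d0 hd] := barrier oD lv (lcb_c HS) r10 r20 B0 L0 (fun x Dx => ltW (v_gt0 Dx)) hB hL weak.
have [x Dx xd] := closure_eps cy d0.
by have := v_gt0 Dx; rewrite (hd x Dx xd) ltxx.
Qed.

(** The tangent hyperplane at [y] supports the convex set [D]. If some [w] of [D] were on its outer
    side, [phi] would be positive at a point of the segment from [y] to [w]; replacing [y] by a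
    close point of [D] gives a nearby point that lies in [D] by convexity, where [phi] must be
    negative. *)
Lemma support_lt y U phi dphi d2phi z : closure D y -> ~ D y -> chart D u1 y U phi dphi d2phi -> D z ->
  \sum_i (z - y) ord0 i * dphi i y < 0.
Proof.
move=> cy Dy HC; have [[oU Uy] [Hphi Hdphi] [j pj] DU hN] := HC.
have le0 w : D w -> \sum_i (w - y) ord0 i * dphi i y <= 0.
  move=> Dw; rewrite leNgt; apply/negP => S0.
  have py : phi y = 0 := chart_phi0 cy Dy HC.
  have [r r0 hr] := open_eps oU Uy.
  pose k : R := `|w - y| + 1.
  have k0 : 0 < k by rewrite /k ltr_wpDl.
  have inU (t : R) : 0 < t < r / k -> U (t *: (w - y) + y).
    move=> /andP[t0 tr]; apply: hr; rewrite addrK normrZ (gtr0_norm t0).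
    apply: (@le_lt_trans _ _ (t * k)); first by apply: ler_wpM2l; [exact: ltW|rewrite /k lerDl].
    by rewrite -ltr_pdivlMr.
  have S2 : 0 < (\sum_i (w - y) ord0 i * dphi i y) / 2 by rewrite divr_gt0.
  have rk0 : 0 < r / k by rewrite divr_gt0.
  have cphi : limin U phi y 0 by rewrite -py; apply: limin_cont; have [] := Hphi y Uy.
  have cdphi i : limin U (dphi i) y (dphi i y) by apply: limin_cont; have [] := Hdphi i y Uy.
  have [del del0 hd] := endpoint_expansion oU Hphi rk0 inU cphi cdphi S2.
  pose t : R := Num.min (Num.min del (r / k)) 1 / 2.
  have m0 : 0 < Num.min (Num.min del (r / k)) 1 by rewrite !lt_min del0 rk0 ltr01.
  have t0 : 0 < t by rewrite divr_gt0.
  have : t < Num.min (Num.min del (r / k)) 1 by rewrite /t; lra.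
  rewrite !lt_min => /andP[/andP[td tr] t1].
  have Ut := inU t (ltac:(by rewrite t0)).
  have phit : 0 < phi (t *: (w - y) + y).
    have := hd t (ltac:(by rewrite t0)); rewrite subr0 ler_norml => /andP[h _].
    have : 0 < t * ((\sum_i (w - y) ord0 i * dphi i y) / 2) by rewrite mulr_gt0.
    move: h; move: (\sum_i _) (phi _) => S ph; lra.
  have [e1 e10 he1] := open_eps oU Ut.
  have [e2 e20 he2] := continuous_eps (proj1 (Hphi _ Ut)) phit.
  have e12 : 0 < Num.min e1 e2 by rewrite lt_min e10.
  have [y' Dy' ] := closure_eps cy e12; rewrite lt_min => /andP[ye1 ye2].
  have Dp : D (t *: (w - y') + y') by apply: segment_in => //; rewrite ltW ?(ltW t1).
  have E : t *: (w - y') + y' - (t *: (w - y) + y) = (1 - t) *: (y' - y).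
    by apply/rowP => i; rewrite !mxE; ring.
  have small (a : R) : `|y' - y| < a -> `|t *: (w - y') + y' - (t *: (w - y) + y)| < a.
    move=> h; rewrite E normrZ; apply: le_lt_trans h; rewrite ler_piMl // ger0_norm ?subr_ge0 ?(ltW t1) //.
    by rewrite gerBl ltW.
  have Up := he1 _ (small _ ye1); have := he2 _ (small _ ye2).
  have := (DU _ Up).1 Dp; rewrite ltr_norml => h /andP[h1 _].
  by lra.
(* Strictness: as [D] is open, [z] can be pushed a little along [grad phi (y)] without leaving
   it. *)
move=> Dz; have [r r0 hr] := open_eps oD Dz.
pose p : V := \row_i dphi i y.
pose k : R := `|p| + 1.
have k0 : 0 < k by rewrite /k ltr_wpDl.
pose t : R := r / k / 2.
have t0 : 0 < t by rewrite !divr_gt0.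
have Dw : D (t *: p + z).
  apply: hr; rewrite addrK normrZ (gtr0_norm t0); apply: (@le_lt_trans _ _ (t * k)).
    by apply: ler_wpM2l; [exact: ltW|rewrite /k lerDl].
  by rewrite -ltr_pdivlMr // /t; have : 0 < r / k by [rewrite divr_gt0]; lra.
have := le0 _ Dw.
rewrite (eq_bigr (fun i => (z - y) ord0 i * dphi i y + t * dphi i y ^+ 2)); last first.
  by move=> i _; rewrite !mxE; ring.
rewrite big_split /= -mulr_sumr.
have : 0 < t * \sum_i dphi i y ^+ 2.
  rewrite mulr_gt0 // (bigD1 j) //=; apply: ltr_wpDr; first by apply: sumr_ge0 => i _; exact: sqr_ge0.
  by rewrite lt_neqAle eq_sym sqrf_eq0 pj sqr_ge0.
move: (\sum_i _) (t * _) => a b; lra.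
Qed.

Definition e0v : V := \row_i e0 i.

(** At the point [y] where the segment leaves [D], the vector [x - y] is a multiple of [e0], tangent
    to the frontier by [e0_tangent]; this contradicts the strict inequality of [support_lt]. *)
Lemma D_translate x (t : R) : D x -> D (t *: e0v + x).
Proof.
move=> Dx; apply: contrapT => Dt.
pose A := [set s : R | 0 <= s <= 1 /\ D ((s * t) *: e0v + x)].
have A0 : A 0 by split; [rewrite lexx ler01|rewrite mul0r scale0r add0r].
have supA : has_sup A by split; [exists 0|exists 1 => s [/andP[]]].
pose s := sup A.
have s01 : 0 <= s <= 1.
  apply/andP; split; first exact: sup_upper_bound supA _ A0.
  by apply: ge_sup; [exists 0|move=> z [/andP[]]].
pose y := (s * t) *: e0v + x.
have lineE (a b : R) : `|(a * t) *: e0v + x - ((b * t) *: e0v + x)| = `|a - b| * (`|t| * `|e0v|).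
  have -> : (a * t) *: e0v + x - ((b * t) *: e0v + x) = ((a - b) * t) *: e0v.
    by apply/rowP => i; rewrite !mxE; ring.
  by rewrite normrZ normrM mulrA.
pose k : R := `|t| * `|e0v| + 1.
have k0 : 0 < k by rewrite ltr_wpDl // mulr_ge0.
have lineB (a b d : R) : 0 < d -> `|a - b| < d / k -> `|(a * t) *: e0v + x - ((b * t) *: e0v + x)| < d.
  move=> d0 h; rewrite lineE; apply: (@le_lt_trans _ _ (`|a - b| * k)).
    by apply: ler_wpM2l => //; rewrite /k lerDl.
  by rewrite -ltr_pdivlMr.
have Dy : ~ D y.
  move=> Dy; have [d d0 hd] := open_eps oD Dy.
  have s1 : s < 1.
    rewrite lt_neqAle (andP s01).2 andbT; apply/eqP => s1.
    by apply: Dt; move: Dy; rewrite /y s1 mul1r.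
  have dk : 0 < d / k by rewrite divr_gt0.
  pose s' := Num.min 1 (s + d / k / 2).
  have ss' : s < s' by rewrite lt_min s1 /= ltrDl divr_gt0.
  have : s' <= s.
    apply: sup_upper_bound => //; split.
      by rewrite (le_trans (andP s01).1 (ltW ss')) ge_min lexx.
    apply: hd; apply: lineB => //; rewrite gtr0_norm ?subr_gt0 // ltrBlDl.
    by rewrite /s' gt_min; apply/orP; right; lra.
  by rewrite leNgt ss'.
have cy : closure D y.
  move=> B /nbhs_eps[d d0 hd].
  have dk : 0 < d / k by rewrite divr_gt0.
  have [s1 As1] := sup_adherent dk supA; rewrite -/s => hs.
  have s1s : s1 <= s := sup_upper_bound supA As1.
  exists ((s1 * t) *: e0v + x); split; first by case: As1.
  by apply: hd; apply: lineB => //; rewrite distrC ger0_norm ?subr_ge0 //; lra.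
have [U [phi [dphi [d2phi HC]]]] := s_chart HS cy Dy.
have := support_lt cy Dy HC Dx.
rewrite (eq_bigr (fun i => - (s * t) * (e0 i * dphi i y))).
  by rewrite -mulr_sumr (e0_tangent cy Dy HC) mulr0 ltxx.
by move=> i _; rewrite !mxE; ring.
Qed.

Lemma dotv_e0v : dotv e0v e0v = 1.
Proof. by rewrite -sum_sqr_e0; apply: eq_bigr => i _; rewrite mxE expr2. Qed.

Lemma dote_dotv x : dote x = dotv x e0v.
Proof. by apply: eq_bigr => i _; rewrite [e0v _ _]mxE. Qed.

Lemma dote_e0v : dote e0v = 1. Proof. by rewrite dote_dotv dotv_e0v. Qed.

(** The line through [x0] with direction [e0], parametrized so that [dote (axis t) = t]: by
    [u_increment], [u x] equals the value of [u] at the point of this line with the same [dote]. *)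
Definition axis (t : R) : V := t *: e0v + (x0 - dote x0 *: e0v).

Lemma axisE t : axis t = (t - dote x0) *: e0v + x0.
Proof. by apply/rowP => i; rewrite !mxE; ring. Qed.

Lemma D_axis t : D (axis t).
Proof. by rewrite axisE; exact: D_translate. Qed.

Lemma dote_axis t : dote (axis t) = t.
Proof. by rewrite axisE doteD doteZ dote_e0v mulr1 subrK. Qed.

Definition profile (t : R) : R := u (axis t).

Lemma u_profile x : D x -> u x = profile (dote x).
Proof.
move=> Dx; have [z _ E] := u_increment (D_axis (dote x)) Dx.
by apply/eqP; rewrite -subr_eq0 E doteB dote_axis subrr mulr0.
Qed.

Lemma is_derive_profile (t : R) : is_derive t 1 profile (v (axis t)).
Proof.
have H := C1g_line oD (s_u HS) (D_axis t); apply: (is_derive_congr H) => //.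
by apply: eq_bigr => i _; rewrite mxE.
Qed.

Lemma is_derive_v_axis (t : R) : is_derive t 1 (fun t => v (axis t)) (- f (profile t)).
Proof.
have H := C1g_line oD (C1_v HS e0) (D_axis t); apply: (is_derive_congr H) => //.
have Dx := D_axis t; set x := axis t in Dx *.
rewrite -(s_pde HS Dx); apply: eq_bigr => i _; rewrite mxE.
have H2 : C1g D (u1 i) (fun j x => e0 i * v1 j x).
  by apply: (C1g_eq (C1gZ (e0 i) (C1_v HS e0)) oD) => y Dy; rewrite -grad_e0.
by rewrite (C1g_uniq i (s_u1 HS i) H2 Dx).
Qed.

Lemma profile_mono s t : s <= t -> profile s <= profile t.
Proof.
move=> st; have [z Dz E] := u_increment (D_axis s) (D_axis t).
by rewrite -subr_ge0 E doteB !dote_axis mulr_ge0 ?subr_ge0 // ltW // v_gt0.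
Qed.

Lemma u_profile_closure : {within closure D, continuous u} ->
  forall x, closure D x -> u x = profile (dote x).
Proof.
move=> cu x cx; have h1 := ext_within cu (fun y _ => erefl) cx.
apply: (limin_uniq cx h1).
have h2 : limin D (fun y => profile (dote y)) x (profile (dote x)).
  apply: (@limin_comp _ _ D dote profile); last exact: is_derive_continuous1 (is_derive_profile _).
  apply: limin_sum => i _; apply: liminM; last exact: limin_cst.
  by apply: limin_cont; have [] := @C1g_coord R n.+1 setT i x I.
by apply: limin_eq h2 => y Dy; rewrite u_profile.
Qed.

End nonconstant.

Lemma constant_case (x0 : V) : {within closure D, continuous u} -> D x0 ->
  (forall x i, D x -> u1 i x = 0) -> forall x, closure D x -> u x = u x0.
Proof.
move=> cu Dx0 h0; have uc x : D x -> u x = u x0.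
  move=> Dx; have [k k01] := @C1g_MVT R n.+1 D u u1 x0 (x - x0) oD (s_u HS) (fun t => segment_in Dx Dx0).
  rewrite subrK big1 => [/eqP|i _]; first by rewrite subr_eq0 => /eqP.
  by rewrite h0 ?mulr0 //; exact: segment_in.
move=> x cx; have h1 := ext_within cu (fun y _ => erefl) cx.
apply: (limin_uniq cx h1); have h2 := @limin_cst R V D x (u x0).
by apply: limin_eq h2 => y Dy; rewrite uc.
Qed.

(** If [f'] were positive at the constant value, testing with [cutoff k] would bound [f'] times the
    integral of [cutoff k ^ 2] by an energy tending to [0], although for large [k] this integral is
    at least that of a fixed [cutoff k0], which equals [1] at [x0]. *)
Lemma constant_stable (x0 : V) : D x0 -> (forall x, D x -> u x = u x0) ->
  f (u x0) = 0 /\ f' (u x0) <= 0.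
Proof.
move=> Dx0 uc.
have Hc : C1g D u (fun _ _ => 0).
  by apply: (C1g_eq (@C1g_cst R n.+1 D (u x0)) oD) => x Dx; rewrite uc.
have Hu1 i : C1g D (u1 i) (fun _ _ => 0).
  apply: (C1g_eq (@C1g_cst R n.+1 D 0) oD) => x Dx.
  by rewrite (C1g_uniq i Hc (s_u HS) Dx).
split.
  have := s_pde HS Dx0; rewrite big1 => [/eqP|i _]; first by rewrite eq_sym oppr_eq0 => /eqP.
  exact: (C1g_uniq i (s_u1 HS i) (Hu1 i) Dx0).
rewrite leNgt; apply/negP => fp.
have [k0 hk0] := @cutoff_near R n `|x0|.
pose J := \int[mu]_(x in D) cutoff k0 x ^+ 2.
have i2 k : ibl D (fun x => cutoff k x ^+ 2) /\ ibl D (fun x => \sum_i dcutoff k i x ^+ 2).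
  have [[lc bc] id] := adm_ibl oD (cutoff_adm D k); split.
    by split; [exact: lcbX|exact: bsuppX bc].
  by apply: ibl_sum => i _; have [l b] := id i; split; [exact: lcbX|exact: bsuppX b].
have [rho rho0 hrho] := @cutoff_supp R n k0.
have [k1 hk1] := @cutoff_near R n rho.
have Jle0 k : (k1 <= k)%N -> f' (u x0) * J <= 64 * C / k.+1%:R.
  move=> kk; apply: le_trans (cutoff_energy oD C0 hC k).
  have := hQ (cutoff_adm D k); rewrite /stabform.
  have [iA iB] := i2 k; have [iC _] := i2 k0.
  rewrite (eq_int_rV (G := fun x => \sum_i dcutoff k i x ^+ 2 - f' (u x0) * cutoff k x ^+ 2)); last first.
    by move=> x Dx; rewrite /c uc.
  rewrite int_rVB //; last exact: iblZ.
  rewrite subr_ge0; apply: le_trans; rewrite -int_rVZ //; apply: le_int_rV => //; try exact: iblZ.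
  move=> x Dx; apply: ler_wpM2l; first exact: ltW.
  have /andP[a0 a1] := cutoff_bounds k x; have /andP[b0 b1] := cutoff_bounds k0 x.
  rewrite ler_pXn2r ?nnegrE //; have [xr|xr] := leP `|x| rho.
    by rewrite (hk1 k kk x xr).1.
  rewrite hrho //; apply: lt_le_trans (norm_qdist 0 x); rewrite subr0.
  by rewrite ltr_pXn2r ?nnegrE.
have Jn : J <= 0.
  rewrite leNgt; apply/negP => Jp.
  have p0 : 0 < f' (u x0) * J by rewrite mulr_gt0.
  have /cvgr0Pnorm_lt/(_ _ p0)[k2 _ hk2] := @cvg_harmonic_scale R (64 * C).
  have := hk2 (maxn k1 k2) (leq_maxr _ _); have := Jle0 (maxn k1 k2) (leq_maxl _ _).
  move=> h1 h2; have := le_lt_trans (le_trans h1 (ler_norm _)) h2.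
  by rewrite ltxx.
have [iC _] := i2 k0.
have := ge0_int_rV_eq0 oD iC (fun x _ => sqr_ge0 _) Jn Dx0.
rewrite (hk0 k0 (leqnn _) x0 (lexx _)).1 expr1n => /eqP; rewrite oner_eq0 //.
Qed.

End flatness.

(** * Cylinders and one-dimensional profiles *)

Section cylinder.
Context {R : realType} {n : nat}.
Local Notation V := 'rV[R]_n.+1.

Lemma mulmx_tr_dotv (x : V) : x *m x^T = (dotv x x)%:M.
Proof. by rewrite [LHS]mx11_scalar mxE; congr (_%:M); apply: eq_bigr => i _; rewrite mxE. Qed.

(** For [a] distinct from [b], the reflection in the hyperplane orthogonal to [w = a - b], where
    [|w| ^ 2 = 2 (1 - s)]. *)
Lemma householder (a b : V) : a *m a^T = 1%:M -> b *m b^T = 1%:M ->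
  exists Q : 'M[R]_n.+1, Q *m Q^T = 1%:M /\ a *m Q = b.
Proof.
move=> aa bb; have [->|ab] := eqVneq a b; first by exists 1%:M; rewrite trmx1 mul1mx mulmx1.
pose w := a - b; pose s := (a *m b^T) ord0 ord0.
have sE : a *m b^T = s%:M by rewrite [LHS]mx11_scalar.
have sE' : b *m a^T = s%:M.
  by rewrite -[LHS]trmxK trmx_mul trmxK sE tr_scalar_mx.
have ww : w *m w^T = (2 * (1 - s))%:M.
  rewrite /w linearB /= mulmxBl !mulmxBr aa bb sE sE'.
  by apply/matrixP => i j; rewrite !mxE; ring.
have aw : a *m w^T = (1 - s)%:M.
  by rewrite /w linearB /= mulmxBr aa sE; apply/matrixP => i j; rewrite !mxE; ring.
have s1 : 1 - s != 0.
  apply/eqP => s1; move: ww; rewrite s1 mulr0 => ww.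
  have : dotv w w = 0.
      have := congr1 (fun A : 'M[R]_1 => A ord0 ord0) ww.
    by rewrite mulmx_tr_dotv !mxE mul0rn eqxx mulr1n.
  move/eqP; rewrite psumr_eq0 => [/allP h|i _]; last by rewrite -expr2 sqr_ge0.
  move/eqP: ab; apply; apply/rowP => i; apply/eqP; rewrite -subr_eq0.
  by have := h i (mem_index_enum i); rewrite /= mulf_eq0 orbb /w !mxE.
pose Q : 'M[R]_n.+1 := 1%:M - (1 - s)^-1 *: (w^T *m w).
have QT : Q^T = Q.
  by rewrite /Q linearB /= trmx1 linearZ /= trmx_mul trmxK.
exists Q; split.
  have E (X : 'M[R]_n.+1) : (1%:M - X) *m (1%:M - X) = 1%:M - X - (X - X *m X).
    by rewrite mulmxBl mul1mx (mulmxBr X) mulmx1.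
  rewrite QT /Q E -scalemxAl -scalemxAr mulmxA -(mulmxA w^T) ww mul_mx_scalar -!scalemxAl !scalerA.
  have -> : (1 - s)^-1 * ((1 - s)^-1 * (2 * (1 - s))) = (1 - s)^-1 + (1 - s)^-1 by field.
  by rewrite scalerDl opprB addrK subrK.
by rewrite /Q mulmxBr mulmx1 -scalemxAr mulmxA aw mul_scalar_mx scalerA mulVf // scale1r /w opprB addrC subrK.
Qed.

Lemma row_decomp (x : V) :
  x = x ord0 ord0 *: delta_mx ord0 ord0 + (row_mx (0 : 'M[R]_(1, 1)) (@rsubmx _ 1 1 n x) : 'M[R]_(1, 1 + n)).
Proof.
apply/rowP => i; rewrite [RHS]mxE mxE.
have [j ->|j ->] := @split_ordP 1 n i.
  rewrite (@row_mxEl _ 1 1 n) !mxE addr0 ord1.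
  have -> : @lshift 1 n ord0 = ord0 by exact/val_inj.
  by rewrite eqxx mulr1.
by rewrite (@row_mxEr _ 1 1 n) !mxE -val_eqE /= mulr0 add0r.
Qed.

(** After an orthogonal map taking the first axis to [e], the cross-section is the slice of [D] at
    first coordinate [0]. *)
Lemma translate_cylinder (D : set V) (e : V) : dotv e e = 1 ->
  (forall x (t : R), D x -> D (t *: e + x)) -> straight_cylinder D.
Proof.
move=> e1 De; pose a : V := delta_mx ord0 ord0.
have one (z : V) : dotv z z = 1 -> z *m z^T = 1%:M by rewrite mulmx_tr_dotv => ->.
have aa : dotv a a = 1.
  rewrite /dotv (bigD1 ord0) //= big1 => [|i i0]; first by rewrite !mxE eqxx mulr1 addr0.
  by rewrite !mxE (negbTE i0) mulr0.
have [Q [QQ aQ]] := householder (one a aa) (one e e1).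
have QtQ : Q^T *m Q = 1%:M by exact: mulmx1C.
exists Q, 0, [set y | D ((row_mx (0 : 'M[R]_(1, 1)) y : 'M[R]_(1, 1 + n)) *m Q)]; split=> //.
have key (x : V) : x *m Q = x ord0 ord0 *: e + (row_mx (0 : 'M[R]_(1, 1)) (@rsubmx _ 1 1 n x) : 'M[R]_(1, 1 + n)) *m Q.
  by rewrite {1}[x]row_decomp mulmxDl -scalemxAl aQ.
apply/seteqP; split=> [z Dz|z [x /= h <-]].
  exists (z *m Q^T); last by rewrite /rigid_motion -mulmxA QtQ mulmx1 addr0.
  have := key (z *m Q^T); rewrite -mulmxA QtQ mulmx1 => zE /=.
  have := De z (- (z *m Q^T) ord0 ord0) Dz.
  by rewrite {2}zE addrA -scalerDl addNr scale0r add0r.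
by rewrite /rigid_motion addr0 key; exact: De.
Qed.

End cylinder.

(** * Bounded increasing profiles *)

Section one_dimensional.
Context {R : realType}.
Implicit Types (f g h F : R -> R).

Lemma MVT_all g h (s t : R) : s <= t -> (forall x : R, is_derive x 1 g (h x)) ->
  exists2 c, s <= c <= t & g t - g s = h c * (t - s).
Proof.
move=> st gh; have cg : {within `[s, t], continuous g}.
  by apply: continuous_in_subspaceT => x _; exact: is_derive_continuous1 (gh x).
by have [k] := @MVT_segment R g h s t st (fun x _ => gh x) cg; rewrite in_itv; exists k.
Qed.

Lemma antiderivative f (a b : R) : continuous f -> a <= b -> exists F,
  (forall x : R, a <= x <= b -> is_derive x 1 F (f x)) /\
  \int[lebesgue_measure]_(t in `[a, b]) f t = F b - F a.
Proof.
(* The integral starts at [a - 1], and [b + 1] serves as right end below, so that the derivatives at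
   [a] and [b] are two-sided. *)
move=> cf ab; pose F x := \int[lebesgue_measure]_(t in `[a - 1, x]) f t.
have fi (c d : R) : lebesgue_measure.-integrable `[c, d] (EFin \o f).
  apply: continuous_compact_integrable; first exact: segment_compact.
  by apply: continuous_subspaceT.
exists F; split.
  move=> x /andP[ax xb]; have bx : x < b + 1 by lra.
  have [d1 d2] := @continuous_FTC1_closed R f (a - 1) x (b + 1) bx (fi _ _) (ltac:(lra)) (cf x).
  by have := derivableP d1; rewrite -derive1E d2.
rewrite /F (@Rintegral_itvB R f (BLeft (a - 1)) (BRight b) a) //; last by rewrite bnd_simp; lra.
rewrite Rintegral_itv_obnd_cbnd //.
by apply: integrableS (fi a b) => //; apply: subset_itvr; rewrite bnd_simp.
Qed.

(** [z] is the supremum of [g]. A speed [h] bounded below by a positive number would push [g] beyond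
    [M]; hence [f <= 0] cannot hold just below [z], since [h] would be nondecreasing from some time
    on. This excludes [f z < 0] and, once [f z = 0], also [f' z > 0]; and [f z > 0] would drive [h]
    to negative values. *)
Lemma profile_limit f f' g h (M : R) : (forall t : R, is_derive t 1 f (f' t)) -> continuous f' ->
  (forall t : R, is_derive t 1 g (h t)) -> (forall t : R, is_derive t 1 h (- f (g t))) ->
  (forall t, 0 < h t) -> (forall t, g t <= M) ->
  exists z, [/\ g t @[t --> +oo] --> z, f z = 0, f' z <= 0, forall t, g t < z &
    forall e : R, 0 < e -> exists2 t, z - e < g t & h t < e].
Proof.
move=> df cf' dg dh h0 gM.
have mono s t : s < t -> g s < g t.
  move=> st; have [c _ E] := MVT_all (ltW st) dg.
  by rewrite -subr_gt0 E mulr_gt0 // subr_gt0.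
have monoW s t : s <= t -> g s <= g t by rewrite le_eqVlt => /predU1P[->//|/mono/ltW].
have bg : has_ubound (range g) by exists M => _ [t _ <-].
have sg : has_sup (range g) by split=> //; exists (g 0), 0.
pose z := sup (range g).
have gz t : g t < z by apply: lt_le_trans (mono t (t + 1) _) _; [lra|apply: sup_upper_bound => //; exists (t + 1)].
have near (e : R) : 0 < e -> exists T, forall t, T <= t -> z - e < g t.
  move=> e0; have [_ [T _ <-] hT] := sup_adherent e0 sg.
  by exists T => t /monoW; exact: lt_le_trans.
have nolow (c T : R) : 0 < c -> ~ forall t, T <= t -> c <= h t.
  move=> c0 hc; pose t := T + ((M - g T) / c + 1).
  have Mg : 0 <= (M - g T) / c by rewrite divr_ge0 ?subr_ge0 // ltW.
  have Tt : T <= t by rewrite /t; lra.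
  have [k /andP[k1 _] E] := MVT_all Tt dg.
  have : c * (t - T) <= g t - g T by rewrite E ler_wpM2r ?subr_ge0 // hc.
  rewrite /t addrAC subrr add0r mulrDr mulr1 mulrC divfK ?gt_eqF // => h1.
  by have := gM t; rewrite /t; lra.
have noneg (e : R) : 0 < e -> ~ forall s, z - e < s < z -> f s <= 0.
  move=> e0 hf; have [T hT] := near e e0.
  apply: (nolow (h T) T) => // t Tt; have [k /andP[k1 _] E] := MVT_all Tt dh.
  rewrite -subr_ge0 E mulr_ge0 ?subr_ge0 // oppr_ge0; apply: hf.
  by rewrite hT //= gz.
have cf x : {for x, continuous f} by exact: is_derive_continuous1 (df x).
have fz0 : f z = 0.
  apply/eqP; rewrite eq_le; apply/andP; split; rewrite leNgt; apply/negP => fz.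
    have fz2 : 0 < f z / 2 by rewrite divr_gt0.
    have [d d0 hd] := continuous_eps (cf z) fz2.
    have [T hT] := near d d0.
    have low t : T <= t -> f z / 2 <= f (g t).
      move=> Tt; have h1 := hT t Tt; have h2 := gz t.
      have := hd (g t); rewrite ltr0_norm ?subr_lt0 // => /(_ ltac:(lra)).
      by rewrite ltr_norml => /andP[]; lra.
    pose t := T + h T / (f z / 2).
    have Tt : T <= t by rewrite /t lerDl divr_ge0 // ltW.
    have [k /andP[k1 _] E] := MVT_all Tt dh.
    have h1 : f z / 2 * (t - T) <= f (g k) * (t - T) by rewrite ler_wpM2r ?subr_ge0 // low.
    have h2 : f z / 2 * (t - T) = h T by rewrite /t addrAC subrr add0r mulrC divfK // gt_eqF.
    have := h0 t; move: E; rewrite mulNr; lra.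
  have fz2 : 0 < - f z by rewrite oppr_gt0.
  have [d d0 hd] := continuous_eps (cf z) fz2.
  apply: (noneg d d0) => s /andP[s1 s2].
  have := hd s; rewrite ltr0_norm ?subr_lt0 // => /(_ ltac:(lra)).
  by rewrite ltr_norml => /andP[]; lra.
exists z; split=> //.
- exact: nondecreasing_cvgr.
- rewrite leNgt; apply/negP => fz.
  have [d d0 hd] := continuous_eps (cf' z) fz.
  apply: (noneg d d0) => s /andP[s1 s2].
  have [k /andP[k1 k2] E] := MVT_all (ltW s2) df.
  have : 0 < f' k.
    have := hd k; rewrite ler0_norm ?subr_le0 // => /(_ ltac:(lra)).
    by rewrite ltr_norml => /andP[]; lra.
  by move: E; rewrite fz0 sub0r => E; rewrite -oppr_ge0 E => ?; rewrite mulr_ge0 ?ltW ?subr_gt0.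
move=> e e0; have [T hT] := near e e0.
apply: contrapT => H; apply: (nolow e T e0) => t Tt.
by rewrite leNgt; apply/negP => ht; apply: H; exists t => //; exact: hT.
Qed.

Lemma is_derive_reflect g (t d : R) : is_derive (- t) 1 g d -> is_derive t 1 (fun t => g (- t)) (- d).
Proof.
move=> H; have h := @is_derive1_comp R g -%R t _ _ H (is_deriveN (is_derive_id t 1)).
by apply: (is_derive_congr h) => //; rewrite mulrN1.
Qed.

Lemma is_derive_opp g (t d : R) : is_derive t 1 g d -> is_derive t 1 (fun t => - g t) (- d).
Proof. by move=> H; exact: (@is_deriveN R R R g t 1 d H). Qed.

(* The second limit is obtained by reflecting [g] and [f] through the origin; the energy
   [h ^ 2 / 2 + F (g)] is constant, where [F' = f], and [h] tends to [0] along sequences. *)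
Lemma bounded_profile f f' g h (B : R) : (forall t : R, is_derive t 1 f (f' t)) -> continuous f' ->
  (forall t : R, is_derive t 1 g (h t)) -> (forall t : R, is_derive t 1 h (- f (g t))) ->
  (forall t, 0 < h t) -> (forall t, `|g t| <= B) ->
  exists zm zp, [/\ f zm = 0 /\ f' zm <= 0, f zp = 0 /\ f' zp <= 0,
    g t @[t --> -oo] --> zm, g t @[t --> +oo] --> zp & oriented_integral f zm zp = 0].
Proof.
move=> df cf' dg dh h0 gB.
have [zp [gp fp f'p gzp appr]] := profile_limit df cf' dg dh h0 (fun t => le_trans (ler_norm _) (gB t)).
pose g2 t := - g (- t); pose h2 t := h (- t); pose f2 t := - f (- t); pose f2' t := f' (- t).
have df2 (t : R) : is_derive t 1 f2 (f2' t).
  by apply: (is_derive_congr (is_derive_opp (is_derive_reflect (df (- t))))) => //; rewrite opprK.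
have cf2 : continuous f2' by move=> t; apply: continuous_comp; [exact: opp_continuous|exact: cf'].
have dg2 (t : R) : is_derive t 1 g2 (h2 t).
  by apply: (is_derive_congr (is_derive_opp (is_derive_reflect (dg (- t))))) => //; rewrite opprK.
have dh2 (t : R) : is_derive t 1 h2 (- f2 (g2 t)).
  by apply: (is_derive_congr (is_derive_reflect (dh (- t)))) => //; rewrite /f2 /g2 !opprK.
have g2B t : g2 t <= B by apply: le_trans (ler_norm _) _; rewrite normrN.
have [z2 [gm fm f'm gzm apprm]] := profile_limit df2 cf2 dg2 dh2 (fun t => h0 (- t)) g2B.
have zmg t : - z2 < g t by have := gzm (- t); rewrite /g2 opprK ltrNl.
have zz : - z2 < zp by apply: lt_trans (zmg 0) (gzp 0).
have cf : continuous f by move=> x; exact: is_derive_continuous1 (df x).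
exists (- z2), zp; split=> //.
- by split=> //; apply/eqP; rewrite -oppr_eq0; apply/eqP.
- apply/cvgNy_compNP; rewrite (_ : g \o -%R = fun t => - g2 t); last by apply/funext => t; rewrite /g2 opprK.
  exact: cvgN.
rewrite /oriented_integral ltW //.
have [F [dF ->]] := antiderivative cf (ltW zz).
have const s t : h s ^+ 2 / 2 + F (g s) = h t ^+ 2 / 2 + F (g t).
  apply: (@is_derive_0_is_cst R (fun t => h t ^+ 2 / 2 + F (g t))) => x.
  have d1 : is_derive (x : R) 1 (fun t => h t ^+ 2 / 2) (- (h x * f (g x))).
    have h1 := @is_derive1_comp R (fun t => t ^+ 2) h x _ _ (is_derive_pow 1 (h x)) (dh x).
    have h2' := @is_deriveZ R R R _ 2^-1 x 1 _ h1.
    by apply: (is_derive_congr h2') => [z|]; rewrite /GRing.scale /= ?expr1; [rewrite mulrC|field].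
  have d2 : is_derive (x : R) 1 (fun t => F (g t)) (f (g x) * h x).
    by apply: (@is_derive1_comp R F g x _ _ _ (dg x)); apply: dF; rewrite !ltW.
  have d3 := @is_deriveD R R R _ _ x 1 _ _ d1 d2.
  by apply: (is_derive_congr d3) => //; ring.
pose E := h 0 ^+ 2 / 2 + F (g 0).
have FE z : {for z, continuous F} -> (forall e : R, 0 < e -> exists2 t, `|g t - z| < e & h t < e) -> F z = E.
  move=> cF ap; apply/eqP; rewrite -subr_eq0 -normr_le0 leNgt; apply/negP => p.
  have p2 : 0 < `|F z - E| / 2 by rewrite divr_gt0.
  have [d d0 hd] := continuous_eps cF p2.
  (* As [h t] is also below [1], its square is smaller than [|F z - E|]. *)
  pose e : R := Num.min d (Num.min 1 (`|F z - E|)).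
  have e0 : 0 < e by rewrite !lt_min d0 ltr01.
  have [t + +] := ap e e0; rewrite !lt_min => /andP[td _] /and3P[_ b2 b3].
  have b1 := hd (g t) td.
  have E1 : E = h t ^+ 2 / 2 + F (g t) := const 0 t.
  have ht := h0 t.
  have b4 : h t ^+ 2 < `|F z - E| by nra.
  have : `|F z - E| <= `|F (g t) - F z| + h t ^+ 2 / 2.
    have -> : F z - E = - (F (g t) - F z) - h t ^+ 2 / 2 by rewrite E1; ring.
    apply: le_trans (ler_normB _ _) _; rewrite normrN lerD2l ger0_norm //.
    by rewrite divr_ge0 // sqr_ge0.
  lra.
have Fzp : F zp = E.
  apply: FE; first by apply: (@is_derive_continuous1 _ _ _ (f zp)); apply: dF; rewrite lexx ltW.
  move=> e e0; have [t t1 t2] := appr e e0; exists t => //.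
  by rewrite ltr0_norm ?subr_lt0 //; lra.
have Fzm : F (- z2) = E.
  apply: FE; first by apply: (@is_derive_continuous1 _ _ _ (f (- z2))); apply: dF; rewrite lexx ltW.
  move=> e e0; have [t t1 t2] := apprm e e0; exists (- t) => //.
  by have := gzm t; move: t1; rewrite /g2 => a b; rewrite ltr_norml; apply/andP; split; lra.
by rewrite Fzp Fzm subrr.
Qed.

End one_dimensional.

(** * The theorem *)

Section conversion.
Context {R : realType} {n : nat}.
Local Notation V := 'rV[R]_n.+1.
Local Notation mu := (@lebesgue_rV R n.+1).

Lemma limin_lim (D : set V) (g : V -> R) z l : closure D z -> limin D g z l ->
  lim (g @ within D (nbhs z)) = l.
Proof. by move=> cz h; have PF := within_nbhs_proper cz; apply: cvg_lim h; exact: norm_hausdorff. Qed.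

Lemma convex_segment (D : set V) x y (t : R) : convex_set D -> D x -> D y -> 0 <= t <= 1 ->
  D (t *: x + (1 - t) *: y).
Proof.
move=> cD Dx Dy ht; have := cD x y (Itv01 (proj1 (andP ht)) (proj2 (andP ht))) (mem_set Dx) (mem_set Dy).
by rewrite inE.
Qed.

Lemma neumann_chart (f : R -> R) (D : set V) u : open D -> smooth_boundary D -> neumann_solution f D u ->
  forall y, closure D y -> ~ D y -> exists U phi dphi d2phi,
    chart D (fun i => partial i u) y U phi dphi d2phi.
Proof.
move=> oD sm [_ hN _ _] y cy Dy.
have Fr z : closure D z -> ~ D z -> frontier D z.
  by move=> cz Dz; split=> // /interior_subset.
have [U [phi [oU Uy sphi gy DU]]] := sm y (Fr y cy Dy).
exists U, phi, (fun i => partial i phi), (fun i j => partial j (partial i phi)).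
have nz z : grad phi z != 0 -> exists j, partial j phi z != 0.
  move=> gz; apply: contrapT => h; move/eqP: gz; apply; apply/rowP => j; rewrite !mxE.
  by apply/eqP; apply/negPn/negP => hj; apply: h; exists j.
split=> //.
- split; first exact: Ck_on_C1g (sphi 1%N).
  by move=> i; apply: (@Ck_on_C1g _ _ 0); exact: Ck_on_partial (sphi 2%N).
- exact: nz.
move=> z tau Uz pz cz [j jz] ht.
have Dz : ~ D z by move=> /(DU z Uz); rewrite pz ltxx.
have gz : grad phi z != 0.
  by apply/eqP => h; move: jz; have := congr1 (fun r : V => r ord0 j) h; rewrite !mxE => ->; rewrite eqxx.
have Ng : enorm (grad phi z) != 0.
  apply/eqP => h; move: jz; have := sqr_enorm (grad phi z); rewrite h expr0n /= => /esym/eqP.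
  rewrite psumr_eq0 => [/allP h'|i _]; last exact: sqr_ge0.
  by have := h' j (mem_index_enum j); rewrite sqrf_eq0 mxE => /eqP ->; rewrite eqxx.
have := hN z ((enorm (grad phi z))^-1 *: grad phi z) (Fr z cz Dz) (ex_intro _ U (ex_intro _ phi (conj
  (And5 oU Uz sphi gz DU) erefl))).
rewrite /dotv (eq_bigr (fun i => (enorm (grad phi z))^-1 * (tau i * partial i phi z))); last first.
  move=> i _; have -> : grad_closure D u z ord0 i = tau i by rewrite mxE; exact: limin_lim.
  have -> : ((enorm (grad phi z))^-1 *: grad phi z) ord0 i = (enorm (grad phi z))^-1 * partial i phi z.
    by rewrite mxE; congr (_ * _); rewrite mxE.
  by rewrite mulrCA.
by rewrite -mulr_sumr => /eqP; rewrite mulf_eq0 invr_eq0 (negbTE Ng) => /eqP.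
Qed.

Lemma neumann_setup (f : R -> R) (D : set V) u : C1_R f -> is_domain D -> smooth_boundary D ->
  convex_set D -> neumann_solution f D u ->
  setup D f (derive1 f) u (fun i => partial i u) (fun i j => partial j (partial i u))
    (fun i j k => partial k (partial j (partial i u))).
Proof.
move=> [df cf'] [oD _ cD] sm conv Hs; have [pde _ Cu _] := Hs; have [Ck _ _] := Cu.
split=> //.
- by move=> x y t; exact: convex_segment.
- by move=> t; have := derivableP (df t); rewrite -derive1E.
- exact: Ck_on_C1g Ck.
- by move=> i; apply: (@Ck_on_C1g _ _ 1); exact: Ck_on_partial Ck.
- by move=> i j; apply: (@Ck_on_C1g _ _ 0); apply: Ck_on_partial; exact: Ck_on_partial Ck.
- exact: (@Ck_closure_ext _ _ 3 D u [::] oD Cu).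
- by move=> i; exact: (@Ck_closure_ext _ _ 3 D u [:: i] oD Cu).
- by move=> i j; exact: (@Ck_closure_ext _ _ 3 D u [:: j; i] oD Cu).
- by move=> i j k; exact: (@Ck_closure_ext _ _ 3 D u [:: k; j; i] oD Cu).
- by move=> x Dx; have /(congr1 -%R) := pde x Dx; rewrite opprK.
exact: neumann_chart oD sm Hs.
Qed.

End conversion.

Theorem theorem1p5 (R : realType) (n : nat) (f : R -> R)
  (Omega : set 'rV[R]_n.+1) (u : 'rV[R]_n.+1 -> R)
  (hf : C1_R f)
  (hdomain : is_domain Omega)
  (hsmooth : smooth_boundary Omega)
  (hconvex : convex_set Omega)
  (hgrowth : quadratic_growth Omega)
  (hsol : neumann_solution f Omega u)
  (hstable : stable f Omega u) :
  (~ straight_cylinder Omega -> constant_sol Omega u) /\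
  (straight_cylinder Omega ->
    (constant_sol Omega u \/ monotonic_flat Omega u) /\
    (bounded_sol Omega u ->
      exists zm zp : R, [/\ stable_root f zm, stable_root f zp,
        connects Omega u zm zp & oriented_integral f zm zp = 0])).
Proof.
have HS := neumann_setup hf hdomain hsmooth hconvex hsol.
have oD := s_open HS; have [_ [x0 Dx0] _] := hdomain.
have [_ _ [_ cu _] [M hM]] := hsol.
have {}hM := gradient_bound oD (s_u HS) hM.
have [C C0 hC] := quadratic_growth_bound oD hgrowth.
have hQ g dg : adm Omega g dg -> 0 <= stabform Omega (fun x => derive1 f (u x)) g dg g dg.
  by move=> Hg; exact: (stable_energy oD hstable (lcb_c HS) Hg).
(* Either the gradient vanishes identically, or there is a point [x1] from which the direction [e0]
   and the profile can be built. *)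
have [h0|/existsNP[x1 /existsNP[i /not_implyP[Dx1 hx1]]]] :=
  pselect (forall x i, Omega x -> partial i u x = 0).
  have uc := constant_case HS cu Dx0 h0.
  have cst : constant_sol Omega u by exists (u x0).
  split=> // _; split; first by left.
  move=> _; have [f0 f'0] := constant_stable HS C0 hC hQ Dx0 (fun x Dx => uc x (subset_closure Dx)).
  exists (u x0), (u x0); split=> //; first by left.
  by rewrite /oriented_integral lexx set_itv1 Rintegral_set1.
have nz : exists i, partial i u x1 != 0 by exists i; apply/eqP.
pose e := e0v (fun i => partial i u) x1.
pose g := profile u (fun i => partial i u) x1.
have e1 : dotv e e = 1 by exact: dotv_e0v nz.
have De x (t : R) : Omega x -> Omega (t *: e + x) by exact: (D_translate HS C0 hC hM hQ Dx1 nz).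
(* A nonconstant solution makes [Omega] a cylinder, so the first conclusion holds vacuously in this
   case. *)
have cyl := translate_cylinder e1 De.
have dE x : dote (fun i => partial i u) x1 x = dotv x e by exact: dote_dotv.
have fl : flat_profile Omega u e g.
  split; first by rewrite /enorm e1 sqrtr1.
  by move=> x cx; rewrite -dE; exact: (u_profile_closure HS C0 hC hM hQ Dx1 nz cu cx).
have mono : {homo g : s t / s <= t} by move=> s t; exact: (profile_mono HS C0 hC hM hQ Dx1 nz).
split=> // _; split; first by right; exists e, g; split=> //; left.
move=> [B hB]; have [df cf'] := hf.
pose h t := dirder (fun i => partial i u) (e0 (fun i => partial i u) x1) (axis (fun i => partial i u) x1 t).
have Dax t := D_axis HS C0 hC hM hQ Dx1 nz t.
have gB t : `|g t| <= B by apply: hB; exact: Dax.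
have h0 t : 0 < h t by exact: (v_gt0 HS C0 hC hM hQ Dx1 nz (Dax t)).
have dg (t : R) : is_derive t 1 g (h t) by exact: (is_derive_profile HS C0 hC hM hQ Dx1 nz t).
have dh (t : R) : is_derive t 1 h (- f (g t)) by exact: (is_derive_v_axis HS C0 hC hM hQ Dx1 nz t).
have ff (t : R) : is_derive t 1 f (derive1 f t) by exact: s_f HS t.
have [zm [zp [sm sp gm gp I0]]] := bounded_profile ff cf' dg dh h0 gB.
exists zm, zp; split=> //; right; exists e, g; split=> // t.
exists (axis (fun i => partial i u) x1 t); first exact: Dax.
by rewrite -dE; exact: dote_axis.
Qed.
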